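(* There exist a two-dimensional Riemannian manifold $M$ and a Bowen homeomorphism $f$ of $M$, with associated saddles $x_1,x_2$ and associated open set $V$, such that $$\mathcal O_{f|\overline V}=[\delta_{x_1},\delta_{x_2}],$$ where $[\delta_{x_1},\delta_{x_2}]=\{t\delta_{x_1}+(1-t)\delta_{x_2}:\ 0\le t\le1\}$.
   Context: A Bowen homeomorphism is a homeomorphism $f$ of a two-dimensional manifold $M$ which is non-singular (i.e. $m(f^{-1}(B))=0$ if and only if $m(B)=0$, where $m$ is the Lebesgue measure) and satisfies: (i) $f$ has three fixed points $x_1,x_2,x_3$. (ii) Restricted to the union of three small compact pairwise disjoint neighbourhoods $U_1,U_2,U_3$ of $x_1,x_2,x_3$ respectively, $f$ is a diffeomorphism onto $f(U_1\cup U_2\cup U_3)$; the fixed points $x_1,x_2$ are hyperbolic saddles and $x_3$ is a hyperbolic source. (iii) $W^s_1\setminus\{x_1\}=W^u_2\setminus\{x_2\}$ and $W^u_1\setminus\{x_1\}=W^s_2\setminus\{x_2\}$, where $W^{s}_{i},W^{u}_{i}$ denote half-branches of the global one-dimensional stable and unstable manifolds of $x_i$, $i=1,2$. They are embedded topological arcs, of $C^1$ type in a neighbourhood of the saddles. Thus $W^s_1\cup W^s_2$ is a compact, simple, closed arc, which is the boundary of an open set $V$ homeomorphic to a 2-ball. (iv) $x_3\in V$, and every orbit in $V\setminus\{x_3\}$ includes $x_1$ and $x_2$ in its $\omega$-limit set and has $\{x_3\}$ as $\alpha$-limit set. For $x\in M$, let $\nu_n(x)=\frac1n\sum_{j=0}^{n-1}\delta_{f^j(x)}$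 and let $\mathcal L^*(x)$ be the set of all weak$^*$-limits of convergent subsequences of $\{\nu_n(x)\}_{n\ge1}$. Fix a metric $\mathrm{dist}^*$ inducing the weak$^*$ topology on Borel probability measures. For a forward invariant set $B$ ($B\subset f^{-1}(B)$) of positive Lebesgue measure, $\mathcal O_{f|B}$ denotes the set of all SRB-like measures for $f|_B$: probability measures $\mu$ such that for all $\epsilon>0$ the set $\{x\in B:\ \mathrm{dist}^*(\mathcal L^*(x),\mu)<\epsilon\}$ has positive Lebesgue measure. Here $\mathrm{dist}^*(\mathcal L^*(x),\mu)$ is the distance from $\mu$ to the set $\mathcal L^*(x)$. *)

(* Defs.v *)
(* The real numbers are an arbitrary [R : realType] of MathComp-Analysis. *)
From HB Require Import structures.
From mathcomp Require Import all_boot all_order all_algebra.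
From mathcomp Require Import complex.
From mathcomp Require Import all_classical all_reals all_analysis.
Set Implicit Arguments.
Unset Strict Implicit.
Unset Printing Implicit Defensive.
Import Order.TTheory GRing.Theory Num.Theory.
Import numFieldTopology.Exports numFieldNormedType.Exports.

Local Open Scope classical_set_scope.
Local Open Scope ring_scope.

Notation borel T := (g_sigma_algebraType (@open T)).

(* h restricts to a homeomorphism of A onto B with inverse k; no condition is
   put on h outside A or on k outside B. *)
Definition homeo_between (S T : topologicalType) (h : S -> T) (k : T -> S)
    (A : set S) (B : set T) : Prop :=
  [/\ {within A, continuous h}, {within B, continuous k},
      h @` A = B, k @` B = A & forall x, A x -> k (h x) = x].

Definition homeo_onto (S T : topologicalType) (h : S -> T)
    (A : set S) (B : set T) : Prop := exists k, homeo_between h k A B.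

Section Calculus.
Variable R : realType.
Local Notation plane := (R * R)%type.

Definition coord (a : 'I_2) (y : plane) : R := if a == ord0 then y.1 else y.2.

Definition basis_vector (a : 'I_2) : plane :=
  if a == ord0 then (1, 0) else (0, 1).

(* f is C^k on U, meant for U open: all iterated partial derivatives up to
   order k exist and those of order k are continuous on U. *)
Fixpoint Ck (k : nat) (U : set plane) (f : plane -> R) : Prop :=
  if k is k'.+1 then
    forall b, (forall y, U y -> derivable f y (basis_vector b)) /\
              Ck k' U (fun y => 'D_(basis_vector b) f y)
  else forall y, U y -> {for y, continuous f}.

Definition Ck_map (k : nat) (U : set plane) (F : plane -> plane) : Prop :=
  forall a, Ck k U (coord a \o F).

Definition jacobian_mx (F : plane -> plane) (y : plane) : 'M[R]_2 :=
  \matrix_(a, b) 'D_(basis_vector b) (coord a \o F) y.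

Definition posdef (A : 'M[R]_2) : Prop :=
  A^T = A /\ forall v : 'cV[R]_2, v != 0 -> 0 < (v^T *m A *m v) ord0 ord0.

Definition plane_lebesgue :
    set (measurableTypeR R * measurableTypeR R) -> \bar R :=
  (@lebesgue_measure R \x @lebesgue_measure R)%E.

Definition spectrum (A : 'M[R]_2) : set R[i] :=
  [set z | eigenvalue (map_mx (real_complex R) A) z].

Definition saddle_mx (A : 'M[R]_2) : Prop :=
  [/\ (forall z, spectrum A z -> `|z| != 1),
      (exists2 z, spectrum A z & `|z| < 1) &
      (exists2 z, spectrum A z & 1 < `|z|)].

Definition source_mx (A : 'M[R]_2) : Prop :=
  forall z, spectrum A z -> 1 < `|z|.

Definition open_disc : set plane := [set y | y.1 ^+ 2 + y.2 ^+ 2 < 1].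

Definition unit_circle : set plane := [set y | y.1 ^+ 2 + y.2 ^+ 2 = 1].

End Calculus.

(* A smooth Riemannian 2-manifold without boundary.  The chart i is defined on
   [dom i], with inverse [param i]; the values of the total functions [chart i]
   outside [dom i], and of [param i] and [metric i] outside [chart i @` dom i],
   are irrelevant.  [metric i y] is the Gram matrix of the metric in the
   coordinates of the chart i.  [vol] is the Riemannian volume, i.e. the
   Lebesgue measure of the manifold: [volE] determines it. *)
Record riemannian_surface (R : realType) : Type := RiemannianSurface {
  carrier :> ptopologicalType ;
  surface_hausdorff : hausdorff_space carrier ;
  surface_second_countable : @second_countable carrier ;
  chart_index : Type ;
  dom : chart_index -> set carrier ;
  chart : chart_index -> carrier -> R * R ;
  param : chart_index -> R * R -> carrier ;
  metric : chart_index -> R * R -> 'M[R]_2 ;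
  vol : {measure set (borel carrier) -> \bar R} ;
  dom_open : forall i, open (dom i) ;
  dom_cover : forall p, exists i, dom i p ;
  chart_open : forall i, open (chart i @` dom i) ;
  chart_homeo : forall i,
    homeo_between (chart i) (param i) (dom i) (chart i @` dom i) ;
  transition_smooth : forall i j k,
    Ck_map k (chart i @` (dom i `&` dom j)) (chart j \o param i) ;
  metric_posdef : forall i y, (chart i @` dom i) y -> posdef (metric i y) ;
  metric_smooth : forall i k (a b : 'I_2),
    Ck k (chart i @` dom i) (fun y => metric i y a b) ;
  metric_compat : forall i j p, dom i p -> dom j p ->
    let J := jacobian_mx (chart j \o param i) (chart i p) in
    metric i (chart i p) = J^T *m metric j (chart j p) *m J ;
  volE : forall i (A : set (borel carrier)), measurable A -> A `<=` dom i ->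
    vol A = (\int[@plane_lebesgue R]_(y in chart i @` A)
              (Num.sqrt (\det (metric i y)))%:E)%E
}.

Section BowenHomeomorphism.
Variables (R : realType) (M : riemannian_surface R).
Implicit Types (f g F : M -> M) (x p : M) (B K O V W : set M).

Definition local_map (i j : chart_index M) F : R * R -> R * R :=
  chart j \o F \o param i.

Definition C1_map O F : Prop :=
  forall p, O p -> {for p, continuous F} /\
    forall i j, dom i p -> dom j (F p) ->
      exists U, [/\ open U, U (chart i p) & Ck_map 1 U (local_map i j F)].

(* On an arbitrary set K, as usual, f is C^1 when it coincides near each point
   of K with a C^1 map defined on an open set. *)
Definition C1_on K f : Prop :=
  forall p, K p -> exists O F,
    [/\ open O, O p, C1_map O F & forall q, (O `&` K) q -> F q = f q].

(* The restriction of the bijection f, with inverse g, to K. *)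
Definition diffeo_on K f g : Prop := C1_on K f /\ C1_on (f @` K) g.

(* The matrix is that of the differential of f at the fixed point x; its
   conjugacy class does not depend on the chart. *)
Definition hyperbolic_saddle f x : Prop :=
  forall i, dom i x -> saddle_mx (jacobian_mx (local_map i i f) (chart i x)).

Definition hyperbolic_source f x : Prop :=
  forall i, dom i x -> source_mx (jacobian_mx (local_map i i f) (chart i x)).

(* Global stable set of x; for a hyperbolic saddle it is the global stable
   manifold.  The unstable one is the stable one of the inverse map. *)
Definition stable_manifold f x : set M :=
  [set y | iter n f y @[n --> \oo] --> x].

Definition regular_C1_curve (D : set R) (c : R -> M) : Prop :=
  forall t, D t -> forall i, dom i (c t) ->
    (forall a : 'I_2, let u := coord a \o chart i \o c in
       derivable u t 1 /\ {for t, continuous (derive1 u)}) /\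
    exists a : 'I_2, derive1 (coord a \o chart i \o c) t != 0.

(* B is one of the two half-branches, x included, of the injectively immersed
   curve W through x; it is an embedded half-line, of class C^1 near x. *)
Definition half_branch W x B : Prop :=
  exists c : R -> M,
    [/\ continuous c, injective c, range c = W & c 0 = x] /\
    homeo_onto c `[0, +oo[ B /\
    exists2 d : R, 0 < d & regular_C1_curve `]-d, d[ c.

Definition simple_closed_curve (C : set M) : Prop :=
  exists c : R * R -> M, homeo_onto c (@unit_circle R) C.

Definition omega_limit f x : set M := cluster (iter n f x @[n --> \oo]).

Definition nonsingular f : Prop :=
  forall A : set (borel M), measurable A ->
    (vol M (f @^-1` A) = 0%E <-> vol M A = 0%E).

(* x1 and x2 are the saddles, x3 is the source, and V is the open disc of the
   definition of a Bowen homeomorphism; g is the inverse of f, W1s and W1u are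
   the stable and unstable half-branches of x1, W2s and W2u those of x2. *)
Definition bowen_homeomorphism f x1 x2 x3 V : Prop :=
  exists g, homeo_between f g setT setT /\
  nonsingular f /\
  [/\ f x1 = x1, f x2 = x2 & f x3 = x3] /\
  [/\ x1 <> x2, x1 <> x3 & x2 <> x3] /\
  (exists U1 U2 U3 : set M,
     [/\ nbhs x1 U1, nbhs x2 U2 & nbhs x3 U3] /\
     [/\ compact U1, compact U2 & compact U3] /\
     [/\ U1 `&` U2 = set0, U1 `&` U3 = set0 & U2 `&` U3 = set0] /\
     diffeo_on (U1 `|` U2 `|` U3) f g) /\
  [/\ hyperbolic_saddle f x1, hyperbolic_saddle f x2 &
      hyperbolic_source f x3] /\
  (exists W1s W1u W2s W2u : set M,
     [/\ half_branch (stable_manifold f x1) x1 W1s,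
         half_branch (stable_manifold g x1) x1 W1u,
         half_branch (stable_manifold f x2) x2 W2s &
         half_branch (stable_manifold g x2) x2 W2u] /\
     W1s `\ x1 = W2u `\ x2 /\
     W1u `\ x1 = W2s `\ x2 /\
     simple_closed_curve (W1s `|` W2s) /\
     closure V `\` V^° = W1s `|` W2s) /\
  open V /\
  (exists h : M -> R * R, homeo_onto h V (@open_disc R)) /\
  V x3 /\
  (forall x, V x -> x <> x3 ->
     [/\ omega_limit f x x1, omega_limit f x x2 &
         omega_limit g x = [set x3]]).

End BowenHomeomorphism.

Section WeakStar.
Variables (R : realType) (M : ptopologicalType).

Definition bounded_continuous : Type :=
  {phi : M -> R | continuous phi /\ exists c : R, forall x, `|phi x| <= c}.

HB.instance Definition _ := gen_eqMixin bounded_continuous.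
HB.instance Definition _ := gen_choiceMixin bounded_continuous.

Definition integrate (mu : probability (borel M) R) :
    {ptws bounded_continuous -> R} :=
  fun phi => (\int[mu]_x (sval phi) x)%R.

(* The Borel probability measures with the weak* topology: the coarsest one
   making mu |-> \int phi dmu continuous for all bounded continuous phi (M need
   not be compact). *)
Definition weakstar := initial_topology integrate.
HB.instance Definition _ := Topological.on weakstar.

(* Two [probability] structures denote the same measure when they agree on the
   measurable sets: their values on other sets are junk.  Hence the form of the
   separation axiom; it would be unsatisfiable with Leibniz equality. *)
Definition weakstar_metric
    (dist : probability (borel M) R -> probability (borel M) R -> R) : Prop :=
  [/\ forall mu nu, 0 <= dist mu nu,
      forall mu nu, dist mu nu = 0 <->
        (forall A : set (borel M), measurable A -> mu A = nu A),
      forall mu nu, dist mu nu = dist nu mu,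
      forall mu nu rho, dist mu rho <= dist mu nu + dist nu rho &
      forall mu : probability (borel M) R, nbhs (mu : weakstar) =
        filter_from [set e : R | 0 < e] (fun e => [set nu | dist mu nu < e])].

End WeakStar.

Section Empirical.
Variables (R : realType) (M : ptopologicalType) (f : M -> M) (x : M) (n : nat).

(* nu_{n+1}(x): the index is shifted so that it is always a probability. *)
Definition empirical : set (borel M) -> \bar R :=
  mscale (n.+1%:R^-1)%:nng
    (msum (fun j => \d_(iter j f x : borel M)) n.+1).

HB.instance Definition _ := Measure.on empirical.

Lemma empirical_setT : empirical setT = 1%E.
Proof.
rewrite /empirical /mscale /= /msum (eq_bigr (fun _ => 1%:E)); last first.
  by move=> j _; exact: diracT.
by rewrite sumEFin sumr_const card_ord -EFinM mulVf ?pnatr_eq0.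
Qed.

HB.instance Definition _ :=
  Measure_isProbability.Build _ _ R empirical empirical_setT.

End Empirical.

Section SRBLike.
Variables (R : realType) (M : ptopologicalType).
Implicit Types (f : M -> M) (mu : probability (borel M) R).

(* The set L^*(x) of the weak* limits of subsequences of nu_n(x), n >= 1. *)
Definition limit_measures f (x : M) : set (probability (borel M) R) :=
  [set mu | exists2 k : nat -> nat, {homo k : a b / (a < b)%N} &
     (empirical R f x (k j) : weakstar R M) @[j --> \oo] --> (mu : weakstar R M)].

(* Distance from mu to a set S; +oo if S is empty. *)
Definition dist_to_set
    (dist : probability (borel M) R -> probability (borel M) R -> R)
    (S : set (probability (borel M) R)) mu : \bar R :=
  ereal_inf [set (dist nu mu)%:E | nu in S].

(* O_{f|B}.  A set has positive measure when it is not contained in a Borel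
   set of measure 0; for a Borel set A this is 0 < m A. *)
Definition SRB_like (m : {measure set (borel M) -> \bar R})
    (dist : probability (borel M) R -> probability (borel M) R -> R)
    f (B : set M) : set (probability (borel M) R) :=
  [set mu | forall e : R, 0 < e ->
     ~ m.-negligible
         [set x | B x /\ (dist_to_set dist (limit_measures f x) mu < e%:E)%E]].

Definition dirac_segment (x1 x2 : M) : set (probability (borel M) R) :=
  [set mu | exists2 t : R, 0 <= t <= 1 &
     forall A : set (borel M), measurable A ->
       mu A = (t%:E * \d_(x1 : borel M) A
               + (1 - t)%:E * \d_(x2 : borel M) A)%E].

End SRBLike.

(* Main.v *)
(* The surface is the plane, the saddles are (1, 1) and (-1, -1), the source is 0
   and V is the hexagon max (|X|, |Y|, |X - Y|) < 1, whose boundary consists of the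
   two saddle connections.  The homeomorphism is a composite of three maps that
   commute with v |-> - v: a rotation around 0 that preserves a function [height]
   and acts as diag (1/2, 2) near the saddles; a radial expansion near the source;
   and a push towards the boundary between the saddles, which makes the distance
   to the boundary so small that the sojourns near the saddles grow
   superexponentially.  So every orbit in V minus 0 spends almost all its time near
   the saddles, and the fraction of time spent near (1, 1) has all the points of
   [0, 1] as limits: the limits of the empirical measures are exactly the convex
   combinations of the two Dirac masses.  The boundary of V is a null set.

   All the maps are explicit and piecewise defined, and only pointwise Lipschitz:
   limsup |f w - f v| / |w - v| is finite at each v, which suffices for the image
   of a null set to be null (for the inverse, off the null set of boundary
   lines). *)
From HB Require Import structures.
From mathcomp Require Import all_boot all_order all_algebra.
From mathcomp Require Import complex.
From mathcomp Require Import all_classical all_reals all_analysis.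
From mathcomp Require Import measurable_realfun.
From mathcomp Require Import ring lra zify.
Require Import Defs.
Set Implicit Arguments.
Unset Strict Implicit.
Unset Printing Implicit Defensive.
Import Order.TTheory GRing.Theory Num.Theory.
Import numFieldTopology.Exports numFieldNormedType.Exports.
Local Open Scope classical_set_scope.
Local Open Scope ring_scope.

(* Makes [R * R] a pointed topological space; the library alone does not. *)
HB.saturate prod.

(** * Lebesgue measure of the plane *)

(** The multipliers 1/2 and 2 preserve [x * y] near a saddle, so a sojourn lasts about log2 of
    [1 / (x * y)] steps. If the map and its inverse were both Lipschitz along the connections,
    [x * y] could shrink only by a bounded factor from one saddle to the next, sojourns would grow
    only by bounded amounts, and the fractions of time would stay away from the ends of [0, 1]. Each
    sojourn has to outweigh all earlier ones, so [x * y] must shrink faster than any power. This is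
    why the push is flat at the boundary and its inverse merely continuous there, which the
    definition permits away from the fixed points. The push must be trivial near the saddles. So its
    exponent varies from 1 to 2 and back along each connection, and an orbit meets it at two
    consecutive times, at places that depend on a phase [t] in [0, 1[. The two exponents are [1 + t]
    and [2 - t]; their product [2 + t * (1 - t)] is at least 2 for every phase, so
    [1 - ln (2 * x * y)] is at least squared along each connection. This estimate yields both the
    vanishing average distance to the saddles and the whole interval of limits. *)

Section PlaneTopology.
Variable R : realType.
Local Notation plane := (R * R)%type.

Lemma plane_norm (v : plane) : `|v| = Num.max `|v.1| `|v.2|.
Proof. by case: v. Qed.

Lemma plane_ballE (v : plane) (e : R) : ball v e = ball v.1 e `*` ball v.2 e.
Proof. by rewrite eqEsubset; split => w []. Qed.

(** Rational boxes serve twice: as a countable base, and to show that open sets belong to the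
    product sigma-algebra. *)
Lemma open_rational_box (O : set plane) (v : plane) : open O -> O v ->
  exists q : rat * rat * rat,
    [/\ 0 < ratr q.2 :> R,
        ball ((ratr q.1.1, ratr q.1.2) : plane) (ratr q.2 : R) v &
        ball ((ratr q.1.1, ratr q.1.2) : plane) (ratr q.2 : R) `<=` O].
Proof.
move=> oO Ov.
have /nbhs_ballP[e /= e0 He] : nbhs v O by exact: open_nbhs_nbhs.
have h1 : v.1 < v.1 + e / 4 by rewrite ltrDl divr_gt0.
have h2 : v.2 < v.2 + e / 4 by rewrite ltrDl divr_gt0.
have h3 : e / 4 < e / 2 by lra.
have [q1 /itvP q1P] := rat_in_itvoo h1.
have [q2 /itvP q2P] := rat_in_itvoo h2.
have [r /itvP rP] := rat_in_itvoo h3.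
have q1l := q1P; exists (q1, q2, r); split => /=.
- by apply: lt_trans (_ : e / 4 < _); [rewrite divr_gt0|rewrite rP].
- rewrite plane_ballE; split; rewrite /ball /= ?q1P ?q2P ?rP.
  + have: v.1 < ratr q1 < v.1 + e / 4 by rewrite !q1P.
    have: e / 4 < ratr r by rewrite rP.
    by move=> ? /andP[? ?]; rewrite ltr_norml; apply/andP; split; lra.
  + have: v.2 < ratr q2 < v.2 + e / 4 by rewrite !q2P.
    have: e / 4 < ratr r by rewrite rP.
    by move=> ? /andP[? ?]; rewrite ltr_norml; apply/andP; split; lra.
- move=> w; rewrite plane_ballE => -[/= w1 w2]; apply: He.
  rewrite plane_ballE; move: w1 w2; rewrite /ball /= => w1 w2.
  have r2 : ratr r < e / 2 by rewrite rP.
  have ? : v.1 < ratr q1 < v.1 + e / 4 by rewrite !q1P.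
  have ? : v.2 < ratr q2 < v.2 + e / 4 by rewrite !q2P.
  by split; move: w1 w2; rewrite /ball_ !ltr_norml /=; lra.
Qed.

Lemma plane_second_countable : @second_countable plane.
Proof.
exists [set B | exists q : rat * rat * rat,
  0 < ratr q.2 :> R /\ B = ball ((ratr q.1.1, ratr q.1.2) : plane) (ratr q.2 : R)].
  apply: (@sub_countable _ _ _ (range (fun q : rat * rat * rat =>
      ball ((ratr q.1.1, ratr q.1.2) : plane) (ratr q.2 : R)))); last first.
    by apply: (card_le_trans (card_image_le _ _)); exact: countableP.
  by apply: subset_card_le => B [q [_ ->]]; exists q.
split=> [B [q [q0 ->]]|v]; first exact: ball_open.
move=> A; rewrite nbhsE => -[U [oU Uv] UA].
have [q [q0 qv qO]] := open_rational_box oU Uv.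
exists (ball ((ratr q.1.1, ratr q.1.2) : plane) (ratr q.2 : R)); last first.
  exact: subset_trans qO UA.
by split => //; exists q.
Qed.

Lemma plane_hausdorff : hausdorff_space plane.
Proof. exact: norm_hausdorff. Qed.

End PlaneTopology.

Section PlaneMeasure.
Variable R : realType.
Local Notation plane := (R * R)%type.
Local Notation mplane := (measurableTypeR R * measurableTypeR R)%type.

Lemma open_measurable_plane (O : set mplane) :
  @open (R * R)%type O -> measurable O.
Proof.
move=> oO.
have -> : O = \bigcup_(q : rat * rat * rat) (if `[<
    ball ((ratr q.1.1, ratr q.1.2) : plane) (ratr q.2 : R) `<=` O >] then
    ball (ratr q.1.1 : R) (ratr q.2 : R) `*` ball (ratr q.1.2 : R) (ratr q.2 : R)
    else set0).
  rewrite eqEsubset; split=> [v Ov|v [q _]]; last first.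
    by case: asboolP => // qO qv; apply: qO; rewrite plane_ballE.
  have [q [q0 qv qO]] := open_rational_box oO Ov.
  exists q => //; case: asboolP => [_|//].
  by move: qv; rewrite plane_ballE.
apply: countable_bigcupT_measurable => // q; case: asboolP => _ //.
by apply: measurableX; exact: measurable_ball.
Qed.

Lemma borel_measurable_plane (A : set plane) :
  measurable (A : set (borel plane)) -> measurable (A : set mplane).
Proof.
move=> mA; apply: (smallest_sub _ _ mA) => [|O oO].
  exact: (sigma_algebra_measurable mplane).
exact: open_measurable_plane.
Qed.

(** The product measure retyped on the Borel sigma-algebra, where the volume of a surface lives;
    additivity carries over because Borel sets are measurable for the product. *)
Definition vol_plane : set (borel plane) -> \bar R := @plane_lebesgue R.

Let vol_plane0 : vol_plane set0 = 0%E.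
Proof. exact: measure0. Qed.

Let vol_plane_ge0 A : (0 <= vol_plane A)%E.
Proof. exact: (measure_ge0 (lebesgue_measure \x lebesgue_measure)%E). Qed.

Let vol_plane_sigma_additive : semi_sigma_additive vol_plane.
Proof.
move=> F mF tF mUF.
apply: (@measure_semi_sigma_additive _ _ _ (lebesgue_measure \x lebesgue_measure)%E) => //.
- by move=> n; apply: borel_measurable_plane; exact: mF.
- exact: borel_measurable_plane.
Qed.

HB.instance Definition _ := isMeasure.Build _ _ _ vol_plane
  vol_plane0 vol_plane_ge0 vol_plane_sigma_additive.

Lemma vol_plane_box (A B : set R) :
  measurable (A : set (measurableTypeR R)) ->
  measurable (B : set (measurableTypeR R)) ->
  vol_plane (A `*` B) = (lebesgue_measure A * lebesgue_measure B)%E.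
Proof. by move=> mA mB; rewrite /vol_plane /plane_lebesgue product_measure1E. Qed.

End PlaneMeasure.

(** * Regularity of finite Borel measures *)

Section Regularity.
Variables (R : realType) (T : normedModType R).
Variable m : {measure set (borel T) -> \bar R}.
Hypothesis m_fin : (m setT < +oo)%E.

Lemma measurable_open_borel (A : set T) : open A -> measurable (A : set (borel T)).
Proof. by move=> oA; exact: sub_sigma_algebra. Qed.

Lemma measurable_closed_borel (A : set T) :
  closed A -> measurable (A : set (borel T)).
Proof.
move=> cA; rewrite -[A]setCK; apply: measurableC.
by apply: measurable_open_borel; exact: closed_openC.
Qed.

Definition regular_set (A : set T) := forall e : R, 0 < e ->
  exists F U : set T, [/\ closed F, open U, F `<=` A, A `<=` U & (m (U `\` F) <= e%:E)%E].

Let finite_subset (A : set T) : measurable (A : set (borel T)) -> (m A < +oo)%E.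
Proof.
move=> mA; apply: le_lt_trans m_fin; apply: le_measure; rewrite ?inE//.
Qed.

Lemma regular_open (U : set T) : open U -> regular_set U.
Proof.
move=> oU e e0.
(* The points at distance at least [1 / (n + 1)] from the complement of [U]. The sets [U] minus
   [F n] decrease to the empty set, and [m] is finite. *)
pose F n := ~` \bigcup_(w in ~` U) ball w (n.+1%:R^-1 : R).
have cF n : closed (F n).
  by apply: open_closedC; apply: bigcup_open => w _; exact: ball_open.
have FU n : F n `<=` U.
  move=> v Fv; apply: contrapT => Uv; apply: Fv; exists v => //.
  by apply: ballxx; rewrite invr_gt0.
have mD n : measurable (U `\` F n : set (borel T)).
  by apply: measurableD; [exact: measurable_open_borel|exact: measurable_closed_borel].
have cap0 : \bigcap_n (U `\` F n) = set0.
  rewrite -subset0 => v capv; have Uv : U v by have [] := capv 0%N I.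
  have /nbhs_ballP[d /= d0 dU] : nbhs v U by exact: open_nbhs_nbhs.
  have [n _ /(_ n (leqnn n)) nd] := near_infty_natSinv_lt (PosNum d0).
  have [_ /contrapT[w /= Uw wv]] := capv n I.
  by apply: Uw; apply: dU; apply: (le_ball (ltW nd)); exact: ball_sym.
have nF n k : (n <= k)%N -> (U `\` F k <= U `\` F n)%O.
  move=> nk; apply/subsetPset => v [Uv /contrapT[w Uw wv]]; split => //; apply.
  exists w => //; apply: le_ball wv.
  by rewrite lef_pV2 ?posrE// ler_nat.
have := @nonincreasing_cvg_mu _ (borel T) R m (fun n => U `\` F n)
  (finite_subset (mD 0%N)) mD.
rewrite cap0 measure0 => /(_ measurable0 nF) mcvg.
have e0nbhs : nbhs (0%E : \bar R) [set x | (x < e%:E)%E].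
  by apply: open_nbhs_nbhs; split; [exact: open_ereal_lt_ereal|rewrite /= lte_fin].
have [n _ /(_ n (leqnn n)) /= mn] := mcvg _ e0nbhs.
exists (F n), U; split => //; exact: (ltW mn).
Qed.

Lemma regularC (A : set T) : regular_set A -> regular_set (~` A).
Proof.
move=> rA e /rA[F [U [cF oU FA AU mUF]]].
exists (~` U), (~` F); split.
- exact: open_closedC.
- exact: closed_openC.
- exact: subsetC.
- exact: subsetC.
- by rewrite setDE setCK setIC -setDE.
Qed.

Lemma regular_bigcup (A : nat -> set T) :
  (forall n, regular_set (A n)) -> regular_set (\bigcup_n A n).
Proof.
move=> rA e e0.
have /choice[FU HFU] : forall n, exists FU : set T * set T,
    [/\ closed FU.1, open FU.2, FU.1 `<=` A n, A n `<=` FU.2 &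
     (m (FU.2 `\` FU.1) <= (e / 2 / (2 ^ n.+1)%:R)%:E)%E].
  move=> n; have := rA n (e / 2 / (2 ^ n.+1)%:R).
  by move=> []; [rewrite !divr_gt0// ltr0n expn_gt0|move=> F [U ?]; exists (F, U)].
(* An infinite union of closed sets need not be closed, hence the finite unions [Fs n]; continuity
   from above bounds what they miss. *)
pose U := \bigcup_n (FU n).2; pose Fs n := \big[setU/set0]_(i < n) (FU i).1.
have FsE n : Fs n = \bigcup_(i < n) (FU i).1.
  by rewrite (bigcup_mkord n (fun i => (FU i).1)).
have oU : open U by apply: bigcup_open => n _; have [] := HFU n.
have cF n : closed (Fs n).
  by apply: closed_bigsetU => i _; have [] := HFU i.
have mFU n : measurable ((FU n).2 `\` (FU n).1 : set (borel T)).
  have [cFn oUn _ _ _] := HFU n.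
  by apply: measurableD; [exact: measurable_open_borel|exact: measurable_closed_borel].
have mD n : measurable (U `\` Fs n : set (borel T)).
  by apply: measurableD; [exact: measurable_open_borel|exact: measurable_closed_borel].
have nF n k : (n <= k)%N -> (U `\` Fs k <= U `\` Fs n)%O.
  move=> nk; apply/subsetPset; apply: setDS.
  by rewrite !FsE => v [i /= ik Fi]; exists i => //=; exact: leq_trans ik nk.
have capE : \bigcap_n (U `\` Fs n) `<=` \bigcup_n ((FU n).2 `\` (FU n).1).
  move=> v capv; have [[n _ Un] _] := capv 0%N I.
  exists n => //; split => // Fn.
  have [_] := capv n.+1 I; apply.
  by rewrite FsE; exists n => //=.
have mcap : measurable (\bigcap_n (U `\` Fs n) : set (borel T)).
  exact: bigcapT_measurable.
have mle : (m (\bigcap_n (U `\` Fs n)) <= (e / 2)%:E)%E.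
  apply: le_trans (measure_sigma_subadditive m mFU mcap capE) _.
  apply: (@le_trans _ _ (\sum_(0 <= n <oo) (0 + (e / 2 / (2 ^ n.+1)%:R)%:E))%E).
    by apply: lee_nneseries => // n _; rewrite add0e; have [] := HFU n.
  apply: le_trans (epsilon_trick _ _ _) _ => //; first by rewrite divr_ge0// ltW.
  by rewrite eseries0// add0e.
have := @nonincreasing_cvg_mu _ (borel T) R m (fun n => U `\` Fs n)
  (finite_subset (mD 0%N)) mD mcap nF => mcvg.
have enbhs : nbhs (m (\bigcap_n (U `\` Fs n))) [set x | (x < e%:E)%E].
  apply: open_nbhs_nbhs; split; first exact: open_ereal_lt_ereal.
  by apply: le_lt_trans mle _; rewrite lte_fin; lra.
have [n _ /(_ n (leqnn n)) /= mn] := mcvg _ enbhs.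
exists (Fs n), U; split => //.
- rewrite FsE => v [i _ Fi]; exists i => //.
  by have [_ _ + _ _] := HFU i; exact.
- by move=> v [i _ Ai]; exists i => //; have [_ _ _ + _] := HFU i; exact.
- exact: (ltW mn).
Qed.

(** The regular sets form a sigma-algebra that contains the open sets. *)
Lemma regular_measurable (A : set T) :
  measurable (A : set (borel T)) -> regular_set A.
Proof.
move=> mA; apply: (smallest_sub _ _ mA) => [|U]; last exact: regular_open.
split.
- exact/regular_open/open0.
- by move=> B rB; rewrite setTD; exact: regularC.
- exact: regular_bigcup.
Qed.

End Regularity.

Section SmallCovers.
Variables (d : measure_display) (T : measurableType d) (R : realType).
Variable m : {measure set T -> \bar R}.

Lemma negligible_small_cover (A : set T) :
  (forall e : R, 0 < e -> exists G, [/\ measurable G, A `<=` G & (m G <= e%:E)%E]) ->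
  m.-negligible A.
Proof.
move=> covA.
have /choice[G HG] : forall n : nat, exists G,
    [/\ measurable G, A `<=` G & (m G <= (n.+1%:R^-1)%:E)%E].
  by move=> n; apply: covA; rewrite invr_gt0.
have mG : measurable (\bigcap_n G n) by apply: bigcapT_measurable => n; have [] := HG n.
exists (\bigcap_n G n); split => //; last first.
  by move=> v Av n _; have [_ + _] := HG n; exact.
apply/eqP; rewrite eq_le measure_ge0 andbT; apply/lee_addgt0Pr => e e0.
have [n _ /(_ n (leqnn n)) ne] := near_infty_natSinv_lt (PosNum e0).
have [mGn _ mle] := HG n; rewrite add0e.
apply: (@le_trans _ _ (m (G n))).
  by apply: le_measure; rewrite ?inE//; exact: bigcap_inf.
by apply: le_trans mle _; rewrite lee_fin ltW.
Qed.

End SmallCovers.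

Section BorelFunctions.
Variables (R : realType) (T : ptopologicalType).

Lemma continuous_borel_measurable (f : T -> R) :
  continuous f -> measurable_fun setT (f : borel T -> R).
Proof.
move=> cf; apply: (measurability _ (RGenOpens.measurableE R)).
move=> _ [_ [a [b ->]] <-]; rewrite setTI.
apply: sub_sigma_algebra; apply: open_comp; last exact: interval_open.
by move=> x _; exact: cf.
Qed.

Lemma continuous_borel_preimage (f : T -> T) (A : set (borel T)) :
  continuous f -> measurable A -> measurable (f @^-1` A : set (borel T)).
Proof.
move=> cf mA; rewrite -[X in measurable X]setTI.
apply: (@measurability _ _ (borel T) (borel T) setT f (@open T)) => //.
move=> _ [U oU <-]; rewrite setTI.
by apply: sub_sigma_algebra; apply: open_comp oU => x _; exact: cf.
Qed.

End BorelFunctions.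

Lemma measurable_box_borel (R : realType) (A B : set R) :
  measurable (A : set (measurableTypeR R)) ->
  measurable (B : set (measurableTypeR R)) ->
  measurable (A `*` B : set (borel (R * R)%type)).
Proof.
move=> mA mB.
have -> : A `*` B = ((fst : R * R -> R) @^-1` A) `&` ((snd : R * R -> R) @^-1` B) by [].
have m1 : continuous (fst : (R * R)%type -> R) by move=> x; exact: cvg_fst.
have m2 : continuous (snd : (R * R)%type -> R) by move=> x; exact: cvg_snd.
have {}m1 := @continuous_borel_measurable R (R * R)%type fst m1.
have {}m2 := @continuous_borel_measurable R (R * R)%type snd m2.
by apply: measurableI; rewrite -[X in measurable X]setTI; [exact: m1|exact: m2].
Qed.

(** * Images of null sets under pointwise Lipschitz maps *)

Section DyadicSquares.
Variable R : realType.
Local Notation plane := (R * R)%type.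

Definition dyadic_index (n : nat) (v : plane) : int * int :=
  (Num.floor (2 ^+ n * v.1), Num.floor (2 ^+ n * v.2)).

Definition dyadic_square (n : nat) (ij : int * int) : set plane :=
  [set v | dyadic_index n v = ij].

Lemma floor_double_inj (a b : R) :
  Num.floor (2 * a) = Num.floor (2 * b) -> Num.floor a = Num.floor b.
Proof.
wlog: a b / (Num.floor a <= Num.floor b) => [W|].
  case: (leP (Num.floor a) (Num.floor b)) => [/W//|/ltW/W W'] /esym /W' -> //.
rewrite le_eqVlt => /predU1P[//|ab] E; exfalso.
have ha := floor_itv a; have hb := floor_itv b.
have ha2 := floor_itv (2 * a); have hb2 := floor_itv (2 * b).
have : Num.floor (2 * a) < 2 * Num.floor b.
  rewrite -(ltr_int R); apply: le_lt_trans (_ : 2 * a < _); first by case/andP: ha2.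
  have : (Num.floor a + 1)%:~R <= (Num.floor b)%:~R :> R.
    by rewrite ler_int lezD1.
  by rewrite intrM; move: ha => /andP[_ ha] hab; rewrite ltr_pM2l//; exact: lt_le_trans hab.
rewrite E; apply/negP; rewrite -leNgt.
rewrite -ltzD1 -(ltr_int R); apply: le_lt_trans (_ : 2 * b < _).
  by rewrite intrM ler_pM2l//; case/andP: hb.
by case/andP: hb2.
Qed.

Lemma dyadic_index_coarser (n k : nat) (v w : plane) : (n <= k)%N ->
  dyadic_index k v = dyadic_index k w -> dyadic_index n v = dyadic_index n w.
Proof.
move=> /subnK <-; elim: (k - n)%N => // p IH; rewrite addSn => E; apply: IH.
move: E; rewrite /dyadic_index exprS -!mulrA => -[E1 E2].
by rewrite (floor_double_inj E1) (floor_double_inj E2).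
Qed.

Lemma dyadic_square_box n i j : dyadic_square n (i, j) =
  `[i%:~R / 2 ^+ n, (i + 1)%:~R / 2 ^+ n[ `*` `[j%:~R / 2 ^+ n, (j + 1)%:~R / 2 ^+ n[.
Proof.
have P (a : R) (k : int) : Num.floor (2 ^+ n * a) = k <->
    a \in `[k%:~R / 2 ^+ n, (k + 1)%:~R / 2 ^+ n[.
  rewrite in_itv /= ler_pdivrMr ?exprn_gt0// ltr_pdivlMr ?exprn_gt0// (mulrC a).
  split=> [<-|]; first exact: floor_itv _.
  exact: floor_def.
rewrite eqEsubset; split => v; rewrite /dyadic_square /dyadic_index /=.
  by move=> [/P ? /P ?].
by move=> [/P -> /P ->].
Qed.

Lemma dyadic_square_diam n ij v w : dyadic_square n ij v -> dyadic_square n ij w ->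
  `|v - w| <= 2 ^- n.
Proof.
have n0 : (0 : R) < 2 ^+ n by rewrite exprn_gt0.
case: ij => i j; rewrite dyadic_square_box => -[/=].
rewrite !in_itv /= !rmorphD /= !mulrDl !mul1r.
move=> /andP[a1 a2] /andP[a3 a4] [/=] /andP[b1 b2] /andP[b3 b4].
rewrite plane_norm ge_max; apply/andP; split; rewrite ler_norml /=; lra.
Qed.

Lemma vol_dyadic_square n ij : vol_plane (dyadic_square n ij) = (2 ^- n * 2 ^- n)%:E.
Proof.
have n0 : (0 : R) < 2 ^- n by rewrite invr_gt0 exprn_gt0.
case: ij => i j; rewrite dyadic_square_box vol_plane_box//.
rewrite !lebesgue_measure_itv /= !rmorphD /= !mulrDl !mul1r !lte_fin !ltrDl n0.
by rewrite -!EFinB -EFinM !(addrC _ (2 ^- n)) !addrK.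
Qed.

Lemma measurable_dyadic_square n ij :
  measurable (dyadic_square n ij : set (borel plane)).
Proof. by case: ij => i j; rewrite dyadic_square_box; exact: measurable_box_borel. Qed.

End DyadicSquares.

(** The constant depends on the point and only increments based at [v] are controlled, so that maps
    defined by cases can be treated one point at a time. *)
Definition lipschitz_at (R : realType) (V W : normedModType R) (f : V -> W) (v : V) :=
  exists K : R, \forall w \near v, `|f w - f v| <= K * `|w - v|.

Section NullImages.
Variable R : realType.
Local Notation plane := (R * R)%type.
Local Notation null := ((@vol_plane R).-negligible).
Implicit Types (f : plane -> plane) (A B U : set plane) (v w : plane).


Lemma vol_plane_square (a b r : R) : 0 <= r ->
  vol_plane (`[a - r, a + r] `*` `[b - r, b + r]) = (4 * r ^+ 2)%:E.
Proof.
move=> r0; rewrite vol_plane_box// !lebesgue_measure_itv /= !lte_fin.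
have E c : (c - r < c + r) = (0 < r) by apply/idP/idP; lra.
rewrite !E.
case: ltP => [_|r1]; first by rewrite -!EFinB -EFinM; congr EFin; ring.
have -> : r = 0 by apply/eqP; rewrite eq_le r0 r1.
by rewrite mule0 expr0n /= mulr0.
Qed.

(* The dyadic squares of side at most [2 ^- N] that are maximal among those
   included in U are pairwise disjoint and cover U. *)
Lemma lipschitz_image_cover f A U (k : nat) (e : R) : open U -> A `<=` U ->
  (forall v w, A v -> A w -> `|w - v| < k.+1%:R^-1 ->
     `|f w - f v| <= k.+1%:R * `|w - v|) ->
  (vol_plane U <= e%:E)%E ->
  exists G : set plane, [/\ measurable (G : set (borel plane)), f @` A `<=` G &
    (vol_plane G <= (4 * k.+1%:R ^+ 2 * e)%:E)%E].
Proof.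
move=> oU AU lipA vole.
have k0 : 0 < k.+1%:R^-1 :> R by rewrite invr_gt0.
(* Squares of side at most [2 ^- N] are small enough for the Lipschitz bound to hold between any two
   points of [A] in the same square. *)
have [N _ HN] := near_infty_natSinv_expn_lt (PosNum k0).
pose sq n v : set plane := dyadic_square n (dyadic_index n v).
pose first n v := [/\ (N <= n)%N, sq n v `<=` U &
  forall n', (N <= n')%N -> (n' < n)%N -> ~ sq n' v `<=` U].
pose sel (t : nat * (int * int)) v := [/\ A v, dyadic_index t.1 v = t.2 & first t.1 v].
have ex_first v : A v -> exists n, first n v.
  move=> Av.
  have /nbhs_ballP[d /= d0 dU] : nbhs v U by apply: open_nbhs_nbhs; split => //; exact: AU.
  have [M _ HM] := near_infty_natSinv_expn_lt (PosNum d0).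
  have exn : exists n, (N <= n)%N && `[< sq n v `<=` U >].
    exists (maxn N M); rewrite leq_maxl /=; apply/asboolP => w vw; apply: dU.
    have := HM (maxn N M) (leq_maxr _ _); rewrite /= div1r => dn.
    rewrite -ball_normE /=; apply: le_lt_trans dn.
    exact: (@dyadic_square_diam _ _ (dyadic_index (maxn N M) v)).
  case: (ex_minnP exn) => n /andP[Nn /asboolP nU] nmin; exists n; split => //.
  move=> n' Nn' n'n n'U.
  have := nmin n'; rewrite Nn' (asboolT n'U) => /(_ isT).
  by rewrite leqNgt n'n.
have sel_disj t t' w : (exists v, sel t v) -> (exists v, sel t' v) ->
    dyadic_square t.1 t.2 w -> dyadic_square t'.1 t'.2 w -> t = t'.
  wlog tt' : t t' / (t.1 <= t'.1)%N => [W|].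
    case: (leqP t.1 t'.1) => [/W//|/ltnW/W {}W] st st' tw t'w; exact/esym/W.
  case: t t' tt' => n ij [n' ij'] /= nn' [v [/= Av vij [Nn nU nmin]]].
  move=> [v' [/= Av' vij' [Nn' nU' nmin']]] wij wij'.
  move: nn'; rewrite leq_eqVlt => /predU1P[nn'|nn'].
    by rewrite -nn'; congr pair; rewrite -wij -wij' nn'.
  exfalso; apply: (nmin' n Nn nn') => z zv'; apply: nU.
  rewrite /sq /dyadic_square /= (zv' : _ = _).
  transitivity (dyadic_index n w); last by rewrite vij.
  by apply: (dyadic_index_coarser (ltnW nn')); rewrite vij' wij'.
have /choice[wit Hwit] : forall t, exists v, (exists v', sel t v') -> sel t v.
  move=> t; case: (pselect (exists v', sel t v')) => [[v sv]|ns]; first by exists v.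
  by exists 0.
pose tt p : nat * (int * int) := odflt (0%N, (0, 0)) (unpickle p).
(* A number that codes nothing decodes to the default pair; asking for [pickle (tt p) = p] prevents
   the same square from being counted twice. *)
pose ok p := exists v, sel (tt p) v /\ pickle (tt p) = p.
pose F p : set plane := if `[< ok p >] then dyadic_square (tt p).1 (tt p).2 else set0.
(* The points of [A] in a square of side [2 ^- n] have their images in the square of half-side
   [rad p] centred at the image of one of them. The centre must come from [A], because the Lipschitz
   bound relates points of [A] only. The ratio of the areas is [4 * k.+1 ^ 2]. *)
pose rad p : R := k.+1%:R * 2 ^- (tt p).1.
pose c p := f (wit (tt p)).
pose G p : set plane := if `[< ok p >] then
  `[(c p).1 - rad p, (c p).1 + rad p] `*` `[(c p).2 - rad p, (c p).2 + rad p] else set0.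
have rad0 p : 0 <= rad p by rewrite mulr_ge0 ?ler0n ?invr_ge0 ?exprn_ge0.
have mF p : measurable (F p : set (borel plane)).
  by rewrite /F; case: asboolP => _ //; exact: measurable_dyadic_square.
have mG p : measurable (G p : set (borel plane)).
  by rewrite /G; case: asboolP => _ //; apply: measurable_box_borel.
have GF p : vol_plane (G p) = ((4 * k.+1%:R ^+ 2)%:E * vol_plane (F p))%E.
  rewrite /G /F; case: asboolP => _; last by rewrite measure0 mule0.
  rewrite vol_plane_square// vol_dyadic_square -EFinM; congr EFin.
  by rewrite /rad; ring.
have tF : trivIset setT F.
  apply/trivIsetP => p q _ _ pq; rewrite -subset0 => w [].
  rewrite /F; case: asboolP => // -[v [sv vp]]; case: asboolP => // -[v' [sv' vq]].
  move=> wp wq; move/eqP: pq; apply; rewrite -vp -vq; congr pickle.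
  by apply: (sel_disj _ _ w) => //; [exists v|exists v'].
have FU : \bigcup_p F p `<=` U.
  move=> w [p _]; rewrite /F; case: asboolP => // -[v [[Av vE [_ vU _]] _]] wp.
  by apply: vU; rewrite /sq vE.
exists (\bigcup_p G p); split; first exact: bigcupT_measurable.
- move=> _ [v Av <-]; have [n fn] := ex_first v Av.
  pose t := (n, dyadic_index n v); have st : sel t v by split.
  have tE : tt (pickle t) = t by rewrite /tt pickleK.
  exists (pickle t) => //; rewrite /G; case: asboolP => [_|[]]; last first.
    by exists v; rewrite tE.
  have [Aw wE [Nn _ _]] : sel t (wit t) by apply: Hwit; exists v.
  have dvw : `|v - wit t| <= 2 ^- n by apply: (dyadic_square_diam _ wE).
  have : `|f v - f (wit t)| <= rad (pickle t).
    apply: le_trans (lipA _ _ Aw Av _) _.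
      by apply: le_lt_trans dvw _; rewrite -div1r; exact: HN.
    by rewrite /rad tE ler_wpM2l.
  rewrite plane_norm ge_max => /andP[/=]; rewrite !ler_distl /c tE => /andP[a1 a2] /andP[b1 b2].
  by split; rewrite /= in_itv /= ?a1 ?a2 ?b1 ?b2.
- apply: le_trans (measure_sigma_subadditive _ mG _ (@subset_refl _ _)) _.
    exact: bigcupT_measurable.
  rewrite (eq_eseriesr (fun p _ => GF p)).
  rewrite nneseriesZl; last by move=> *; exact: measure_ge0.
  rewrite [leRHS]EFinM; apply: lee_wpmul2l; first by rewrite lee_fin mulr_ge0 ?exprn_ge0.
  have := measure_bigcup (@vol_plane R) setT F (fun i _ => mF i) tF.
  under eq_eseriesl do rewrite in_setT. 
  move=> <-; apply: le_trans vole; apply: le_measure; rewrite ?inE//.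
    exact: bigcupT_measurable.
  exact: measurable_open_borel.
Qed.

(** [A] is the union of sets [Ak k] on which one number controls the Lipschitz constant, the radius
    where it is valid and the norm. Each has open neighbourhoods of arbitrarily small area, and
    [lipschitz_image_cover] multiplies the area by a constant only. The sets [Ak k] may be
    non-measurable. *)
Lemma null_lipschitz_image f A : null A -> (forall v, A v -> lipschitz_at f v) ->
  null (f @` A).
Proof.
move=> [B [mB B0 AB]] lipA.
pose Ak k := [set v | [/\ A v, `|v| < k.+1%:R &
   forall w, `|w - v| < k.+1%:R^-1 -> `|f w - f v| <= k.+1%:R * `|w - v|]].
have Acov : f @` A `<=` \bigcup_k (f @` Ak k).
  move=> _ [v Av <-]; have [K] := lipA v Av.
  move=> /nbhs_ballP[d /= d0 dK].
  have [n1 _ H1] := near_infty_natSinv_lt (PosNum d0).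
  pose n2 := Num.truncn `|K|; pose n3 := Num.truncn `|v|.
  pose n := maxn n1 (maxn n2 n3).
  have nn1 : (n1 <= n)%N by exact: leq_maxl.
  have nn2 : (n2 <= n)%N by rewrite /n; lia.
  have nn3 : (n3 <= n)%N by rewrite /n; lia.
  exists n => //; exists v => //; split => //.
    apply: lt_le_trans (truncnS_gt _) _; by rewrite ler_nat ltnS.
  move=> w wv; apply: le_trans (_ : K * `|w - v| <= _).
    apply: dK; rewrite -ball_normE /= distrC; apply: lt_trans wv _; exact: H1.
  apply: ler_wpM2r => //; apply: le_trans (ler_norm _) _; apply: ltW.
  by apply: lt_le_trans (truncnS_gt _) _; rewrite ler_nat ltnS.
apply: (@negligibleS _ (borel plane) R (@vol_plane R) _ _ Acov); apply: negligible_bigcup => k.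
apply: negligible_small_cover => e e0.
pose D : set plane := ball (0 : plane) (k.+1%:R : R).
have mD : measurable (D : set (borel plane)).
  by apply: measurable_open_borel; exact: ball_open.
have DE : D = ball (0 : R) (k.+1%:R : R) `*` ball (0 : R) (k.+1%:R : R).
  by rewrite /D plane_ballE.
(* Regularity was proved for finite measures, so the area is restricted to a ball that contains
   [Ak k]. *)
have Dfin : (mrestr (@vol_plane R) mD setT < +oo)%E.
  rewrite /mrestr setTI DE vol_plane_box; [|exact: measurable_ball..].
  by rewrite lebesgue_measure_ball// -EFinM ltry.
pose e' := e / (4 * k.+1%:R ^+ 2).
have k2 : 0 < 4 * k.+1%:R ^+ 2 :> R by rewrite mulr_gt0// exprn_gt0.
have e'0 : 0 < e' by rewrite divr_gt0.
have [F [U [cF oU FB BU mUF]]] := regular_measurable Dfin mB e'0.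
have mU := measurable_open_borel oU; have mF := measurable_closed_borel cF.
have oUD : open (U `&` D) by apply: openI => //; exact: ball_open.
have volUD : (vol_plane (U `&` D) <= e'%:E)%E.
  have -> : U `&` D = ((U `\` F) `&` D) `|` (F `&` D).
    by rewrite -setIUl setUDl setDv setD0 setUidl//; exact: subset_trans BU.
  apply: le_trans (measureU2 _ _ _) _.
  - by apply: measurableI => //; exact: measurableD.
  - exact: measurableI.
  - rewrite -[leRHS]adde0; apply: leeD => //.
    rewrite -B0; apply: le_measure; rewrite ?inE//; first exact: measurableI.
    by apply: subset_trans FB; exact: subIsetl.
have AkU : Ak k `<=` U `&` D.
  move=> v [Av vk _]; split; first exact/BU/AB.
  by rewrite /D -ball_normE /= sub0r normrN.
have lipAk v w : Ak k v -> Ak k w -> `|w - v| < k.+1%:R^-1 ->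
    `|f w - f v| <= k.+1%:R * `|w - v| by move=> [_ _ Hv] _; exact: Hv.
have [G [mG fG volG]] := lipschitz_image_cover oUD AkU lipAk volUD.
exists G; split => //; apply: le_trans volG _.
by rewrite lee_fin /e' mulrCA mulfV ?mulr1// gt_eqF.
Qed.

End NullImages.

(** * Pointwise Lipschitz maps *)

Section LipschitzAt.
Variable R : realType.
Implicit Types V W X : normedModType R.

Lemma lip_continuous V W (f : V -> W) (v : V) : lipschitz_at f v -> {for v, continuous f}.
Proof.
move=> [K /nbhs_ballP[d /= d0 dK]]; apply/cvgrPdist_lt => e e0.
have K0 : 0 < `|K| + 1 by rewrite ltr_wpDl.
near=> w.
have wv : `|v - w| < e / (`|K| + 1) by near: w; apply: cvgr_dist_lt; rewrite ?divr_gt0.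
have : ball v d w by near: w; exact: nbhsx_ballx.
move=> /dK fK; rewrite distrC; apply: le_lt_trans fK _.
move: wv; rewrite ltr_pdivlMr// distrC => wv; apply: le_lt_trans wv.
rewrite mulrC ler_wpM2l//; apply: le_trans (ler_norm _) _; lra.
Unshelve. all: by end_near. Qed.

Lemma lip_cst V W (c : W) (v : V) : lipschitz_at (fun=> c) v.
Proof. by exists 0; near=> w; rewrite subrr normr0 mul0r. Unshelve. all: by end_near. Qed.

Lemma lip_id V (v : V) : lipschitz_at id v.
Proof. by exists 1; near=> w; rewrite mul1r. Unshelve. all: by end_near. Qed.

Lemma lip_fst (v : R * R) : lipschitz_at (fun w : R * R => w.1) v.
Proof.
exists 1; near=> w; rewrite mul1r plane_norm le_max /=.
by rewrite lexx.
Unshelve. all: by end_near. Qed.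

Lemma lip_snd (v : R * R) : lipschitz_at (fun w : R * R => w.2) v.
Proof.
exists 1; near=> w; rewrite mul1r plane_norm le_max /=.
by rewrite lexx orbT.
Unshelve. all: by end_near. Qed.

Lemma lip_near V W (f g : V -> W) (v : V) : (\forall w \near v, f w = g w) ->
  lipschitz_at g v -> lipschitz_at f v.
Proof.
move=> fg [K gK]; exists K; near=> w.
rewrite (nbhs_singleton fg) (near fg w)//; exact: (near gK w).
Unshelve. all: by end_near. Qed.

Lemma lip_comp V W X (h : W -> X) (f : V -> W) (v : V) :
  lipschitz_at h (f v) -> lipschitz_at f v -> lipschitz_at (fun w => h (f w)) v.
Proof.
move=> [K hK] lf; have cf := lip_continuous lf; case: lf => L fL.
exists (`|K| * L); near=> w.
have : `|h (f w) - h (f v)| <= K * `|f w - f v| by near: w; exact: (cf _ hK).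
move=> /le_trans; apply; rewrite -mulrA; apply: (@le_trans _ _ (`|K| * `|f w - f v|)).
  by rewrite ler_wpM2r// ler_norm.
by rewrite ler_wpM2l//; near: w.
Unshelve. all: by end_near. Qed.

Lemma lip_bound V W (f : V -> W) (v : V) (C : R) (phi : V -> R) :
  lipschitz_at phi v -> (\forall w \near v, `|f w - f v| <= C * `|phi w - phi v|) ->
  lipschitz_at f v.
Proof.
move=> [K pK] fC; exists (`|C| * K); near=> w.
apply: (@le_trans _ _ (C * `|phi w - phi v|)); first by near: w.
apply: (@le_trans _ _ (`|C| * `|phi w - phi v|)).
  by rewrite ler_wpM2r// ler_norm.
by rewrite -mulrA ler_wpM2l//; near: w.
Unshelve. all: by end_near. Qed.

Lemma lipD V (f g : V -> R) (v : V) : lipschitz_at f v -> lipschitz_at g v ->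
  lipschitz_at (fun w => f w + g w) v.
Proof.
move=> [K fK] [L gL]; exists (K + L); near=> w.
rewrite opprD addrACA; apply: le_trans (ler_normD _ _) _; rewrite mulrDl lerD//; by near: w.
Unshelve. all: by end_near. Qed.

Lemma lipN V (f : V -> R) (v : V) : lipschitz_at f v -> lipschitz_at (fun w => - f w) v.
Proof.
move=> [K fK]; exists K; near=> w; rewrite -opprD normrN; by near: w.
Unshelve. all: by end_near. Qed.

Lemma lipM V (f g : V -> R) (v : V) : lipschitz_at f v -> lipschitz_at g v ->
  lipschitz_at (fun w => f w * g w) v.
Proof.
move=> lf [L gL]; have cf := lip_continuous lf; case: lf => K fK.
exists ((`|f v| + 1) * `|L| + `|g v| * K); near=> w.
have -> : f w * g w - f v * g v = f w * (g w - g v) + g v * (f w - f v) by ring.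
apply: le_trans (ler_normD _ _) _; rewrite !normrM mulrDl; apply: lerD; last first.
  by rewrite -mulrA ler_wpM2l//; near: w.
rewrite -mulrA; apply: ler_pM => //.
  have : `|f v - f w| < 1 by near: w; move/cvgrPdist_lt : cf; apply.
  have := ler_normD (f v) (f w - f v); rewrite addrC subrK distrC; lra.
apply: (@le_trans _ _ (L * `|w - v|)); first by near: w.
by rewrite ler_wpM2r// ler_norm.
Unshelve. all: by end_near. Qed.

Lemma lip_norm V (f : V -> R) (v : V) : lipschitz_at f v -> lipschitz_at (fun w => `|f w|) v.
Proof.
move=> lf; apply: (@lip_bound _ _ _ _ 1 f) => //; near=> w.
by rewrite mul1r; exact: ler_dist_dist.
Unshelve. all: by end_near. Qed.

Lemma lip_max V (f g : V -> R) (v : V) : lipschitz_at f v -> lipschitz_at g v ->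
  lipschitz_at (fun w => Num.max (f w) (g w)) v.
Proof.
move=> lf lg; have -> : (fun w => Num.max (f w) (g w)) =
    (fun w => (f w + g w + `|f w - g w|) * 2^-1).
  by apply/funext => w; rewrite maxr_absE.
apply: lipM; last exact: lip_cst.
by apply: lipD; [exact: lipD|apply: lip_norm; apply: lipD => //; exact: lipN].
Qed.

Lemma lip_min V (f g : V -> R) (v : V) : lipschitz_at f v -> lipschitz_at g v ->
  lipschitz_at (fun w => Num.min (f w) (g w)) v.
Proof.
move=> lf lg; have -> : (fun w => Num.min (f w) (g w)) =
    (fun w => (f w + g w + - `|f w - g w|) * 2^-1).
  by apply/funext => w; rewrite minr_absE.
apply: lipM; last exact: lip_cst.
by apply: lipD; [exact: lipD|apply: lipN; apply: lip_norm; apply: lipD => //; exact: lipN].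
Qed.

Lemma lip_pair V (f g : V -> R) (v : V) : lipschitz_at f v -> lipschitz_at g v ->
  lipschitz_at (fun w => (f w, g w)) v.
Proof.
move=> [K fK] [L gL]; exists (Num.max K L); near=> w.
rewrite plane_norm ge_max /=; apply/andP; split.
  apply: (@le_trans _ _ (K * `|w - v|)); first by near: w.
  by rewrite ler_wpM2r// le_max lexx.
apply: (@le_trans _ _ (L * `|w - v|)); first by near: w.
by rewrite ler_wpM2r// le_max lexx orbT.
Unshelve. all: by end_near. Qed.

Lemma lip_derivable (h : R -> R) (x : R) : derivable h x 1 -> lipschitz_at h x.
Proof.
move=> dh; pose l := 'D_1 h x.
have /cvgrPdist_lt /(_ 1 ltr01) : t^-1 *: (h (t *: 1 + x) - h x) @[t --> 0^'] --> l by exact: dh.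
move=> /nbhs_ballP[d /= d0 dl]; exists (`|l| + 1).
apply/nbhs_ballP; exists d => //= w; rewrite -ball_normE /= => wd.
have [->|wx] := eqVneq w x; first by rewrite !subrr normr0 mulr0.
have t0 : w - x != 0 by rewrite subr_eq0.
have := dl (w - x); rewrite -ball_normE /= sub0r normrN distrC => /(_ wd t0).
rewrite -/(GRing.scale _ _) /GRing.scale /= mulr1 subrK => q1.
have : `|(w - x)^-1 * (h w - h x)| < `|l| + 1.
  have := ler_normD l (- (l - (w - x)^-1 * (h w - h x))).
  rewrite normrN opprB addrC subrK; lra.
rewrite normrM normfV mulrC ltr_pdivrMr ?normr_gt0// => /ltW; by rewrite (distrC x).
Qed.

Lemma lip_inv V (f : V -> R) (v : V) : f v != 0 -> lipschitz_at f v ->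
  lipschitz_at (fun w => (f w)^-1) v.
Proof.
move=> fv0 lf; have cf := lip_continuous lf.
apply: (@lip_bound _ _ _ _ (2 / `|f v| ^+ 2) f) => //; near=> w.
have fw : `|f v| / 2 < `|f w|.
  have : `|f v - f w| < `|f v| / 2.
    by near: w; move/cvgrPdist_lt : cf; apply; rewrite divr_gt0// normr_gt0.
  have := ler_normD (f w) (f v - f w); rewrite addrC subrK; lra.
have fv : 0 < `|f v| by rewrite normr_gt0.
have fw0 : f w != 0 by rewrite -normr_gt0; apply: lt_trans fw; rewrite divr_gt0.
have E (a b : R) : a != 0 -> b != 0 -> a^-1 - b^-1 = (b - a) / (a * b).
  by move=> a0 b0; field; rewrite a0 b0.
rewrite E//.
rewrite normrM normfV distrC mulrC ler_wpM2r//.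
have -> : 2 / `|f v| ^+ 2 = (`|f v| / 2 * `|f v|)^-1.
  by rewrite expr2 !invfM invrK mulrA (mulrC 2) -!mulrA (mulrC 2).
rewrite normrM lef_pV2 ?posrE ?mulr_gt0 ?invr_gt0// ?normr_gt0//.
by rewrite ler_wpM2r// ltW.
Unshelve. all: by end_near. Qed.

(** At a border point the larger of the two constants serves; elsewhere a single branch is in force
    nearby. *)
Lemma lip_if V W (h : V -> R) (f g : V -> W) (v : V) : {for v, continuous h} ->
  (h v = 0 -> f v = g v) ->
  (0 <= h v -> lipschitz_at f v) -> (h v <= 0 -> lipschitz_at g v) ->
  lipschitz_at (fun w => if 0 <= h w then f w else g w) v.
Proof.
move=> ch fg lf lg; have [h0|h0|h0] := ltgtP (h v) 0.
- apply: (@lip_near _ _ _ g); last by apply: lg; exact: ltW.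
  near=> w; rewrite ifN// -ltNge; near: w; exact: (cvgr_lt _ ch).
- apply: (@lip_near _ _ _ f); last by apply: lf; exact: ltW.
  near=> w; rewrite ifT//; near: w; exact: (cvgr_ge _ ch).
- have [K fK] : lipschitz_at f v by apply: lf; rewrite h0.
  have [L gL] : lipschitz_at g v by apply: lg; rewrite h0.
  exists (Num.max K L); near=> w; rewrite h0 lexx.
  case: ifP => _; last rewrite (fg h0).
  + apply: (@le_trans _ _ (K * `|w - v|)); first by near: w.
    by rewrite ler_wpM2r// le_max lexx.
  + apply: (@le_trans _ _ (L * `|w - v|)); first by near: w.
    by rewrite ler_wpM2r// le_max lexx orbT.
Unshelve. all: by end_near. Qed.

Lemma continuous_if (T U : topologicalType) (h : T -> R) (f g : T -> U) (v : T) :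
  {for v, continuous h} -> (h v = 0 -> f v = g v) ->
  (0 <= h v -> {for v, continuous f}) -> (h v <= 0 -> {for v, continuous g}) ->
  {for v, continuous (fun w => if 0 <= h w then f w else g w)}.
Proof.
move=> ch fg cf cg; have [h0|h0|h0] := ltgtP (h v) 0.
- have cg' : {for v, continuous g} by apply: cg; exact: ltW.
  move=> A /=; rewrite leNgt h0 /= => /cg' gA.
  rewrite /nbhs /=; near=> w; rewrite /= ifN; first by near: w.
  by rewrite -ltNge; near: w; exact: (cvgr_lt _ ch).
- have cf' : {for v, continuous f} by apply: cf; exact: ltW.
  move=> A /=; rewrite (ltW h0) /= => /cf' fA.
  rewrite /nbhs /=; near=> w; rewrite /= ifT; first by near: w.
  by near: w; exact: (cvgr_ge _ ch).
- have cf' : {for v, continuous f} by apply: cf; rewrite h0.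
  have cg' : {for v, continuous g} by apply: cg; rewrite h0.
  move=> A /=; rewrite h0 lexx => Af.
  have fA := cf' _ Af; move: Af; rewrite (fg h0) => /cg' gA.
  rewrite /nbhs /=; near=> w; rewrite /=; case: ifP => _; by near: w.
Unshelve. all: by end_near. Qed.

End LipschitzAt.

(** * Construction of the homeomorphism *)

Section QuadrantGluing.
Variable R : realType.
Local Notation plane := (R * R)%type.
Implicit Types (F G : plane -> plane) (v : plane).

Definition antipode v : plane := (- v.1, - v.2).
Definition swap v : plane := (v.2, v.1).

Definition glue F G v : plane :=
  if 0 <= v.1 then (if 0 <= v.2 then F v else G v)
  else (if 0 <= v.2 then antipode (G (antipode v)) else antipode (F (antipode v))).

Lemma antipodeK : involutive antipode.
Proof. by case=> a b; rewrite /antipode /= !opprK. Qed.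

Lemma swapK : involutive swap.
Proof. by case. Qed.

Lemma swap_antipode v : swap (antipode v) = antipode (swap v).
Proof. by []. Qed.

Lemma lip_antipode v : lipschitz_at antipode v.
Proof. by apply: lip_pair; apply: lipN; [exact: lip_fst|exact: lip_snd]. Qed.

Lemma lip_swap v : lipschitz_at swap v.
Proof. by apply: lip_pair; [exact: lip_snd|exact: lip_fst]. Qed.

(** Matching conditions for [F] on the first quadrant, [G] on the fourth and their antipodal copies
    on the other two: one on the half-axis between the first and the fourth quadrant, one between
    the first and the second. Symmetry gives the remaining two. *)
Definition glueable F G :=
  (forall a : R, 0 <= a -> F (a, 0) = G (a, 0)) /\
  (forall a : R, 0 <= a -> F (0, a) = antipode (G (0, - a))).

Section Glue.
Variables (F G : plane -> plane).
Hypothesis FG : glueable F G.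

Lemma glue1 v : 0 <= v.1 -> 0 <= v.2 -> glue F G v = F v.
Proof. by move=> a b; rewrite /glue a b. Qed.

Lemma glue4 v : 0 <= v.1 -> v.2 <= 0 -> glue F G v = G v.
Proof.
case: v => a b /= a0 b0; rewrite /glue /= a0; case: ifP => // b1.
by have -> : b = 0 by [apply/eqP; rewrite eq_le b0]; case: FG => H _; exact: H.
Qed.

Lemma glue3 v : v.1 <= 0 -> v.2 <= 0 -> glue F G v = antipode (F (antipode v)).
Proof.
case: v => a b /= a0 b0; rewrite /glue /=; case: FG => H1 H2.
have E (c : R) : c <= 0 -> (0 <= c) -> c = 0 by move=> c0 c1; apply/eqP; rewrite eq_le c0.
case: ifPn => [/(E _ a0) ->|_]; case: ifPn => [/(E _ b0) ->|_] //.
- have -> : antipode (0, 0) = (0, 0) by rewrite /antipode /= oppr0.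
  by rewrite [in RHS]H1// [LHS]H2// oppr0.
- have -> : antipode (0, b) = (0, - b) by rewrite /antipode /= oppr0.
  by rewrite H2 ?oppr_ge0// opprK antipodeK.
- have -> : antipode (a, 0) = (- a, 0) by rewrite /antipode /= oppr0.
  by rewrite H1 ?oppr_ge0.
Qed.

Lemma glue2 v : v.1 <= 0 -> 0 <= v.2 -> glue F G v = antipode (G (antipode v)).
Proof.
case: v => a b /= a0 b0; rewrite /glue /= b0; case: FG => H1 H2.
have E (c : R) : c <= 0 -> (0 <= c) -> c = 0 by move=> c0 c1; apply/eqP; rewrite eq_le c0.
case: ifPn => [/(E _ a0) ->|_] //.
have -> : antipode (0, b) = (0, - b) by rewrite /antipode /= oppr0.
by rewrite H2.
Qed.

Lemma glue_antipode v : glue F G (antipode v) = antipode (glue F G v).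
Proof.
have N1 : (antipode v).1 = - v.1 by [].
have N2 : (antipode v).2 = - v.2 by [].
have [a|/ltW a] := lerP 0 v.1; have [b|/ltW b] := lerP 0 v.2.
- by rewrite glue3 ?N1 ?N2 ?oppr_le0// antipodeK glue1.
- by rewrite glue2 ?N1 ?N2 ?oppr_le0 ?oppr_ge0// antipodeK glue4.
- by rewrite glue4 ?N1 ?N2 ?oppr_le0 ?oppr_ge0// glue2// antipodeK.
- by rewrite glue1 ?N1 ?N2 ?oppr_ge0// glue3// antipodeK.
Qed.

Lemma lip_glue v :
  (0 <= v.1 -> 0 <= v.2 -> lipschitz_at F v) ->
  (0 <= v.1 -> v.2 <= 0 -> lipschitz_at G v) ->
  (v.1 <= 0 -> v.2 <= 0 -> lipschitz_at F (antipode v)) ->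
  (v.1 <= 0 -> 0 <= v.2 -> lipschitz_at G (antipode v)) ->
  lipschitz_at (glue F G) v.
Proof.
move=> h1 h4 h3 h2.
have J K : lipschitz_at K (antipode v) ->
    lipschitz_at (fun w => antipode (K (antipode w))) v.
  move=> lK; apply: lip_comp; first exact: lip_antipode.
  by apply: lip_comp => //; exact: lip_antipode.
apply: lip_if; first exact: cvg_fst.
- move=> v0; have v10 : 0 <= v.1 by rewrite v0.
  have v01 : v.1 <= 0 by rewrite v0.
  have -> : (if 0 <= v.2 then F v else G v) = glue F G v by rewrite /glue v10.
  by case: ifPn => [b|]; [rewrite glue2|rewrite -ltNge => /ltW b; rewrite glue3].
- move=> v10; apply: lip_if; first exact: cvg_snd.
  + by case: v v10 {h1 h2 h3 h4 J} => a b /= a0 ->; case: FG => + _; exact.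
  + exact: h1.
  + exact: h4.
- move=> v10; apply: lip_if; first exact: cvg_snd.
  + case: v v10 {h1 h2 h3 h4 J} => a b /= a0 ->; case: FG => + _.
    have -> : antipode (a, 0) = (- a, 0) by rewrite /antipode /= oppr0.
    by move=> ->; rewrite ?oppr_ge0.
  + by move=> ?; apply: J; exact: h2.
  + by move=> ?; apply: J; exact: h3.
Qed.

Lemma continuous_glue :
  (forall v, 0 <= v.1 -> 0 <= v.2 -> {for v, continuous F}) ->
  (forall v, 0 <= v.1 -> v.2 <= 0 -> {for v, continuous G}) ->
  continuous (glue F G).
Proof.
move=> cF cG v.
have J K : {for antipode v, continuous K} ->
    {for v, continuous (fun w => antipode (K (antipode w)))}.
  move=> cK; apply: continuous_comp; last exact: lip_continuous (lip_antipode _).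
  by apply: continuous_comp => //; exact: lip_continuous (lip_antipode _).
apply: continuous_if; first exact: cvg_fst.
- move=> v0; have v10 : 0 <= v.1 by rewrite v0.
  have v01 : v.1 <= 0 by rewrite v0.
  have -> : (if 0 <= v.2 then F v else G v) = glue F G v by rewrite /glue v10.
  by case: ifPn => [b|]; [rewrite glue2|rewrite -ltNge => /ltW b; rewrite glue3].
- move=> v10; apply: continuous_if; first exact: cvg_snd.
  + by case: v v10 {J} => a b /= a0 ->; case: FG => + _; exact.
  + exact: cF.
  + exact: cG.
- move=> v10; apply: continuous_if; first exact: cvg_snd.
  + case: v v10 {J} => a b /= a0 ->; case: FG => + _.
    have -> : antipode (a, 0) = (- a, 0) by rewrite /antipode /= oppr0.
    by move=> ->; rewrite ?oppr_ge0.
  + by move=> ?; apply: J; apply: cG; rewrite /antipode /= ?oppr_ge0 ?oppr_le0.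
  + by move=> ?; apply: J; apply: cF; rewrite /antipode /= ?oppr_ge0 ?oppr_le0.
Qed.

End Glue.

End QuadrantGluing.

(** * The rotation that preserves the height *)

Section Rotation.
Variable R : realType.
Local Notation plane := (R * R)%type.
Implicit Types (v : plane) (X Y s : R).

Definition pos (a : R) := Num.max a 0.

(* With x = 1 - X and y = 1 - Y, [level X Y] is 1 - x y as soon as X or Y is at
   least 1/2; elsewhere it is a function of X + Y, equal to X + Y near 0. *)
Definition level X Y := X + Y - pos (X * Y - pos (2^-1 - X) * pos (2^-1 - Y)).

(** For [X] in [0, 1/2], the inverse of [level X]: max and min select one of three affine pieces.
    The inner max equals [1 - X] there and bounds the denominator away from 0 elsewhere, so that one
    formula is Lipschitz at every point. *)
Definition ilevel X s := Num.max (s - X)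
  (Num.min (2 * s - 2^-1 - X) (1 - (1 - s) / Num.max 2^-1 (1 - X))).

(** Equal to 1 for [s <= 1/2], which makes [rot] an exact quarter turn near the source, and to the
    unstable multiplier 2 on the boundary [s = 1]. *)
Definition speed s := Num.max 1 (2 * s).

(* [exit_map] carries each level curve of the first quadrant, and [entry_map] each
   segment X - Y = s of the fourth one, along itself and its continuation, at a
   speed for which the map is (X, Y) |-> ((1 + X) / 2, 2 Y - 1) near (1, 1). *)
Definition exit_map v : plane :=
  let c := Num.min v.2 2^-1 in let s := level v.1 c in
  (speed s * c, speed s * c - s + pos (2 * v.2 - 1)).

Definition entry_map v : plane :=
  let s := v.1 - v.2 in let x := - v.2 / speed s in (- x, - ilevel x s).

Definition rot : plane -> plane := glue exit_map entry_map.
Definition irot v : plane := swap (rot (swap v)).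

Lemma posE0 a : a <= 0 -> pos a = 0.
Proof. by move=> a0; rewrite /pos max_r. Qed.

Lemma posE a : 0 <= a -> pos a = a.
Proof. by move=> a0; rewrite /pos max_l. Qed.

Lemma level_sym X Y : level X Y = level Y X.
Proof. by rewrite /level (addrC X) (mulrC X) (mulrC (pos (2^-1 - X))). Qed.

Lemma level_out X Y : 0 <= X -> 0 <= Y -> 2^-1 <= X \/ 2^-1 <= Y ->
  level X Y = X + Y - X * Y.
Proof.
move=> X0 Y0 XY; rewrite /level.
have -> : pos (2^-1 - X) * pos (2^-1 - Y) = 0.
  by case: XY => h; [rewrite posE0 ?mul0r//|rewrite [X in _ * X]posE0 ?mulr0//]; rewrite subr_le0.
by rewrite subr0 posE// mulr_ge0.
Qed.

Lemma level_in X Y : 0 <= X -> 0 <= Y -> X + Y <= 2^-1 -> level X Y = X + Y.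
Proof. 
move=> X0 Y0 XY; rewrite /level (@posE (_ - X)) ?(@posE (_ - Y)) ?posE0 ?subr0//; nra.
Qed.

Lemma level_mid X Y : X <= 2^-1 -> Y <= 2^-1 -> 2^-1 <= X + Y ->
  level X Y = 4^-1 + (X + Y) / 2.
Proof. 
move=> X0 Y0 XY; rewrite /level (@posE (_ - X)) ?(@posE (_ - Y)) ?posE; try lra; nra.
Qed.

Variant level_spec X Y : R -> Prop :=
| LevelIn of X + Y <= 2^-1 : level_spec X Y (X + Y)
| LevelMid of X <= 2^-1 & Y <= 2^-1 & 2^-1 <= X + Y : level_spec X Y (4^-1 + (X + Y) / 2)
| LevelOut of 2^-1 <= X \/ 2^-1 <= Y : level_spec X Y (X + Y - X * Y).

Lemma levelP X Y : 0 <= X -> 0 <= Y -> level_spec X Y (level X Y).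
Proof.
move=> X0 Y0.
have [hX|hX] := lerP 2^-1 X; first by rewrite level_out//; [constructor|]; left.
have [hY|hY] := lerP 2^-1 Y; first by rewrite level_out//; [constructor|]; right.
have [h|/ltW h] := lerP (X + Y) 2^-1; first by rewrite level_in//; constructor.
by rewrite level_mid ?(ltW hX) ?(ltW hY)//; apply: LevelMid => //; exact: ltW.
Qed.

Variant ilevel_spec X s : R -> Prop :=
| IlevelIn of s <= 2^-1 : ilevel_spec X s (s - X)
| IlevelMid of 2^-1 <= s & s <= (1 + X) / 2 : ilevel_spec X s (2 * s - 2^-1 - X)
| IlevelOut of (1 + X) / 2 <= s : ilevel_spec X s (1 - (1 - s) / (1 - X)).

Lemma ilevelP X s : 0 <= X -> X <= 2^-1 -> X <= s -> ilevel_spec X s (ilevel X s).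
Proof.
move=> X0 X2 Xs; rewrite /ilevel (max_r (x := 2^-1) (y := 1 - X)); last by lra.
have x0 : 0 < 1 - X by lra.
have [h|h] := lerP s 2^-1.
  rewrite max_l; first exact: IlevelIn.
  by rewrite ge_min; apply/orP; left; lra.
have [h'|h'] := lerP s ((1 + X) / 2).
  rewrite min_l; last first.
    by rewrite lerBrDr -lerBrDl ler_pdivrMr//; nra.
  by rewrite max_r; [apply: IlevelMid => //; exact: ltW|lra].
have e : 1 - (1 - s) / (1 - X) <= 2 * s - 2^-1 - X.
  by rewrite lerBlDr -lerBlDl ler_pdivlMr//; nra.
rewrite min_r// max_r; first by apply: IlevelOut; exact: ltW.
by rewrite lerBrDr -lerBrDl ler_pdivrMr//; nra.
Qed.

Lemma level_ge X Y : 0 <= X -> 0 <= Y -> Y <= 1 -> Y <= level X Y.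
Proof. by move=> X0 Y0 X1; case: (levelP X0 Y0) => *; nra. Qed.

Lemma ilevel_level X Y : 0 <= X -> X <= 2^-1 -> 0 <= Y -> ilevel X (level X Y) = Y.
Proof.
move=> X0 X2 Y0.
have Xs : X <= level X Y by case: (levelP X0 Y0) => *; nra.
have x0 : 0 < 1 - X by lra.
have E : 2^-1 <= Y -> 1 - (1 - (X + Y - X * Y)) / (1 - X) = Y.
  by move=> _; field; rewrite gt_eqF.
move: Xs; case: (levelP X0 Y0) => [h|h1 h2 h3|h] Xs;
  case: (ilevelP X0 X2 Xs) => [g|g1 g2|g]; try lra.
- have -> : X + Y = 2^-1 by lra.
  have -> : X = 0 by lra.
  by rewrite subr0 divr1; lra.
- have hY : Y = 2^-1 by lra.
  by rewrite -[RHS]E ?hY//; congr (1 - _ / _); lra.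
- case: h => h; last by nra.
  have hX : X = 2^-1 by lra.
  by move: g; rewrite hX; lra.
- case: h => h.
    have hX : X = 2^-1 by lra.
    by move: g1 g2; rewrite hX; lra.
  by nra.
- case: h => h; last exact: E.
  have hX : X = 2^-1 by lra.
  by field; rewrite gt_eqF.
Qed.

Lemma ilevel_ge0 X s : 0 <= X -> X <= 2^-1 -> X <= s -> 0 <= ilevel X s.
Proof.
move=> X0 X2 Xs; case: (ilevelP X0 X2 Xs) => [|*|h]; try lra.
have x0 : 0 < 1 - X by lra.
by rewrite subr_ge0 ler_pdivrMr//; lra.
Qed.

Lemma level_ilevel X s : 0 <= X -> X <= 2^-1 -> X <= s -> level X (ilevel X s) = s.
Proof.
move=> X0 X2 Xs.
have x0 : 0 < 1 - X by lra.
case: (ilevelP X0 X2 Xs) => [h|h1 h2|h].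
- by rewrite level_in; lra.
- by rewrite level_mid; lra.
- have hY : 2^-1 <= 1 - (1 - s) / (1 - X).
    by rewrite lerBrDr -lerBrDl ler_pdivrMr//; lra.
  rewrite level_out//; [|lra|by right].
  by field; rewrite gt_eqF.
Qed.

Lemma speed_ge1 s : 1 <= speed s.
Proof. by rewrite /speed le_max lexx. Qed.

Lemma div_speed s Y : 0 <= Y -> Y <= s -> 0 <= Y / speed s /\ Y / speed s <= 2^-1 /\
  Y / speed s <= s.
Proof.
move=> Y0 Ys; have q1 := speed_ge1 s; have q0 : 0 < speed s by lra.
split; first by rewrite divr_ge0// ltW.
split; first by rewrite ler_pdivrMr// /speed maxr_pMr ?invr_ge0// le_max; apply/orP; right; lra.
by rewrite ler_pdivrMr//; nra.
Qed.

End Rotation.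

Ltac lip := repeat first
  [ exact: lip_cst | exact: lip_fst | exact: lip_snd | assumption
  | apply: lip_pair | apply: lip_max | apply: lip_min | apply: lipD | apply: lipM
  | apply: lipN | apply: lip_norm | apply: lip_inv ].

Section RotationDynamics.
Variable R : realType.
Local Notation plane := (R * R)%type.
Implicit Types (v : plane) (X Y s : R).

Lemma speed_gt0 s : 0 < speed s.
Proof. exact: lt_le_trans (speed_ge1 s). Qed.

Lemma rot_glueable : glueable (@exit_map R) (@entry_map R).
Proof.
have L0 Y : 0 <= Y -> level 0 Y = Y.
  by move=> Y0; case: (levelP (lexx 0) Y0) => *; lra.
split=> a a0; rewrite /exit_map /entry_map /antipode /=.
  rewrite min_l ?invr_ge0// level_sym L0// subr0 oppr0 !mul0r !mulr0 add0r posE0; last by lra.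
  rewrite addr0; congr pair; first by rewrite oppr0.
  have h2 : (0 : R) <= 2^-1 by lra.
  congr (- _); by case: (ilevelP (lexx 0) h2 a0) => *; rewrite ?subr0 ?divr1; lra.
have c0 : 0 <= Num.min a 2^-1 by rewrite le_min a0 invr_ge0 ler0n.
rewrite L0// !sub0r !opprK.
have [h|/ltW h] := lerP a 2^-1.
  have -> : speed a = 1 by rewrite /speed max_l//; lra.
  rewrite !mul1r divr1 subrr add0r posE0; last by lra.
  by congr pair; case: (ilevelP a0 h (lexx a)) => *; lra.
have -> : speed (2^-1 : R) = 1 by rewrite /speed max_l//; lra.
have -> : speed a = 2 * a by rewrite /speed max_r//; lra.
have a1 : 0 < a by lra.
have -> : a / (2 * a) = 2^-1 by field; rewrite gt_eqF.
rewrite !mul1r subrr add0r posE; last by lra.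
have h2 : (0 : R) <= 2^-1 by lra.
congr pair; case: (ilevelP h2 (lexx _) h) => *; try lra.
by field.
Qed.

Lemma rot_antipode v : rot (antipode v) = antipode (rot v).
Proof. exact: glue_antipode rot_glueable v. Qed.

Lemma irot_antipode v : irot (antipode v) = antipode (irot v).
Proof. by rewrite /irot swap_antipode rot_antipode swap_antipode. Qed.

Lemma rot_box X Y : 0 <= X -> 2^-1 <= Y ->
  rot (X, Y) = ((1 + X) / 2, 2 * Y - 1).
Proof.
move=> X0 Y2; rewrite /rot glue1 //=; last by lra.
rewrite /exit_map /= min_r// level_out ?invr_ge0//; last by right.
have -> : X + 2^-1 - X * 2^-1 = (1 + X) / 2 by field.
rewrite /speed max_r; last by lra.
by rewrite posE; [congr pair; field|lra].
Qed.

Lemma rot_exit X Y : 0 <= X -> 0 <= Y -> Y <= 2^-1 ->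
  rot (X, Y) = (speed (level X Y) * Y, speed (level X Y) * Y - level X Y).
Proof.
move=> X0 Y0 Y2; rewrite /rot glue1 //= /exit_map /= min_l//.
by rewrite posE0 ?addr0//; lra.
Qed.

Lemma exit_bounds X Y : 0 <= X -> 0 <= Y -> Y <= 2^-1 ->
  0 <= speed (level X Y) * Y <= level X Y.
Proof.
move=> X0 Y0 Y2; have Y1 : Y <= 1 by lra.
have h := level_ge X0 Y0 Y1; rewrite mulr_ge0 ?(ltW (speed_gt0 _))//=.
by rewrite /speed maxr_pMl// ge_max mul1r h /=; nra.
Qed.

Lemma rot_entry X Y : 0 <= X -> Y <= 0 ->
  rot (X, Y) = (Y / speed (X - Y), - ilevel (- Y / speed (X - Y)) (X - Y)).
Proof.
move=> X0 Y0; rewrite /rot (glue4 rot_glueable)// /entry_map /=.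
by rewrite mulNr opprK.
Qed.

(** Reversibility: reflection in the diagonal conjugates [rot] to its inverse. Seen through [swap]
    and [antipode], [exit_map] and [entry_map] undo each other because [ilevel] inverts [level] and
    both keep the same [s], hence the same speed. *)
Lemma rotSK v : rot (swap (rot (swap v))) = v.
Proof.
wlog : v / 0 <= v.1 => [W|].
  have [/W//|/ltW v0] := lerP 0 v.1.
  have := W (antipode v); rewrite /= oppr_ge0 => /(_ v0).
  by rewrite swap_antipode rot_antipode swap_antipode rot_antipode => /(can_inj (@antipodeK R)).
case: v => X Y /= X0; rewrite /swap /=.
have [Y0|/ltW Y0] := lerP 0 Y.
- have [X2|/ltW X2] := lerP X 2^-1.
  + rewrite [rot (Y, X)]rot_exit//=; have := exit_bounds Y0 X0 X2.
    set s := level Y X; set p := speed s => /andP[p0 ps].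
    have -> : (p * X - s, p * X) = antipode (s - p * X, - (p * X)).
      by rewrite /antipode /=; congr pair; ring.
    rewrite rot_antipode rot_entry; [|by lra..].
    have -> : s - p * X - - (p * X) = s by ring.
    rewrite -/p !opprK mulrAC mulfV ?gt_eqF ?speed_gt0// mul1r.
    rewrite /s level_sym ilevel_level// /antipode /= opprK mulNr opprK.
    by rewrite mulrAC mulfV ?gt_eqF ?speed_gt0// mul1r.
  + rewrite [rot (Y, X)]rot_box//=.
    by rewrite rot_box; [congr pair; field|lra|lra].
- have -> : (Y, X) = antipode (- Y, - X) by rewrite /antipode /= !opprK.
  rewrite [rot (antipode _)]rot_antipode [rot (- Y, - X)]rot_entry; [|by lra..].
  have -> : - Y - - X = X - Y by ring.
  set s := X - Y; rewrite /antipode /= !opprK.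
  have Xs : X <= s by rewrite /s; lra.
  have [q0 [q2 qs]] := div_speed X0 Xs.
  rewrite mulNr opprK rot_exit //; last by apply: ilevel_ge0.
  rewrite level_sym level_ilevel// mulrC mulfVK ?gt_eqF ?speed_gt0//.
  by congr pair; rewrite /s; ring.
Qed.

Lemma rotK : cancel (@rot R) (@irot R).
Proof. by move=> v; rewrite /irot; have := rotSK (swap v); rewrite swapK => ->; rewrite swapK. Qed.

Lemma irotK : cancel (@irot R) (@rot R).
Proof. by move=> v; rewrite /irot rotSK. Qed.

Lemma lip_rot v : lipschitz_at (@rot R) v.
Proof.
have P (f : plane -> R) w : lipschitz_at f w -> lipschitz_at (fun z => pos (f z)) w.
  by move=> ?; apply: lip_max => //; exact: lip_cst.
have l1 w : lipschitz_at (@exit_map R) w.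
  rewrite /exit_map /level /speed; lip; apply: P; lip; apply: P; lip.
have l2 w : lipschitz_at (@entry_map R) w.
  rewrite /entry_map /ilevel; lip;
    by rewrite gt_eqF ?speed_gt0// lt_max ?invr_gt0 ?ltr0n.
by apply: (lip_glue rot_glueable).
Qed.

Lemma lip_irot v : lipschitz_at (@irot R) v.
Proof.
apply: lip_comp; first exact: lip_swap.
by apply: lip_comp; [exact: lip_rot|exact: lip_swap].
Qed.

End RotationDynamics.

(** * The radial expansion near the source *)

Section RadialPush.
Variable R : realType.
Local Notation plane := (R * R)%type.
Implicit Types v : plane.

Definition norm1 v : R := `|v.1| + `|v.2|.

Definition scale (k : R) v : plane := (k * v.1, k * v.2).

(** The profile [a * push_factor a] of the radius [a = norm1 v] is [2 * a] up to 1/4, then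
    [a / 2 + 3 / 8], then [a] from 3/4 on. That of [pull_factor] is the inverse: [a / 2],
    [2 * a - 3 / 4], [a]. The inner max avoids a division by 0. *)
Definition push_factor (a : R) : R := Num.max 1 (2^-1 + 3 / (8 * Num.max a 4^-1)).
Definition pull_factor (a : R) : R := Num.min 1 (2 - 3 / (4 * Num.max a 2^-1)).

Definition radial_push v := scale (push_factor (norm1 v)) v.
Definition radial_pull v := scale (pull_factor (norm1 v)) v.

Lemma norm1_scale k v : 0 <= k -> norm1 (scale k v) = k * norm1 v.
Proof. by move=> k0; rewrite /norm1 /= !normrM (ger0_norm k0) mulrDr. Qed.

Lemma norm1_ge0 v : 0 <= norm1 v.
Proof. by rewrite addr_ge0. Qed.

Lemma scale_scale k l v : scale k (scale l v) = scale (k * l) v.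
Proof. by rewrite /scale /= !mulrA. Qed.

Lemma scale1 v : scale 1 v = v.
Proof. by case: v => a b; rewrite /scale /= !mul1r. Qed.

Lemma scale_antipode k v : scale k (antipode v) = antipode (scale k v).
Proof. by rewrite /scale /antipode /= !mulrN. Qed.

Lemma norm1_antipode v : norm1 (antipode v) = norm1 v.
Proof. by rewrite /norm1 /= !normrN. Qed.

Lemma radial_push_antipode v : radial_push (antipode v) = antipode (radial_push v).
Proof. by rewrite /radial_push norm1_antipode scale_antipode. Qed.

Lemma radial_pull_antipode v : radial_pull (antipode v) = antipode (radial_pull v).
Proof. by rewrite /radial_pull norm1_antipode scale_antipode. Qed.

Lemma push_factor_near a : a <= 4^-1 -> push_factor a = 2.
Proof.
move=> h; rewrite /push_factor (max_r h).
have -> : 2^-1 + 3 / (8 * 4^-1) = 2 :> R by field.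
by rewrite max_r//; lra.
Qed.

Lemma push_factor_mid a : 4^-1 <= a -> a <= 3 / 4 -> push_factor a = 2^-1 + 3 / (8 * a).
Proof.
move=> h1 h2; rewrite /push_factor (max_l h1) max_r// -lerBlDl ler_pdivlMr; lra.
Qed.

Lemma push_factor_far a : 3 / 4 <= a -> push_factor a = 1.
Proof.
move=> h; rewrite /push_factor (@max_l _ _ a); last by lra.
by rewrite max_l// -lerBrDl ler_pdivrMr; lra.
Qed.

Lemma push_factor_ge1 a : 1 <= push_factor a.
Proof. by rewrite /push_factor le_max lexx. Qed.

Lemma push_factor_gt1 a : a < 3 / 4 -> 1 < push_factor a.
Proof.
move=> h; have [h'|/ltW h'] := lerP a 4^-1; first by rewrite push_factor_near//; lra.
by rewrite push_factor_mid ?(ltW h)// -ltrBlDl ltr_pdivlMr; lra.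
Qed.

Lemma pull_factor_near a : a <= 2^-1 -> pull_factor a = 2^-1.
Proof.
move=> h; rewrite /pull_factor (max_r h).
have -> : 2 - 3 / (4 * 2^-1) = 2^-1 :> R by field.
by rewrite min_r//; lra.
Qed.

Lemma pull_factor_mid a : 2^-1 <= a -> a <= 3 / 4 -> pull_factor a = 2 - 3 / (4 * a).
Proof.
move=> h1 h2; rewrite /pull_factor (max_l h1) min_r// lerBlDr -lerBlDl ler_pdivlMr; lra.
Qed.

Lemma pull_factor_far a : 3 / 4 <= a -> pull_factor a = 1.
Proof.
move=> h; rewrite /pull_factor (@max_l _ _ a); last by lra.
by rewrite min_l// lerBrDr -lerBrDl ler_pdivrMr; lra.
Qed.

Lemma radial_pushK : cancel radial_push radial_pull.
Proof.
move=> v; rewrite /radial_pull /radial_push; set a := norm1 v.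
rewrite norm1_scale; last by apply: le_trans (push_factor_ge1 _).
rewrite scale_scale -/a -[RHS]scale1; congr scale.
have [h1|/ltW h1] := lerP a 4^-1.
  rewrite push_factor_near// pull_factor_near; [by field|lra].
have [h2|/ltW h2] := lerP a (3 / 4); last by rewrite push_factor_far// mul1r pull_factor_far// mul1r.
have a0 : 0 < a by lra.
rewrite push_factor_mid//.
have -> : (2^-1 + 3 / (8 * a)) * a = a / 2 + 3 / 8 by field; rewrite gt_eqF.
rewrite pull_factor_mid; [|lra..].
by field; rewrite !gt_eqF//; lra.
Qed.

Lemma radial_pullK : cancel radial_pull radial_push.
Proof.
have pull0 a : 0 <= pull_factor a.
  have [h1|/ltW h1] := lerP a 2^-1; first by rewrite pull_factor_near.
  have [h2|/ltW h2] := lerP a (3 / 4); last by rewrite pull_factor_far.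
  by rewrite pull_factor_mid// subr_ge0 ler_pdivrMr; lra.
move=> v; rewrite /radial_pull /radial_push; set a := norm1 v.
rewrite norm1_scale// scale_scale -/a -[RHS]scale1; congr scale.
have [h1|/ltW h1] := lerP a 2^-1.
  rewrite pull_factor_near// push_factor_near; [by field|lra].
have [h2|/ltW h2] := lerP a (3 / 4); last by rewrite pull_factor_far// mul1r push_factor_far// mul1r.
have a0 : 0 < a by lra.
rewrite pull_factor_mid//.
have -> : (2 - 3 / (4 * a)) * a = 2 * a - 3 / 4 by field; rewrite gt_eqF.
rewrite push_factor_mid; [|lra..].
by field; rewrite !gt_eqF//; lra.
Qed.

Lemma lip_radial_push v : lipschitz_at radial_push v.
Proof.
rewrite /radial_push /scale /push_factor /norm1; lip;
    by rewrite gt_eqF// mulr_gt0// lt_max invr_gt0 ltr0n orbT.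
Qed.

Lemma lip_radial_pull v : lipschitz_at radial_pull v.
Proof.
rewrite /radial_pull /scale /pull_factor /norm1; lip;
    by rewrite gt_eqF// mulr_gt0// lt_max invr_gt0 ltr0n orbT.
Qed.

End RadialPush.

(** * A one-parameter group of homeomorphisms, flat at 0 *)

Section Flattening.
Variable R : realType.
Implicit Types (c d w : R).

(* On ]0, 1/2[ the coordinate [depth] turns [flatten c] into d |-> c * d, so
   that the [flatten c] form a one-parameter group; 1 - ln (2 w) is raised to
   the power c, which makes [flatten c] flatter than any power at 0. *)
Definition depth w := ln (1 - ln (2 * w)).
Definition of_depth d := expR (1 - expR d) / 2.

Definition flatten c w :=
  if (0 < w) && (w < 2^-1) then of_depth (c * depth w) else w.

Lemma ln2w w : 0 < w -> w < 2^-1 -> ln (2 * w) < 0.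
Proof. by move=> w0 w1; apply: ln_lt0; apply/andP; split; lra. Qed.

Lemma depth_gt0 w : 0 < w -> w < 2^-1 -> 0 < depth w.
Proof. by move=> w0 w1; apply: ln_gt0; have := ln2w w0 w1; lra. Qed.

Lemma of_depthK d : depth (of_depth d) = d.
Proof.
rewrite /depth /of_depth mulrCA mulfV ?mulr1 ?pnatr_eq0// expRK.
by have -> : 1 - (1 - expR d) = expR d by [ring]; rewrite expRK.
Qed.

Lemma depthK w : 0 < w -> w < 2^-1 -> of_depth (depth w) = w.
Proof.
move=> w0 w1; have l := ln2w w0 w1; rewrite /depth /of_depth lnK ?posrE; last by lra.
have -> : 1 - (1 - ln (2 * w)) = ln (2 * w) by ring.
by rewrite lnK ?posrE; [field|lra].
Qed.

Lemma of_depth_gt0 d : 0 < of_depth d.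
Proof. by rewrite divr_gt0// expR_gt0. Qed.

Lemma of_depth_lt d : 0 < d -> of_depth d < 2^-1.
Proof.
move=> d0; rewrite /of_depth ltr_pdivrMr// mulVf ?pnatr_eq0// -[ltRHS]expR0 ltr_expR.
have : 1 < expR d by rewrite expR_gt1.
lra.
Qed.

Lemma of_depth_lt_mono d e : (of_depth d < of_depth e) = (e < d).
Proof.
by rewrite /of_depth ltr_pM2r ?invr_gt0// ltr_expR ltrD2l ltrN2 ltr_expR.
Qed.

Lemma of_depth_le_mono d e : (of_depth d <= of_depth e) = (e <= d).
Proof. by rewrite !leNgt of_depth_lt_mono. Qed.

Lemma flatten_out c w : w <= 0 \/ 2^-1 <= w -> flatten c w = w.
Proof. by rewrite /flatten; case: ifP => // /andP[? ?] []; lra. Qed.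

Lemma flatten_in c w : 0 < w -> w < 2^-1 -> flatten c w = of_depth (c * depth w).
Proof. by move=> w0 w1; rewrite /flatten w0 w1. Qed.

Variant flatten_spec c w : R -> Prop :=
| FlattenOut of w <= 0 \/ 2^-1 <= w : flatten_spec c w w
| FlattenIn of 0 < w & w < 2^-1 : flatten_spec c w (of_depth (c * depth w)).

Lemma flattenP c w : flatten_spec c w (flatten c w).
Proof.
have [w0|w0] := lerP w 0; first by rewrite flatten_out; [apply: FlattenOut|]; left.
have [w1|w1] := lerP 2^-1 w; first by rewrite flatten_out; [apply: FlattenOut|]; right.
by rewrite flatten_in//; exact: FlattenIn.
Qed.

Lemma flatten1 w : flatten 1 w = w.
Proof. by case: flattenP => // w0 w1; rewrite mul1r depthK. Qed.

Lemma flatten_gt0 c w : 0 < w -> 0 < flatten c w.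
Proof. by move=> w0; case: flattenP => // *; exact: of_depth_gt0. Qed.

Lemma flatten_lt c w : 0 < c -> w < 2^-1 -> flatten c w < 2^-1.
Proof. by move=> c0 w0; case: flattenP => // *; rewrite of_depth_lt// mulr_gt0// depth_gt0. Qed.

Lemma flatten_depth c w : 0 < w -> w < 2^-1 -> depth (flatten c w) = c * depth w.
Proof. by move=> w0 w1; rewrite flatten_in// of_depthK. Qed.

Lemma flatten_flatten b c w : 0 < c -> flatten b (flatten c w) = flatten (b * c) w.
Proof.
move=> c0; case: (flattenP c w) => [h|w0 w1]; first by rewrite !flatten_out.
by rewrite flatten_in ?of_depth_gt0 ?of_depth_lt ?mulr_gt0 ?depth_gt0// of_depthK mulrA flatten_in.
Qed.

Lemma flatten_le c w : 1 <= c -> flatten c w <= w.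
Proof.
move=> c1; case: flattenP => // w0 w1.
by rewrite -{2}(depthK w0 w1) of_depth_le_mono ler_peMl// ltW// depth_gt0.
Qed.

Lemma flatten_lt_id c w : 1 < c -> 0 < w -> w < 2^-1 -> flatten c w < w.
Proof.
move=> c1 w0 w1; rewrite flatten_in// -{2}(depthK w0 w1) of_depth_lt_mono.
by rewrite ltr_pMl// depth_gt0.
Qed.

Lemma flatten_anti b c w : b <= c -> flatten c w <= flatten b w.
Proof.
move=> bc; case: (flattenP b w) => [h|w0 w1]; first by rewrite flatten_out.
by rewrite flatten_in// of_depth_le_mono ler_wpM2r// ltW// depth_gt0.
Qed.

Lemma depth_anti v w : 0 < v -> v < w -> w < 2^-1 -> depth w < depth v.
Proof. by move=> v0 vw w1; rewrite -of_depth_lt_mono !depthK//; lra. Qed.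

Lemma flatten_mono c v w : 0 < c -> 0 < v -> v < w -> w < 2^-1 -> flatten c v < flatten c w.
Proof.
move=> c0 v0 vw w1; rewrite !flatten_in//; [|lra..].
by rewrite of_depth_lt_mono ltr_pM2l// depth_anti.
Qed.

Lemma lip_expR (V : normedModType R) (f : V -> R) (v : V) : lipschitz_at f v ->
  lipschitz_at (fun z => expR (f z)) v.
Proof. by apply: lip_comp; apply: lip_derivable; exact: derivable_expR. Qed.

Lemma lip_ln (V : normedModType R) (f : V -> R) (v : V) : 0 < f v -> lipschitz_at f v ->
  lipschitz_at (fun z => ln (f z)) v.
Proof.
move=> f0; apply: lip_comp; apply: lip_derivable.
by have [] := is_derive1_ln f0.
Qed.

Section FlattenRegularity.
Variables (V : normedModType R) (phi psi : V -> R) (v : V).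

(** One expression for all positive [psi]: [depth] vanishes at 1/2, where the two pieces of
    [flatten] therefore join. *)
Let formula z := of_depth (phi z * depth (Num.min (psi z) 2^-1)) +
  Num.max 0 (psi z - 2^-1).

Let formulaE z : 0 < psi z -> flatten (phi z) (psi z) = formula z.
Proof.
move=> p0; rewrite /formula; have [p1|p1] := ltrP (psi z) 2^-1.
  by rewrite max_l ?addr0 ?flatten_in//; lra.
rewrite flatten_out; last by right.
rewrite max_r; last by lra.
rewrite /depth mulfV ?pnatr_eq0// ln1 subr0 ln1 mulr0 /of_depth expR0 subrr expR0.
lra.
Qed.

Lemma lip_flatten_neq0 : psi v != 0 -> lipschitz_at phi v -> lipschitz_at psi v ->
  lipschitz_at (fun z => flatten (phi z) (psi z)) v.
Proof.
move=> pv0 lphi lpsi; have cpsi := lip_continuous lpsi.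
have [p0|p0] := ltrP 0 (psi v).
  apply: (@lip_near _ _ _ _ formula).
    near=> z; apply: formulaE; near: z; exact: (cvgr_gt _ cpsi).
  have m0 : 0 < Num.min (psi v) 2^-1 by rewrite lt_min p0 invr_gt0 ltr0n.
  have m1 : ln (2 * Num.min (psi v) 2^-1) <= 0.
    rewrite ln_le0//; have : Num.min (psi v) 2^-1 <= 2^-1 by rewrite ge_min lexx orbT.
    lra.
  rewrite /formula /of_depth /depth; lip; apply: lip_expR; lip; apply: lip_expR; lip.
  apply: lip_ln; first by lra.
  by lip; apply: lip_ln; [rewrite mulr_gt0|lip].
apply: (@lip_near _ _ _ _ psi) => //.
near=> z; apply: flatten_out; left; apply: ltW; near: z; apply: (cvgr_lt _ cpsi).
by rewrite lt_neqAle pv0.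
Unshelve. all: by end_near. Qed.

(** Where [psi] vanishes, an exponent at least 1 gives [flatten <= psi] on the positive side, so the
    constant of [psi] is enough. *)
Lemma lip_flatten : (forall z, 1 <= phi z) -> lipschitz_at phi v -> lipschitz_at psi v ->
  lipschitz_at (fun z => flatten (phi z) (psi z)) v.
Proof.
move=> phi1 lphi lpsi; have [p0|] := eqVneq (psi v) 0; last by move=> ?; exact: lip_flatten_neq0.
apply: (@lip_bound _ _ _ _ _ 1 psi) => //; near=> z.
rewrite p0 (@flatten_out _ 0) ?subr0 ?mul1r; last by left.
have [q0|q0] := lerP (psi z) 0; first by rewrite flatten_out//; left.
by rewrite !gtr0_norm ?flatten_gt0// flatten_le.
Unshelve. all: by end_near. Qed.

(** An exponent below 1 gives an infinite slope at 0. But all exponents from 1/2 on are dominated by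
    the exponent 1/2, which is controlled through its inverse, the exponent 2. *)
Lemma continuous_flatten : (forall z, 2^-1 <= phi z) ->
  lipschitz_at phi v -> lipschitz_at psi v ->
  {for v, continuous (fun z => flatten (phi z) (psi z))}.
Proof.
move=> phi1 lphi lpsi; have [p0|] := eqVneq (psi v) 0; last first.
  by move=> ?; apply: lip_continuous; exact: lip_flatten_neq0.
have cpsi := lip_continuous lpsi.
apply/cvgrPdist_lt => e e0; rewrite p0 flatten_out; last by left.
pose e1 := Num.min e 4^-1.
have e10 : 0 < e1 by rewrite lt_min e0 invr_gt0 ltr0n.
have e11 : e1 < 2^-1 by rewrite gt_min; apply/orP; right; lra.
near=> z; rewrite sub0r normrN.
have pze : `|psi z| < Num.min e (flatten 2 e1).
  rewrite -[psi z]subr0 -p0 distrC; near: z; move/cvgrPdist_lt : cpsi; apply.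
  by rewrite lt_min e0 flatten_gt0.
move: pze; rewrite lt_min => /andP[pze pzf].
have [q0|q0] := lerP (psi z) 0; first by rewrite flatten_out//; left.
rewrite gtr0_norm ?flatten_gt0//; move: pzf; rewrite gtr0_norm// => pzf.
apply: (@lt_le_trans _ _ e1); last by rewrite ge_min lexx.
apply: le_lt_trans (flatten_anti _ (phi1 z)) _.
have E : e1 = flatten 2^-1 (flatten 2 e1).
  by rewrite flatten_flatten// mulVf ?pnatr_eq0// flatten1.
rewrite [ltRHS]E; apply: flatten_mono => //.
exact: flatten_lt.
Unshelve. all: by end_near. Qed.

End FlattenRegularity.

End Flattening.

(** * The push towards the boundary *)

Section EdgePush.
Variable R : realType.
Local Notation plane := (R * R)%type.
Implicit Types (v : plane) (X Y s : R) (kap : R -> R).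

Definition clamp (a : R) := Num.max 0 (Num.min 1 a).

(* [edge_box] moves Y only and turns x y into its image by [flatten]; [edge_side]
   does the same with 1 - (X - Y), along rays.  The exponent kap b is 1 near the
   saddles, where b = 0; on the line X = 0 one has b = 1. *)
Definition edge_box kap v : plane :=
  let x := 1 - v.1 in let y := 1 - v.2 in
  (v.1, v.2 - (flatten (kap (clamp (2 * x - 1))) (x * y) - x * y) / Num.max x 2^-1).

Definition edge_side kap v : plane :=
  let s := v.1 - v.2 in let b := clamp (- v.2 / Num.max s 2^-1) in
  scale (1 + (1 - flatten (kap b) (1 - s) - s) / Num.max s 2^-1) v.

Definition edge kap : plane -> plane := glue (edge_box kap) (edge_side kap).

Lemma clamp0 a : a <= 0 -> clamp a = 0.
Proof. by move=> h; rewrite /clamp max_l// ge_min h orbT. Qed.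

Lemma clampE a : 0 <= a -> a <= 1 -> clamp a = a.
Proof. by move=> h0 h1; rewrite /clamp min_r// max_r. Qed.

Lemma clamp_ge0 a : 0 <= clamp a.
Proof. by rewrite /clamp le_max lexx. Qed.

Lemma clamp_le1 a : clamp a <= 1.
Proof. by rewrite /clamp ge_max ler01 ge_min lexx. Qed.

Section Edge.
Variable kap : R -> R.
Hypothesis kap0 : kap 0 = 1.

Lemma edge_box_far X Y : 2^-1 <= X -> edge_box kap (X, Y) = (X, Y).
Proof.
move=> h; rewrite /edge_box /= clamp0; last by lra.
by rewrite kap0 flatten1 subrr mul0r subr0.
Qed.

Lemma edge_box_near X Y : 0 <= X -> X <= 2^-1 -> edge_box kap (X, Y) =
  (X, 1 - flatten (kap (1 - 2 * X)) ((1 - X) * (1 - Y)) / (1 - X)).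
Proof.
move=> h0 h1; rewrite /edge_box /= max_l; last by lra.
have -> : 2 * (1 - X) - 1 = 1 - 2 * X by ring.
rewrite clampE; [|lra..].
by congr pair; field; rewrite gt_eqF//; lra.
Qed.

Lemma edge_side_near X Y : X - Y <= 2^-1 -> edge_side kap (X, Y) = (X, Y).
Proof.
move=> h; rewrite /edge_side /= flatten_out; last by right; lra.
by have -> : 1 - (1 - (X - Y)) - (X - Y) = 0 by [ring]; rewrite mul0r addr0 scale1.
Qed.

Lemma edge_side_far X Y : 0 <= X -> Y <= 0 -> 2^-1 <= X - Y -> edge_side kap (X, Y) =
  scale ((1 - flatten (kap (- Y / (X - Y))) (1 - (X - Y))) / (X - Y)) (X, Y).
Proof.
move=> h0 h1 h2; rewrite /edge_side /= max_l// clampE; first last.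
- by rewrite ler_pdivrMr; lra.
- by rewrite divr_ge0; lra.
by congr scale; field; rewrite gt_eqF//; lra.
Qed.

Lemma edge_glueable : glueable (edge_box kap) (edge_side kap).
Proof.
split=> a a0.
- have -> : edge_side kap (a, 0) = (a, 0).
    rewrite /edge_side /= subr0 oppr0 mul0r clamp0// kap0 flatten1.
    by have -> : 1 - (1 - a) - a = 0 by [ring]; rewrite mul0r addr0 scale1.
  have [h|/ltW h] := lerP 2^-1 a; first by rewrite edge_box_far.
  rewrite edge_box_near// subr0 mulr1 flatten_out; last by right; lra.
  by rewrite divff ?subrr// gt_eqF//; lra.
- rewrite edge_box_near ?invr_ge0//.
  have -> : 1 - 2 * 0 = 1 :> R by ring.
  rewrite !subr0 mul1r divr1.
  have [h|/ltW h] := lerP a 2^-1.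
    rewrite edge_side_near ?sub0r ?opprK// /antipode /= oppr0 opprK.
    by rewrite flatten_out; [congr pair; ring|right; lra].
  rewrite edge_side_far ?sub0r ?opprK ?oppr_le0//.
  rewrite divff; last by rewrite gt_eqF//; lra.
  rewrite /antipode /scale /= mulr0 oppr0 mulrN opprK mulfVK// gt_eqF//; lra.
Qed.

Lemma edge_antipode v : edge kap (antipode v) = antipode (edge kap v).
Proof. exact: glue_antipode edge_glueable v. Qed.

Lemma edge1 v : 0 <= v.1 -> 0 <= v.2 -> edge kap v = edge_box kap v.
Proof. exact: glue1. Qed.

Lemma edge4 v : 0 <= v.1 -> v.2 <= 0 -> edge kap v = edge_side kap v.
Proof. exact: glue4 edge_glueable v. Qed.

Lemma edge_box_quadrant v : (forall b, 0 <= b <= 1 -> 0 < kap b) ->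
  0 <= v.1 -> 0 <= v.2 -> 0 <= (edge_box kap v).2.
Proof.
case: v => X Y kp /= X0 Y0.
have [h|/ltW h] := lerP 2^-1 X; first by have := congr1 snd (edge_box_far Y h) => /= ->.
have := congr1 snd (edge_box_near Y X0 h) => /= ->.
rewrite subr_ge0 ler_pdivrMr; last by lra.
rewrite mul1r; case: flattenP => [_|w0 w1]; first by nra.
apply: (@le_trans _ _ 2^-1); last by lra.
by rewrite ltW// of_depth_lt// mulr_gt0 ?depth_gt0// kp//; lra.
Qed.

End Edge.

(** The map preserves the parameter [b] of its own exponent: [b] depends on X alone in the box and
    is constant along rays on the side. So on each fibre two members of the group [flatten] are
    composed, and their exponents multiply to 1. *)
Lemma edgeK (kap kap' : R -> R) : kap 0 = 1 -> kap' 0 = 1 ->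
  (forall b, 0 <= b <= 1 -> 0 < kap b /\ kap' b * kap b = 1) ->
  cancel (edge kap) (edge kap').
Proof.
move=> k0 k'0 kk v; have kp b : 0 <= b <= 1 -> 0 < kap b by move=> /kk[].
have kf b w : 0 <= b <= 1 -> flatten (kap' b) (flatten (kap b) w) = w.
  by move=> /kk[kb0 kb]; rewrite flatten_flatten// kb flatten1.
wlog : v / 0 <= v.1 => [W|].
  have [/W//|/ltW v0] := lerP 0 v.1.
  have := W (antipode v); rewrite /= oppr_ge0 => /(_ v0).
  by rewrite !edge_antipode// => /(can_inj (@antipodeK R)).
case: v => X Y /= X0; have [Y0|/ltW Y0] := lerP 0 Y.
  have q := edge_box_quadrant k0 kp (X0 : 0 <= (X, Y).1) (Y0 : 0 <= (X, Y).2).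
  rewrite [edge kap _]edge1// edge1//.
  have [h|/ltW h] := lerP 2^-1 X; first by rewrite !edge_box_far.
  have b01 : 0 <= 1 - 2 * X <= 1 by lra.
  rewrite !edge_box_near//.
  have -> : 1 - (1 - flatten (kap (1 - 2 * X)) ((1 - X) * (1 - Y)) / (1 - X)) =
    flatten (kap (1 - 2 * X)) ((1 - X) * (1 - Y)) / (1 - X) by ring.
  rewrite mulrCA divff ?mulr1; last by rewrite gt_eqF//; lra.
  rewrite kf// mulrAC divff; last by rewrite gt_eqF//; lra.
  by congr pair; ring.
have [h|/ltW h] := lerP (X - Y) 2^-1; first by rewrite !edge4 ?edge_side_near.
rewrite [edge kap _]edge4// edge_side_far//.
set s := X - Y; set b := - Y / s; set s' := 1 - flatten (kap b) (1 - s).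
have s0 : 0 < s by rewrite /s; lra.
have b01 : 0 <= b <= 1.
  rewrite /b; apply/andP; split; first by rewrite divr_ge0 ?oppr_ge0// ltW.
  by rewrite ler_pdivrMr// mul1r /s; lra.
have s'2 : 2^-1 <= s'.
  rewrite /s'; case: flattenP => [|w0 w1]; first by rewrite /s; lra.
  suff : of_depth (kap b * depth (1 - s)) < 2^-1 by lra.
  by rewrite of_depth_lt// mulr_gt0 ?depth_gt0// kp.
have k0' : 0 < s' / s by rewrite divr_gt0//; lra.
have sE : s' / s * X - s' / s * Y = s'.
  by rewrite -mulrBr mulfVK// gt_eqF.
rewrite edge4//=; [|by rewrite mulr_ge0// ltW|by rewrite mulr_ge0_le0// ltW].
rewrite /scale /= edge_side_far ?sE//; [|by rewrite mulr_ge0// ltW|by rewrite mulr_ge0_le0// ltW].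
have -> : - (s' / s * Y) / s' = b.
  by rewrite /b; field; rewrite !gt_eqF//; lra.
have -> : 1 - s' = flatten (kap b) (1 - s) by rewrite /s'; ring.
rewrite kf//.
have -> : (1 - (1 - s)) / s' = s / s' by congr (_ / _); ring.
rewrite /scale /=.
have E z : s / s' * (s' / s * z) = z by field; rewrite !gt_eqF//; lra.
by rewrite !E.
Qed.

Definition kap_push (b : R) := 1 + b.
Definition kap_pull (b : R) := (1 + b)^-1.

Lemma kap_push0 : kap_push 0 = 1. Proof. by rewrite /kap_push addr0. Qed.
Lemma kap_pull0 : kap_pull 0 = 1. Proof. by rewrite /kap_pull addr0 invr1. Qed.

Lemma edge_pushK : cancel (edge kap_push) (edge kap_pull).
Proof.
apply: edgeK; [exact: kap_push0|exact: kap_pull0|move=> b b01; rewrite /kap_push /kap_pull].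
by split; [lra|rewrite mulVf// gt_eqF//; lra].
Qed.

Lemma edge_pullK : cancel (edge kap_pull) (edge kap_push).
Proof.
apply: edgeK; [exact: kap_pull0|exact: kap_push0|move=> b b01; rewrite /kap_push /kap_pull].
by split; [rewrite invr_gt0; lra|rewrite mulfV// gt_eqF//; lra].
Qed.

Lemma lip_edge_push v : lipschitz_at (edge kap_push) v.
Proof.
have max0 (a : R) : Num.max a 2^-1 != 0.
  by rewrite gt_eqF// lt_max invr_gt0 ltr0n orbT.
have k1 a : 1 <= kap_push (clamp a) by rewrite /kap_push lerDl clamp_ge0.
have l1 w : lipschitz_at (edge_box kap_push) w.
  rewrite /edge_box /= ; apply: lip_pair; first exact: lip_fst.
  apply: lipD; first exact: lip_snd; apply: lipN; apply: lipM; last by lip.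
  apply: lipD; last by lip.
  apply: lip_flatten => //; last by lip.
  by rewrite /kap_push /clamp; lip.
have l2 w : lipschitz_at (edge_side kap_push) w.
  rewrite /edge_side /scale /=.
  have l : lipschitz_at (fun z : plane => flatten
      (kap_push (clamp (- z.2 / Num.max (z.1 - z.2) 2^-1))) (1 - (z.1 - z.2))) w.
    apply: lip_flatten => //; last by lip.
    by rewrite /kap_push /clamp; lip.
  by lip.
by apply: (lip_glue (edge_glueable kap_push0)).
Qed.

Lemma kap_pull_bound (a : R) : 2^-1 <= kap_pull (clamp a).
Proof.
have := clamp_ge0 a; have := clamp_le1 a; rewrite /kap_pull => h1 h0.
by rewrite lef_pV2 ?posrE//; lra.
Qed.

Lemma lip_clamp (V : normedModType R) (f : V -> R) (v : V) : lipschitz_at f v ->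
  lipschitz_at (fun z => kap_pull (clamp (f z))) v.
Proof.
move=> lf; rewrite /kap_pull /clamp; lip.
by have := clamp_ge0 (f v); rewrite /clamp => h; rewrite gt_eqF//; lra.
Qed.

Lemma continuous_edge_pull : continuous (edge kap_pull).
Proof.
have max0 (a : R) : Num.max a 2^-1 != 0.
  by rewrite gt_eqF// lt_max invr_gt0 ltr0n orbT.
have cD (f g : plane -> R) w : {for w, continuous f} -> {for w, continuous g} ->
    {for w, continuous (fun z => f z + g z)} by exact: cvgD.
have cM (f g : plane -> R) w : {for w, continuous f} -> {for w, continuous g} ->
    {for w, continuous (fun z => f z * g z)} by exact: cvgM.
have cN (f : plane -> R) w : {for w, continuous f} ->
    {for w, continuous (fun z => - f z)} by exact: cvgN.
have cP (f g : plane -> R) w : {for w, continuous f} -> {for w, continuous g} ->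
    {for w, continuous (fun z => (f z, g z))} by exact: cvg_pair.
have cL (f : plane -> R) w : lipschitz_at f w -> {for w, continuous f}.
  exact: lip_continuous.
apply: (continuous_glue (edge_glueable kap_pull0)) => v _ _.
- rewrite /edge_box /=; apply: (cP _ _ _); first by apply: (cL _ _); lip.
  apply: (cD _ _ _); first by apply: (cL _ _); lip.
  apply: (cN _ _); apply: (cM _ _ _); last by apply: (cL _ _); lip.
  apply: (cD _ _ _); last by apply: (cL _ _); lip.
  apply: continuous_flatten => [z||]; [exact: kap_pull_bound| |by lip].
  by apply: lip_clamp; lip.
- have c : {for v, continuous (fun z : plane => 1 + (1 - flatten
      (kap_pull (clamp (- z.2 / Num.max (z.1 - z.2) 2^-1))) (1 - (z.1 - z.2)) -
      (z.1 - z.2)) / Num.max (z.1 - z.2) 2^-1)}.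
    apply: (cD _ _ _); first by apply: (cL _ _); lip.
    apply: (cM _ _ _); last by apply: (cL _ _); lip.
    apply: (cD _ _ _); last by apply: (cL _ _); lip.
    apply: (cD _ _ _); first by apply: (cL _ _); lip.
    apply: (cN _ _); apply: continuous_flatten => [z||]; [exact: kap_pull_bound| |by lip].
    by apply: lip_clamp; lip.
  by rewrite /edge_side /scale /=; apply: (cP _ _ _); apply: (cM _ _ _) => //; apply: (cL _ _); lip.
Qed.

End EdgePush.

(** * The composite map and its action on null sets *)

Section BowenMap.
Variable R : realType.
Local Notation plane := (R * R)%type.
Local Notation null := ((@vol_plane R).-negligible).
Implicit Types (v : plane) (X Y : R).

Definition bowen v : plane := edge (@kap_push R) (radial_push (rot v)).
Definition bowen_inv v : plane := irot (radial_pull (edge (@kap_pull R) v)).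

Lemma bowenK : cancel bowen bowen_inv.
Proof. by move=> v; rewrite /bowen_inv edge_pushK radial_pushK rotK. Qed.

Lemma bowen_invK : cancel bowen_inv bowen.
Proof. by move=> v; rewrite /bowen irotK radial_pullK edge_pullK. Qed.

Lemma bowen_antipode v : bowen (antipode v) = antipode (bowen v).
Proof. by rewrite /bowen rot_antipode radial_push_antipode edge_antipode// kap_push0. Qed.

Lemma bowen_inv_antipode v : bowen_inv (antipode v) = antipode (bowen_inv v).
Proof.
by rewrite /bowen_inv edge_antipode ?kap_pull0// radial_pull_antipode irot_antipode.
Qed.

Lemma lip_bowen v : lipschitz_at bowen v.
Proof.
apply: lip_comp; first exact: lip_edge_push.
by apply: lip_comp; [exact: lip_radial_push|exact: lip_rot].
Qed.

Lemma continuous_bowen : continuous bowen.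
Proof. by move=> v; exact: lip_continuous (lip_bowen v). Qed.

Lemma lip_rotate_pull v : lipschitz_at (fun w : plane => irot (radial_pull w)) v.
Proof. by apply: lip_comp; [exact: lip_irot|exact: lip_radial_pull]. Qed.

Lemma continuous_bowen_inv : continuous bowen_inv.
Proof.
move=> v; apply: (@continuous_comp _ _ _ (edge (@kap_pull R)) (fun w => irot (radial_pull w))).
  exact: continuous_edge_pull.
exact: lip_continuous (lip_rotate_pull _).
Qed.

Section EdgeFix.
Variable kap : R -> R.
Hypothesis kap0 : kap 0 = 1.

Lemma edge_fix_box X Y : 0 <= X -> 0 <= Y ->
  [\/ 2^-1 <= X, (1 - X) * (1 - Y) <= 0 | 2^-1 <= (1 - X) * (1 - Y)] ->
  edge kap (X, Y) = (X, Y).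
Proof.
move=> X0 Y0 h; rewrite edge1//; case: h => [h|h|h]; first exact: edge_box_far.
- by rewrite /edge_box /= flatten_out ?subrr ?mul0r ?subr0//; left.
- by rewrite /edge_box /= flatten_out ?subrr ?mul0r ?subr0//; right.
Qed.

Lemma edge_fix_side X Y : 0 <= X -> Y <= 0 -> X - Y <= 2^-1 \/ 1 <= X - Y ->
  edge kap (X, Y) = (X, Y).
Proof.
move=> X0 Y0 h; rewrite edge4//; case: h => h; first exact: edge_side_near.
rewrite edge_side_far//; last by lra.
rewrite flatten_out; last by left; lra.
have -> : 1 - (1 - (X - Y)) = X - Y by ring.
by rewrite divff ?scale1// gt_eqF//; lra.
Qed.

(** Together with their antipodes, the six lines that carry the sides of the hexagon. *)
Definition boundary_line v := [\/ v.1 = 1, v.2 = 1 | v.1 - v.2 = 1].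

Lemma edge_fix_lines v : boundary_line v \/ boundary_line (antipode v) -> edge kap v = v.
Proof.
wlog : v / 0 <= v.1 => [W|].
  have [/W//|/ltW v0] := lerP 0 v.1.
  have := W (antipode v); rewrite antipodeK or_comm edge_antipode// => H /H.
  by rewrite /= oppr_ge0 => /(_ v0) /(can_inj (@antipodeK R)).
case: v => X Y /= X0; have [Y0|/ltW Y0] := lerP 0 Y; rewrite /boundary_line /= => h.
- apply: edge_fix_box => //; have [h1|h1] := lerP 2^-1 X; first by constructor 1.
  constructor 2; case: h => -[]; nra.
- apply: edge_fix_side => //; right; case: h => -[]; lra.
Qed.

End EdgeFix.

Lemma lip_edge_pull v : ~ (boundary_line v \/ boundary_line (antipode v)) ->
  lipschitz_at (edge (@kap_pull R)) v.
Proof.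
have max0 (a : R) : Num.max a 2^-1 != 0.
  by rewrite gt_eqF// lt_max invr_gt0 ltr0n orbT.
have l1 w : ~ boundary_line w -> lipschitz_at (edge_box (@kap_pull R)) w.
  move=> bw; rewrite /edge_box /= ; apply: lip_pair; first exact: lip_fst.
  apply: lipD; first exact: lip_snd.
  apply: lipN; apply: lipM; last by lip.
  apply: lipD; last by lip.
  apply: lip_flatten_neq0; [|by apply: lip_clamp; lip|by lip].
  by rewrite mulf_neq0//; apply/eqP => h; apply: bw; [constructor 1|constructor 2]; lra.
have l2 w : ~ boundary_line w -> lipschitz_at (edge_side (@kap_pull R)) w.
  move=> bw; rewrite /edge_side /scale /=.
  have l : lipschitz_at (fun z : plane => flatten
      (kap_pull (clamp (- z.2 / Num.max (z.1 - z.2) 2^-1))) (1 - (z.1 - z.2))) w.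
    apply: lip_flatten_neq0; [|by apply: lip_clamp; lip|by lip].
    by apply/eqP => h; apply: bw; constructor 3; lra.
  by lip.
move=> /not_orP[b1 b2].
by apply: (lip_glue (edge_glueable (@kap_pull0 R))) => _ _; [exact: l1|exact: l2|exact: l1|exact: l2].
Qed.

Lemma null_vertical_line (c : R) : null [set v : plane | v.1 = c].
Proof.
exists ([set c] `*` setT); split.
- by apply: measurable_box_borel => //; exact: measurable_set1.
- by rewrite vol_plane_box// lebesgue_measure_set1 mul0e.
- by move=> v /= ->.
Qed.

Lemma null_boundary_lines : null [set v | boundary_line v].
Proof.
have n1 := null_vertical_line 1.
have n2 : null [set v : plane | v.2 = 1].
  have /(null_lipschitz_image n1) : forall v : plane, [set v : plane | v.1 = 1] v ->
    lipschitz_at (@swap R) v by move=> v _; exact: lip_swap.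
  apply: (@negligibleS _ (borel plane) R (@vol_plane R)) => -[X Y] /= ->.
  by exists (1, X).
have n3 : null [set v : plane | v.1 - v.2 = 1].
  have /(null_lipschitz_image n1) : forall v : plane, [set v : plane | v.1 = 1] v ->
    lipschitz_at (fun v : plane => (v.1 + v.2, v.2)) v by move=> v _; lip.
  apply: (@negligibleS _ (borel plane) R (@vol_plane R)) => -[X Y] /= h.
  by exists (1, Y) => //=; congr pair; lra.
have : null ([set v : plane | v.1 = 1] `|` [set v : plane | v.2 = 1] `|`
  [set v : plane | v.1 - v.2 = 1]) by do 2 apply: negligibleU => //.
by apply: (@negligibleS _ (borel plane) R (@vol_plane R)) => v [h|h|h]; [left; left|left; right|right].
Qed.

Lemma null_antipode_lines : null [set v | boundary_line (antipode v)].
Proof.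
have := null_lipschitz_image null_boundary_lines (fun v _ => @lip_antipode R v).
apply: (@negligibleS _ (borel plane) R (@vol_plane R)) => v /= h.
by exists (antipode v) => //; rewrite antipodeK.
Qed.

Lemma null_image_bowen (A : set plane) : null A -> null (bowen @` A).
Proof. by move=> nA; apply: null_lipschitz_image => // v _; exact: lip_bowen. Qed.

(** On the boundary lines, where [edge kap_pull] fails to be Lipschitz, it is the identity, and the
    lines are null. So its image of [A] is null, and the remaining factor of [bowen_inv] is
    Lipschitz at every point. *)
Lemma null_image_bowen_inv (A : set plane) : null A -> null (bowen_inv @` A).
Proof.
move=> nA.
pose L := [set v | boundary_line v \/ boundary_line (antipode v)].
have nL : null L.
  have := negligibleU null_boundary_lines null_antipode_lines.
  by apply: (@negligibleS _ (borel plane) R (@vol_plane R)) => v.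
have nAL : null (edge (@kap_pull R) @` (A `\` L)).
  apply: null_lipschitz_image => [|v [_ Lv]]; last exact: lip_edge_pull.
  by apply: (@negligibleS _ (borel plane) R (@vol_plane R)) nA => v [].
have : null (edge (@kap_pull R) @` (A `\` L) `|` L) by exact: negligibleU.
move=> /null_lipschitz_image /(_ (fun v _ => lip_rotate_pull v)).
apply: (@negligibleS _ (borel plane) R (@vol_plane R)) => _ [v Av <-].
exists (edge (@kap_pull R) v) => //.
have [Lv|Lv] := pselect (L v); last by left; exists v.
by right; rewrite edge_fix_lines// kap_pull0.
Qed.

Lemma bowen_nonsingular (A : set (borel plane)) : measurable A ->
  vol_plane (bowen @^-1` A) = 0%E <-> vol_plane A = 0%E.
Proof.
move=> mA.
have mfA : measurable (bowen @^-1` A : set (borel plane)).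
  exact: continuous_borel_preimage continuous_bowen mA.
rewrite -!negligibleP//; split=> [/null_image_bowen|/null_image_bowen_inv].
- apply: (@negligibleS _ (borel plane) R (@vol_plane R)) => v Av.
  by exists (bowen_inv v); rewrite /= bowen_invK.
- apply: (@negligibleS _ (borel plane) R (@vol_plane R)) => v Av.
  by exists (bowen v) => //; rewrite bowenK.
Qed.

Lemma norm1_quadrant X Y : 0 <= X -> 0 <= Y -> norm1 (X, Y) = X + Y.
Proof. by move=> *; rewrite /norm1 !ger0_norm. Qed.

Lemma radial_push_far v : 3 / 4 <= norm1 v -> radial_push v = v.
Proof. by move=> h; rewrite /radial_push push_factor_far// scale1. Qed.

(** The last hypothesis says that [norm1] is at least 3/4 after the rotation, out of reach of
    [radial_push]; the new abscissa is at least 1/2, where [edge] is trivial. *)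
Lemma bowen_box X Y : 0 <= X -> 2^-1 <= Y -> 5 / 4 <= X / 2 + 2 * Y ->
  bowen (X, Y) = ((1 + X) / 2, 2 * Y - 1).
Proof.
move=> X0 Y2 h; rewrite /bowen rot_box// radial_push_far; last first.
  by rewrite norm1_quadrant; lra.
by rewrite edge_fix_box ?kap_push0//; [lra|lra|constructor 1; lra].
Qed.

Lemma bowen_inv_box X Y : 2^-1 <= X -> 4^-1 <= Y ->
  bowen_inv (X, Y) = (2 * X - 1, (1 + Y) / 2).
Proof.
move=> X0 Y0; rewrite -[RHS]bowenK; congr bowen_inv.
by rewrite bowen_box; [congr pair; field|lra|lra|lra].
Qed.

Lemma rot_source v : norm1 v <= 2^-1 -> rot v = (v.2, - v.1).
Proof.
wlog : v / 0 <= v.1 => [W|].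
  have [/W//|/ltW v0 hv] := lerP 0 v.1.
  have := W (antipode v); rewrite /= oppr_ge0 norm1_antipode => /(_ v0 hv).
  rewrite rot_antipode => E; apply: (can_inj (@antipodeK R)).
  by rewrite E /antipode /=.
case: v => X Y /= X0; have [Y0|/ltW Y0] := lerP 0 Y; rewrite /norm1 /= ger0_norm//.
- rewrite ger0_norm// => h; rewrite rot_exit//; last by lra.
  rewrite level_in// /speed max_l ?mul1r; last by lra.
  by congr pair; ring.
- rewrite ler0_norm// => h; rewrite rot_entry// /speed max_l; last by lra.
  rewrite !divr1; congr (_, - _).
  have h1 : 0 <= - Y by lra.
  have h2 : - Y <= 2^-1 by lra.
  have h3 : - Y <= X - Y by lra.
  case: (ilevelP h1 h2 h3) => [|*|h4]; [lra|lra|].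
  by have -> : Y = 0 by [lra]; rewrite oppr0 !subr0 divr1; lra.
Qed.

Lemma bowen_source v : norm1 v <= 4^-1 -> bowen v = (2 * v.2, - (2 * v.1)).
Proof.
move=> h; rewrite /bowen rot_source; last by lra.
have n1 : norm1 (v.2, - v.1) = norm1 v by rewrite /norm1 /= normrN addrC.
rewrite /radial_push n1 push_factor_near//.
have -> : scale 2 (v.2, - v.1) = (2 * v.2, - (2 * v.1)) by rewrite /scale /= mulrN.
have h2 : norm1 (2 * v.2, - (2 * v.1)) <= 2^-1.
  by rewrite /norm1 /= normrN !normrM (ger0_norm (_ : 0 <= 2))//; rewrite /norm1 in h; lra.
set w := (_, _) in h2 *.
have : forall w, norm1 w <= 2^-1 -> edge (@kap_push R) w = w.
  move=> {v h n1 w h2} w; wlog : w / 0 <= w.1 => [W|].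
    have [/W//|/ltW v0 hv] := lerP 0 w.1.
    have := W (antipode w); rewrite /= oppr_ge0 norm1_antipode => /(_ v0 hv).
    by rewrite edge_antipode ?kap_push0// => /(can_inj (@antipodeK R)).
  case: w => X Y /= X0; have [Y0|/ltW Y0] := lerP 0 Y; rewrite /norm1 /= ger0_norm//.
  - rewrite ger0_norm// => h; rewrite edge_fix_box ?kap_push0//; constructor 3; nra.
  - rewrite ler0_norm// => h; rewrite edge_fix_side ?kap_push0//; left; lra.
exact.
Qed.

Lemma bowen_inv_source v : norm1 v <= 2^-1 -> bowen_inv v = (- v.2 / 2, v.1 / 2).
Proof.
move=> h; rewrite -[RHS]bowenK; congr bowen_inv.
rewrite bowen_source /=; first by case: v h => X Y _ /=; congr pair; field.
by rewrite /norm1 /= !normrM normrN (ger0_norm (_ : 0 <= 2^-1))// in h *; lra.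
Qed.

End BowenMap.

(** * A Lyapunov function on the hexagon *)

Section Hexagon.
Variable R : realType.
Local Notation plane := (R * R)%type.
Implicit Types (v : plane) (X Y s : R).

Definition hex_norm v : R := Num.max (Num.max `|v.1| `|v.2|) `|v.1 - v.2|.

Definition hexagon : set plane := [set v | hex_norm v < 1].

Lemma hex_norm_antipode v : hex_norm (antipode v) = hex_norm v.
Proof. by rewrite /hex_norm /= !normrN -opprD normrN. Qed.

Lemma hex_norm_swap v : hex_norm (swap v) = hex_norm v.
Proof. by rewrite /hex_norm /= (maxC `|v.2|) (distrC v.2). Qed.

Lemma hex_norm_scale k v : 0 <= k -> hex_norm (scale k v) = k * hex_norm v.
Proof.
by move=> k0; rewrite /hex_norm /= -mulrBr !normrM (ger0_norm k0) !maxr_pMr.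
Qed.

Lemma hex_norm_box X Y : 0 <= X -> 0 <= Y -> hex_norm (X, Y) = Num.max X Y.
Proof.
move=> X0 Y0; rewrite /hex_norm /= (ger0_norm X0) (ger0_norm Y0) max_l// ler_norml.
by have [h|h] := lerP Y X; apply/andP; split; lra.
Qed.

Lemma hex_norm_side X Y : 0 <= X -> Y <= 0 -> hex_norm (X, Y) = X - Y.
Proof.
move=> X0 Y0; rewrite /hex_norm /= (ger0_norm X0) (ler0_norm Y0) ger0_norm; last by lra.
by rewrite max_r// ge_max; apply/andP; split; lra.
Qed.

Lemma hexagon_box X Y : 0 <= X -> 0 <= Y -> hexagon (X, Y) <-> X < 1 /\ Y < 1.
Proof. by move=> X0 Y0; rewrite /hexagon /= hex_norm_box// gt_max; split=> /andP. Qed.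

Lemma hexagon_side X Y : 0 <= X -> Y <= 0 -> hexagon (X, Y) <-> X - Y < 1.
Proof. by move=> X0 Y0; rewrite /hexagon /= hex_norm_side. Qed.

Lemma hexagon_antipode v : hexagon (antipode v) <-> hexagon v.
Proof. by rewrite /hexagon /= hex_norm_antipode. Qed.

Lemma hexagon_swap v : hexagon (swap v) <-> hexagon v.
Proof. by rewrite /hexagon /= hex_norm_swap. Qed.

Lemma continuous_hex_norm : continuous hex_norm.
Proof. by move=> v; apply: lip_continuous; rewrite /hex_norm; lip. Qed.

Lemma hexagon_open : open hexagon.
Proof.
apply: (@open_comp _ _ hex_norm [set a | a < 1]); last exact: open_lt.
by move=> v _; exact: continuous_hex_norm.
Qed.

(* The values of [height] are 0 at the source and 1 on the boundary of the
   hexagon; [rot] preserves it and the two pushes increase it. *)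
Definition height v : R :=
  if 0 <= v.1 then (if 0 <= v.2 then level v.1 v.2 else v.1 - v.2)
  else (if 0 <= v.2 then v.2 - v.1 else level (- v.1) (- v.2)).

Lemma level0 X : 0 <= X -> level X 0 = X.
Proof. by move=> X0; case: (levelP X0 (lexx 0)) => *; lra. Qed.

Lemma height_box X Y : 0 <= X -> 0 <= Y -> height (X, Y) = level X Y.
Proof. by move=> X0 Y0; rewrite /height /= X0 Y0. Qed.

Lemma height_side X Y : 0 <= X -> Y <= 0 -> height (X, Y) = X - Y.
Proof.
move=> X0 Y0; rewrite /height /= X0; case: ifP => // Y1.
have -> : Y = 0 by lra.
by rewrite level0 ?subr0.
Qed.

Lemma height_antipode v : height (antipode v) = height v.
Proof.
case: v => X Y; rewrite /height /= !oppr_ge0 !opprK.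
have [h1|h1] := lerP 0 X; have [h2|h2] := lerP X 0; have [h3|h3] := lerP 0 Y;
  have [h4|h4] := lerP Y 0; try lra.
- have -> : X = 0 by lra.
  have -> : Y = 0 by lra.
  by rewrite oppr0.
- have -> : X = 0 by lra.
  by rewrite level_sym level0//; lra.
- have -> : X = 0 by lra.
  by rewrite oppr0 level_sym level0//; lra.
- have -> : Y = 0 by lra.
  by rewrite level0//; lra.
- have -> : Y = 0 by lra.
  by rewrite oppr0 level0//; lra.
Qed.

Lemma continuous_height : continuous height.
Proof.
have P (f : plane -> R) w : lipschitz_at f w -> lipschitz_at (fun z => pos (f z)) w.
  by move=> ?; apply: lip_max => //; exact: lip_cst.
have l w : lipschitz_at (fun v : plane => level v.1 v.2) w.
  by rewrite /level; lip; apply: P; lip; apply: P; lip.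
have l' w : lipschitz_at (fun v : plane => level (- v.1) (- v.2)) w.
  by rewrite /level; lip; apply: P; lip; apply: P; lip.
move=> v; apply: lip_continuous; apply: lip_if; first exact: cvg_fst.
- case: v => X Y /= ->; rewrite sub0r subr0 oppr0.
  have [h|/ltW h] := lerP 0 Y; first by rewrite level_sym level0.
  by rewrite level_sym level0// oppr_ge0.
- move=> h; apply: lip_if; first exact: cvg_snd.
  + by case: v h => X Y /= h ->; rewrite level0 ?subr0.
  + by [].
  + by move=> _; lip.
- move=> h; apply: lip_if; first exact: cvg_snd.
  + by case: v h => X Y /= h ->; rewrite oppr0 level0 ?oppr_ge0// sub0r.
  + by move=> _; lip.
  + by [].
Qed.

Lemma plane_wlog (P : plane -> Prop) :
  (forall v, P (antipode v) -> P v) ->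
  (forall X Y, 0 <= X -> 0 <= Y -> P (X, Y)) ->
  (forall X Y, 0 <= X -> Y <= 0 -> P (X, Y)) -> forall v, P v.
Proof.
move=> J P1 P4; have half v : 0 <= v.1 -> P v.
  case: v => X Y /= X0; have [Y0|/ltW Y0] := lerP 0 Y; [exact: P1|exact: P4].
move=> v; have [/half//|/ltW h] := lerP 0 v.1.
by apply: J; apply: half; rewrite /= oppr_ge0.
Qed.

Lemma height_ge_norm v : hexagon v -> `|v| <= height v.
Proof.
move: v; apply: plane_wlog => [v IH|X Y X0 Y0|X Y X0 Y0].
- move=> /hexagon_antipode /IH; rewrite height_antipode.
  by rewrite !plane_norm /= !normrN.
- move=> /(hexagon_box X0 Y0)[X1 Y1]; rewrite height_box// plane_norm /= !ger0_norm//.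
  by rewrite ge_max; apply/andP; split; [rewrite level_sym|]; apply: level_ge => //; exact: ltW.
- move=> _; rewrite height_side// plane_norm /= ger0_norm// ler0_norm// ge_max.
  by apply/andP; split; lra.
Qed.

Lemma height_lt1 v : hexagon v -> height v < 1.
Proof.
move: v; apply: plane_wlog => [v IH|X Y X0 Y0|X Y X0 Y0].
- by move=> /hexagon_antipode /IH; rewrite height_antipode.
- move=> /(hexagon_box X0 Y0)[X1 Y1]; rewrite height_box//.
  by case: (levelP X0 Y0) => *; nra.
- by move=> /(hexagon_side X0 Y0) h; rewrite height_side.
Qed.

(** The height is 1 on the boundary. This serves for cluster points of orbits, which a priori lie
    only in the closed hexagon. *)
Lemma hexagon_of_height v : hex_norm v <= 1 -> height v < 1 -> hexagon v.
Proof.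
move: v; apply: plane_wlog => [v IH|X Y X0 Y0|X Y X0 Y0].
- rewrite -hex_norm_antipode -height_antipode => h1 h2.
  by apply/hexagon_antipode/IH.
- rewrite hex_norm_box// ge_max => /andP[X1 Y1]; rewrite height_box// => h.
  apply/(hexagon_box X0 Y0); rewrite !lt_neqAle X1 Y1 !andbT.
  by split; apply/eqP => E; move: h; case: (levelP X0 Y0) => *; nra.
- by rewrite height_side// => _ h; apply/(hexagon_side X0 Y0).
Qed.

Lemma height0 : height 0 = 0.
Proof. by rewrite (height_box (lexx 0) (lexx 0)) level0. Qed.

Lemma height_gt0 v : hexagon v -> v != 0 -> 0 < height v.
Proof. by move=> Vv v0; apply: lt_le_trans (height_ge_norm Vv); rewrite normr_gt0. Qed.

Lemma rot_hexagon v : hexagon v -> hexagon (rot v) /\ height (rot v) = height v.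
Proof.
move: v; apply: plane_wlog => [v IH|X Y X0 Y0|X Y X0 Y0].
- move=> /hexagon_antipode /IH; rewrite rot_antipode !height_antipode.
  by move=> [/hexagon_antipode].
- move=> /(hexagon_box X0 Y0)[X1 Y1].
  have [h|h] := lerP 2^-1 Y.
    rewrite rot_box//; have h1 : 0 <= (1 + X) / 2 by lra.
    have h2 : 0 <= 2 * Y - 1 by lra.
    split; first by apply/hexagon_box => //; split; lra.
    by rewrite !height_box// !level_out//; [field|right|left; lra].
  have Y2 := ltW h.
  have /andP[e0 e1] := exit_bounds X0 Y0 Y2; rewrite rot_exit//.
  have e2 : speed (level X Y) * Y - level X Y <= 0 by lra.
  rewrite (height_side e0 e2) (height_box X0 Y0); split; last by ring.
  apply/(hexagon_side e0 e2); rewrite opprB addrC subrK.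
  by rewrite -height_box// height_lt1//; apply/hexagon_box.
- move=> /(hexagon_side X0 Y0) h; rewrite rot_entry//.
  have Y0' : 0 <= - Y by lra.
  have Ys : - Y <= X - Y by lra.
  have [d0 [d2 ds]] := div_speed Y0' Ys.
  have i0 := ilevel_ge0 d0 d2 ds.
  have -> : (Y / speed (X - Y), - ilevel (- Y / speed (X - Y)) (X - Y)) =
    antipode (- Y / speed (X - Y), ilevel (- Y / speed (X - Y)) (X - Y)).
    by rewrite /antipode /= mulNr opprK.
  rewrite height_antipode (height_box d0 i0) (level_ilevel d0 d2 ds) (height_side X0 Y0).
  split => //.
  apply/hexagon_antipode/hexagon_box => //; split; first by lra.
  have d1 : 0 < 1 - - Y / speed (X - Y) by lra.
  case: (ilevelP d0 d2 ds) => [|*|_]; [lra|lra|].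
  by rewrite ltrBlDr ltrDl divr_gt0//; lra.
Qed.

Lemma irot_hexagon v : hexagon v -> hexagon (irot v).
Proof.
by move=> /hexagon_swap /rot_hexagon[Vv _]; apply/hexagon_swap.
Qed.

Lemma level_mono X Y X' Y' : 0 <= X -> 0 <= Y -> X <= X' -> Y <= Y' ->
  X' <= 1 -> Y' <= 1 -> level X Y <= level X' Y'.
Proof.
move=> X0 Y0 XX YY X1 Y1.
have mono (A B C : R) : 0 <= A -> 0 <= C -> A <= B -> B <= 1 -> C <= 1 -> level A C <= level B C.
  move=> A0 C0 AB B1 C1; have B0 : 0 <= B by lra.
  by case: (levelP A0 C0) => [h|h1 h2 h3|[h|h]];
    case: (levelP B0 C0) => [g|g1 g2 g3|[g|g]]; try lra; nra.
apply: (@le_trans _ _ (level X' Y)); first by apply: mono; lra.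
by rewrite level_sym (level_sym X'); apply: mono; lra.
Qed.

Lemma level_scale k X Y : 0 <= X -> 0 <= Y -> 0 < X + Y -> 1 < k ->
  k * (X + Y) <= 3 / 4 -> level X Y < level (k * X) (k * Y).
Proof.
move=> X0 Y0 XY k1 h.
have kX : X <= k * X by nra.
have kY : Y <= k * Y by nra.
have s : X + Y < k * X + k * Y by nra.
have h' : k * X + k * Y <= 3 / 4 by lra.
set A := k * X in kX s h' *; set B := k * Y in kY s h' *.
have A0 : 0 <= A by lra.
have B0 : 0 <= B by lra.
case: (levelP X0 Y0) => [g|g1 g2 g3|[g|g]]; case: (levelP A0 B0) => [f|f1 f2 f3|[f|f]]; try lra; nra.
Qed.

End Hexagon.

(** * Monotonicity of the height along orbits *)

Section Lyapunov.
Variable R : realType.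
Local Notation plane := (R * R)%type.
Implicit Types (v : plane) (X Y s : R).

Lemma radial_push_hexagon v : hexagon v ->
  hexagon (radial_push v) /\ height v <= height (radial_push v).
Proof.
move=> Vv; have [h|h] := lerP (3 / 4) (norm1 v); first by rewrite radial_push_far.
have k1 := push_factor_gt1 h; have k0 : 0 <= push_factor (norm1 v) by lra.
have kn : push_factor (norm1 v) * norm1 v <= 3 / 4.
  have n0 := norm1_ge0 v; have [g|/ltW g] := lerP (norm1 v) 4^-1.
    by rewrite push_factor_near//; lra.
  rewrite push_factor_mid ?(ltW h)//.
  have -> : (2^-1 + 3 / (8 * norm1 v)) * norm1 v = norm1 v / 2 + 3 / 8.
    by field; rewrite gt_eqF//; lra.
  lra.
move: Vv h k1 k0 kn; rewrite /radial_push; move: (push_factor _) => k.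
move: v; apply: plane_wlog => [v IH|X Y X0 Y0|X Y X0 Y0].
- move: IH; rewrite scale_antipode !height_antipode norm1_antipode.
  move=> IH /hexagon_antipode Vv h k1 k0 kn.
  by have [/hexagon_antipode] := IH Vv h k1 k0 kn.
- rewrite norm1_quadrant// => Vv h k1 k0 kn; rewrite /scale /=.
  have X1 : 0 <= k * X by rewrite mulr_ge0.
  have Y1 : 0 <= k * Y by rewrite mulr_ge0.
  split; first by apply/(hexagon_box X1 Y1); split; nra.
  rewrite (height_box X0 Y0) (height_box X1 Y1); apply: level_mono => //; nra.
- rewrite /norm1 /= ger0_norm// ler0_norm// => Vv h k1 k0 kn; rewrite /scale /=.
  have X1 : 0 <= k * X by rewrite mulr_ge0.
  have Y1 : k * Y <= 0 by rewrite mulr_ge0_le0.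
  split; first by apply/(hexagon_side X1 Y1); nra.
  by rewrite (height_side X0 Y0) (height_side X1 Y1); nra.
Qed.

Lemma radial_push_strict v : hexagon v -> v != 0 -> norm1 v < 3 / 4 ->
  height v < height (radial_push v).
Proof.
move=> Vv v0 h.
have n0 : 0 < norm1 v.
  rewrite lt_neqAle norm1_ge0 andbT eq_sym; apply: contra_neq v0 => n0.
  apply/eqP; rewrite -normr_eq0 plane_norm eq_le le_max normr_ge0 andbT ge_max.
  by move: n0; rewrite /norm1 => n0; rewrite -n0 lerDl lerDr !normr_ge0.
have k1 := push_factor_gt1 h; have k0 : 0 <= push_factor (norm1 v) by lra.
have kn : push_factor (norm1 v) * norm1 v <= 3 / 4.
  have [g|/ltW g] := lerP (norm1 v) 4^-1.
    by rewrite push_factor_near//; lra.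
  rewrite push_factor_mid ?(ltW h)//.
  have -> : (2^-1 + 3 / (8 * norm1 v)) * norm1 v = norm1 v / 2 + 3 / 8.
    by field; rewrite gt_eqF//; lra.
  lra.
move: {v0} Vv h n0 k1 k0 kn; rewrite /radial_push; move: (push_factor _) => k.
move: v; apply: plane_wlog => [v IH|X Y X0 Y0|X Y X0 Y0].
- move: IH; rewrite scale_antipode !height_antipode norm1_antipode.
  by move=> IH /hexagon_antipode; exact: IH.
- rewrite norm1_quadrant// => Vv h n0 k1 k0 kn; rewrite /scale /=.
  have X1 : 0 <= k * X by rewrite mulr_ge0.
  have Y1 : 0 <= k * Y by rewrite mulr_ge0.
  by rewrite (height_box X0 Y0) (height_box X1 Y1); apply: level_scale.
- rewrite /norm1 /= ger0_norm// ler0_norm// => Vv h n0 k1 k0 kn; rewrite /scale /=.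
  have X1 : 0 <= k * X by rewrite mulr_ge0.
  have Y1 : k * Y <= 0 by rewrite mulr_ge0_le0.
  by rewrite (height_side X0 Y0) (height_side X1 Y1); nra.
Qed.

Lemma radial_pull_hexagon v : hexagon v -> hexagon (radial_pull v).
Proof.
have k01 : 0 <= pull_factor (norm1 v) <= 1.
  have [h1|/ltW h1] := lerP (norm1 v) 2^-1; first by rewrite pull_factor_near//; lra.
  have [h2|/ltW h2] := lerP (norm1 v) (3 / 4); last by rewrite pull_factor_far//; lra.
  rewrite pull_factor_mid// subr_ge0 ler_pdivrMr ?mulr_gt0//; last by lra.
  rewrite lerBlDr -lerBlDl ler_pdivlMr ?mulr_gt0//; last by lra.
  by apply/andP; split; lra.
rewrite /hexagon /= /radial_pull hex_norm_scale; last by case/andP: k01.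
have : 0 <= hex_norm v by rewrite /hex_norm le_max normr_ge0 orbT.
by nra.
Qed.

Section EdgeHexagon.
Variable kap : R -> R.
Hypothesis kap0 : kap 0 = 1.
Hypothesis kap_gt0 : forall b, 0 <= b <= 1 -> 0 < kap b.

Lemma edge_hexagon v : hexagon v -> hexagon (edge kap v).
Proof.
move: v; apply: plane_wlog => [v IH|X Y X0 Y0|X Y X0 Y0].
- by move: IH; rewrite edge_antipode// => IH /hexagon_antipode /IH /hexagon_antipode.
- have q := edge_box_quadrant kap0 kap_gt0 (X0 : 0 <= (X, Y).1) (Y0 : 0 <= (X, Y).2).
  move=> /(hexagon_box X0 Y0)[X1 Y1]; rewrite edge1//.
  have [h|/ltW h] := lerP 2^-1 X; first by rewrite edge_box_far//; apply/(hexagon_box X0 Y0).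
  move: q; rewrite edge_box_near//= => q; apply/(hexagon_box X0 q); split => //.
  by rewrite ltrBlDr ltrDl divr_gt0 ?flatten_gt0// ?mulr_gt0//; lra.
- move=> /(hexagon_side X0 Y0) h.
  have [g|/ltW g] := lerP (X - Y) 2^-1.
    by rewrite edge4// edge_side_near//; apply/(hexagon_side X0 Y0).
  rewrite edge4// edge_side_far//; set s := X - Y; set k := _ / s.
  have s0 : 0 < s by rewrite /s; lra.
  have b01 : 0 <= - Y / s <= 1.
    apply/andP; split; first by rewrite divr_ge0 ?oppr_ge0// ltW.
    by rewrite ler_pdivrMr// mul1r /s; lra.
  have f0 : 0 < flatten (kap (- Y / s)) (1 - s) by apply: flatten_gt0; rewrite /s; lra.
  have f1 : flatten (kap (- Y / s)) (1 - s) <= 2^-1.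
    case: flattenP => [|w0 w1]; first by rewrite /s; lra.
    by rewrite ltW// of_depth_lt// mulr_gt0 ?depth_gt0// kap_gt0.
  have k0 : 0 <= k by rewrite divr_ge0//; lra.
  have X1 : 0 <= k * X by rewrite mulr_ge0.
  have Y1 : k * Y <= 0 by rewrite mulr_ge0_le0.
  apply/(hexagon_side X1 Y1); rewrite -mulrBr -/s mulfVK ?gt_eqF//; lra.
Qed.

End EdgeHexagon.

Lemma edge_push_height v : hexagon v -> height v <= height (edge (@kap_push R) v).
Proof.
have kp : forall b : R, 0 <= b <= 1 -> 0 < kap_push b by move=> b; rewrite /kap_push; lra.
move: v; apply: plane_wlog => [v IH|X Y X0 Y0|X Y X0 Y0].
- move: IH; rewrite edge_antipode ?kap_push0// !height_antipode.
  by move=> IH /hexagon_antipode.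
- have q := edge_box_quadrant (@kap_push0 R) kp (X0 : 0 <= (X, Y).1) (Y0 : 0 <= (X, Y).2).
  move=> VXY; have := edge_hexagon (@kap_push0 R) kp VXY; rewrite edge1//.
  move: VXY => /(hexagon_box X0 Y0)[X1 Y1].
  have [h|/ltW h] := lerP 2^-1 X; first by rewrite (edge_box_far (@kap_push0 R)).
  move: q; rewrite edge_box_near//= => q /(hexagon_box X0 q)[_ Y'1].
  rewrite (height_box X0 Y0) (height_box X0 q); apply: level_mono => //; [|lra|lra].
  rewrite lerBrDr -lerBrDl ler_pdivrMr ?(mulrC _ (1 - X)); last by lra.
  by apply: flatten_le; rewrite /kap_push; lra.
- move=> /(hexagon_side X0 Y0) h.
  have [g|/ltW g] := lerP (X - Y) 2^-1; first by rewrite edge4 ?kap_push0// edge_side_near.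
  rewrite edge4 ?kap_push0// edge_side_far//; set s := X - Y; set k := _ / s.
  have s0 : 0 < s by rewrite /s; lra.
  have f1 : flatten (kap_push (- Y / s)) (1 - s) <= 1 - s.
    by apply: flatten_le; rewrite /kap_push lerDl divr_ge0// ?oppr_ge0// ltW.
  have k0 : 0 <= k by rewrite divr_ge0//; lra.
  have X1 : 0 <= k * X by rewrite mulr_ge0.
  have Y1 : k * Y <= 0 by rewrite mulr_ge0_le0.
  rewrite /scale /= (height_side X0 Y0) (height_side X1 Y1) -mulrBr -/s mulfVK ?gt_eqF//.
  lra.
Qed.

Lemma edge_push_strict X Y : 0 <= X -> Y < 0 -> 2^-1 < X - Y -> X - Y < 1 ->
  height (X, Y) < height (edge (@kap_push R) (X, Y)).
Proof.
move=> X0 Ylt g h; have Y0 := ltW Ylt.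
rewrite edge4 ?kap_push0// edge_side_far ?(ltW g)//; set s := X - Y; set k := _ / s.
have s0 : 0 < s by rewrite /s; lra.
have f1 : flatten (kap_push (- Y / s)) (1 - s) < 1 - s.
  by apply: flatten_lt_id; rewrite ?/kap_push ?ltrDl ?divr_gt0 ?oppr_gt0// /s; lra.
have k0 : 0 <= k by rewrite divr_ge0// ?ltW//; lra.
have X1 : 0 <= k * X by rewrite mulr_ge0.
have Y1 : k * Y <= 0 by rewrite mulr_ge0_le0.
rewrite /scale /= (height_side X0 Y0) (height_side X1 Y1) -mulrBr -/s mulfVK ?gt_eqF//.
lra.
Qed.

Lemma bowen_hexagon v : hexagon v -> hexagon (bowen v) /\ height v <= height (bowen v).
Proof.
move=> /rot_hexagon[V1 <-]; have [V2 h2] := radial_push_hexagon V1.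
split; last exact: le_trans h2 (edge_push_height V2).
by apply: edge_hexagon V2 => [|b]; rewrite ?kap_push0// /kap_push; lra.
Qed.

Lemma bowen_inv_hexagon v : hexagon v -> hexagon (bowen_inv v).
Proof.
move=> Vv; apply: irot_hexagon; apply: radial_pull_hexagon.
apply: edge_hexagon Vv => [|b]; rewrite ?kap_pull0// /kap_pull invr_gt0; lra.
Qed.

Lemma iter_bowen_hexagon n v : hexagon v -> hexagon (iter n (@bowen R) v).
Proof. by move=> Vv; elim: n => //= n /bowen_hexagon[]. Qed.

Lemma bowen0 : bowen 0 = 0 :> plane.
Proof.
rewrite bowen_source /= ?mulr0 ?oppr0//.
by rewrite /norm1 /= normr0; lra.
Qed.

Lemma bowen_inv0 : bowen_inv 0 = 0 :> plane.
Proof. by rewrite -{1}bowen0 bowenK. Qed.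

Lemma iter_bowenK n : cancel (iter n (@bowen R)) (iter n (@bowen_inv R)).
Proof. by elim: n => // n IH v; rewrite iterSr [X in bowen_inv X]iterS bowenK. Qed.

Lemma iter_bowen_invK n : cancel (iter n (@bowen_inv R)) (iter n (@bowen R)).
Proof. by elim: n => // n IH v; rewrite iterSr [X in bowen X]iterS bowen_invK. Qed.

Lemma iter_bowen_inv0 n : iter n (@bowen_inv R) 0 = 0.
Proof. by elim: n => //= n ->; exact: bowen_inv0. Qed.

(* If the height were constant along the orbit of v, neither push would ever
   act; but in a box [rot] doubles y until the orbit leaves through a side. *)
Lemma height_increases v : hexagon v -> v != 0 ->
  exists k, height v < height (iter k (@bowen R) v).
Proof.
move=> Vv v0; apply: contrapT => /forallNP const.
have {}const k : height (iter k (@bowen R) v) = height v.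
  apply/eqP; rewrite eq_le leNgt; apply/andP; split; first exact/negP.
  elim: k => //= k IH; apply: le_trans IH _.
  by have [] := bowen_hexagon (iter_bowen_hexagon k Vv).
(* A radial push that acts on [rot u] would raise the height strictly. *)
have step k (u := iter k (@bowen R) v) :
    3 / 4 <= norm1 (rot u) /\ bowen u = edge (@kap_push R) (rot u).
  have Vu : hexagon u by exact: iter_bowen_hexagon.
  have u0 : u != 0.
    by apply: contra_neq v0 => u0; rewrite -(iter_bowenK k v) -/u u0 iter_bowen_inv0.
  have [Vr hr] := rot_hexagon Vu.
  have r0 : rot u != 0.
    apply: contra_neq u0 => ru; rewrite -[u]rotK ru.
    by rewrite /irot /swap /= -[(0, 0)]/(0 : plane) rot_source /= ?oppr0 // /norm1 /= normr0; lra.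
  have far : 3 / 4 <= norm1 (rot u).
    rewrite leNgt; apply/negP => h.
    have := radial_push_strict Vr r0 h.
    have [Vp _] := radial_push_hexagon Vr; have := edge_push_height Vp.
    have := const k.+1; rewrite /= -/u -/(bowen u) /bowen => ->.
    by rewrite hr const; lra.
  by split => //; rewrite /bowen radial_push_far.
(* In the open fourth quadrant [edge] raises the height strictly, as its exponent there exceeds
   1. *)
have side k X Y : rot (iter k (@bowen R) v) = (X, Y) -> 0 <= X -> Y < 0 -> False.
  move=> rE X0 Y0; have [far bE] := step k.
  have Vu := iter_bowen_hexagon k Vv; have [Vr hr] := rot_hexagon Vu.
  move: far bE Vr hr; rewrite rE /norm1 /= ger0_norm// ltr0_norm// => far bE.
  move=> /(hexagon_side X0 (ltW Y0)) h hr.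
  have := @edge_push_strict X Y X0 Y0; rewrite -bE hr.
  by have := const k.+1; rewrite /= => ->; rewrite const; lra.
have side' k X Y : rot (iter k (@bowen R) v) = antipode (X, Y) -> 0 <= X -> Y < 0 -> False.
  move=> rE X0 Y0; have [far bE] := step k.
  have Vu := iter_bowen_hexagon k Vv; have [Vr hr] := rot_hexagon Vu.
  move: far bE Vr hr; rewrite rE norm1_antipode /norm1 /= ger0_norm// ltr0_norm// => far bE.
  move=> /hexagon_antipode /(hexagon_side X0 (ltW Y0)) h hr.
  have := @edge_push_strict X Y X0 Y0.
  rewrite -[height (edge _ _)]height_antipode -edge_antipode ?kap_push0// -bE.
  rewrite -[height (X, Y)]height_antipode hr.
  by have := const k.+1; rewrite /= => ->; rewrite const; lra.
(* The height is at least 3/4 here, so the speed is twice the level and [Y < 1/2] puts the image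
   strictly inside a side region. *)
have exit k (eps : bool) X Y : 0 <= X -> 0 <= Y -> Y < 2^-1 ->
    iter k (@bowen R) v = (if eps then antipode (X, Y) else (X, Y)) -> False.
  move=> X0 Y0 Y2 uE; have Vu := iter_bowen_hexagon k Vv.
  have rE := rot_exit X0 Y0 (ltW Y2).
  have /andP[e0 e1] := exit_bounds X0 Y0 (ltW Y2).
  have rE' : rot (iter k (@bowen R) v) = if eps then
      antipode (speed (level X Y) * Y, speed (level X Y) * Y - level X Y) else
      (speed (level X Y) * Y, speed (level X Y) * Y - level X Y).
    by rewrite uE; case: eps {uE}; rewrite ?rot_antipode rE.
  have [far _] := step k.
  have s34 : 3 / 4 <= level X Y.
    move: far; rewrite rE'; case: eps {uE rE'}; rewrite ?norm1_antipode /norm1 /= ger0_norm// ler0_norm; lra.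
  have neg : speed (level X Y) * Y - level X Y < 0.
    by rewrite /speed max_r; nra.
  by case: eps {uE} rE' => rE'; [exact: side' rE' e0 neg|exact: side rE' e0 neg].
have K (z : R) : 1 - (1 - z) = z by ring.
(* At the last [j] with [2 ^+ j * y <= 1], the ordinate [1 - 2 ^+ j * y] is below 1/2 and [exit]
   applies. *)
have box k (eps : bool) (x y : R) : 0 <= x -> x <= 1 -> 0 < y -> y < 1 ->
    iter k (@bowen R) v = (if eps then antipode (1 - x, 1 - y) else (1 - x, 1 - y)) -> False.
  move=> x0 x1 y0 y1 uE.
  have iterE j : 2 ^+ j * y <= 1 -> iter (k + j) (@bowen R) v =
      (if eps then antipode (1 - x / 2 ^+ j, 1 - 2 ^+ j * y) else (1 - x / 2 ^+ j, 1 - 2 ^+ j * y)).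
    elim: j => [|j IH]; first by rewrite expr0 divr1 mul1r addn0.
    rewrite exprS -mulrA => yj; have yj' : 2 ^+ j * y <= 1.
      by have : 0 < 2 ^+ j * y by [rewrite mulr_gt0// exprn_gt0]; lra.
    have xj : 0 <= x / 2 ^+ j by rewrite divr_ge0// exprn_ge0.
    have xj1 : x / 2 ^+ j <= 1.
      rewrite ler_pdivrMr ?exprn_gt0// mul1r; apply: le_trans x1 _.
      by rewrite exprn_ege1// ler1n.
    have := IH yj'; rewrite addnS iterS => uE'; have [_ ->] := step (k + j)%N.
    rewrite uE'.
    have rb := @rot_box R (1 - x / 2 ^+ j) (1 - 2 ^+ j * y).
    have E1 : (1 + (1 - x / 2 ^+ j)) / 2 = 1 - x / (2 * 2 ^+ j) by field; rewrite expf_eq0 /= pnatr_eq0 andbF.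
    have E2 : 2 * (1 - 2 ^+ j * y) - 1 = 1 - 2 * (2 ^+ j * y) by ring.
    have eb : edge (@kap_push R) (1 - x / (2 * 2 ^+ j), 1 - 2 * (2 ^+ j * y)) =
        (1 - x / (2 * 2 ^+ j), 1 - 2 * (2 ^+ j * y)).
      by apply: edge_fix_box; rewrite ?kap_push0//; [lra|lra|constructor 1; lra].
    by case: eps {uE IH uE'}; rewrite ?rot_antipode rb ?edge_antipode ?kap_push0// ?E1 ?E2 ?eb//; lra.
  have exj : exists j, 1 < 2 ^+ j * y.
    have [n _ /(_ n (leqnn n)) h] := near_infty_natSinv_expn_lt (PosNum y0).
    by exists n; move: h; rewrite /= ltr_pdivrMr ?exprn_gt0// mulrC.
  case: (ex_minnP exj) => -[|j] yj jmin; first by move: yj; rewrite expr0; lra.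
  have yj' : 2 ^+ j * y <= 1.
    by rewrite leNgt; apply/negP => /jmin; rewrite ltnn.
  move: yj; rewrite exprS -mulrA => yj.
  have xj : 0 <= x / 2 ^+ j by rewrite divr_ge0// exprn_ge0.
  have xj1 : x / 2 ^+ j <= 1.
    rewrite ler_pdivrMr ?exprn_gt0// mul1r; apply: le_trans x1 _.
    by rewrite exprn_ege1// ler1n.
  by apply: (exit _ _ _ _ _ _ _ (iterE j yj')); lra.
(* One step leads to the opposite box, strictly between its axis and its far side, even after the
   action of [edge]; so [box] applies with [0 < y < 1]. *)
have entry k (eps : bool) X Y : 0 < X -> Y <= 0 ->
    iter k (@bowen R) v = (if eps then antipode (X, Y) else (X, Y)) -> False.
  move=> X0 Y0 uE; have Vu := iter_bowen_hexagon k Vv.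
  have [far bE] := step k.
  pose p := - Y / speed (X - Y); pose q := ilevel p (X - Y).
  have Y0' : 0 <= - Y by lra.
  have Ys : - Y <= X - Y by lra.
  have [d0 [d2 ds]] := div_speed Y0' Ys; rewrite -/p in d0 d2 ds.
  have q0 : 0 <= q by exact: ilevel_ge0.
  have rE : rot (X, Y) = antipode (p, q).
    by rewrite (rot_entry (ltW X0) Y0) /antipode /q /p /= mulNr opprK.
  have VX : hexagon (X, Y).
    by move: Vu; rewrite uE; case: eps {uE} => // /hexagon_antipode.
  have [] := rot_hexagon VX; rewrite rE => Vpq hpq.
  have hX := height_side (ltW X0) Y0.
  have q_gt0 : 0 < q.
    move: (level_ilevel d0 d2 ds); rewrite -/p -/q => E; rewrite lt_neqAle q0 andbT.
    apply/eqP => q00; move: E; rewrite -q00 level0// /p => E.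
    have := speed_ge1 (X - Y); have : - Y / speed (X - Y) * speed (X - Y) = - Y.
      by rewrite mulfVK// gt_eqF// speed_gt0.
    by rewrite E; nra.
  have kp : forall b : R, 0 <= b <= 1 -> 0 < kap_push b by move=> b; rewrite /kap_push; lra.
  have Q0 := edge_box_quadrant (@kap_push0 R) kp (d0 : 0 <= (p, q).1) (q0 : 0 <= (p, q).2).
  have Ve : hexagon (edge (@kap_push R) (p, q)).
    apply: edge_hexagon kp _ _ => //; first exact: kap_push0.
    by move: Vpq => /hexagon_antipode.
  have eE : edge (@kap_push R) (p, q) = (p, (edge_box (@kap_push R) (p, q)).2) by rewrite edge1.
  move: Ve; rewrite eE => /(hexagon_box d0 Q0)[_ Q1].
  have qQ : q <= (edge_box (@kap_push R) (p, q)).2.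
    rewrite edge_box_near//= lerBrDr -lerBrDl ler_pdivrMr ?(mulrC _ (1 - p)); last by lra.
    by apply: flatten_le; rewrite /kap_push; lra.
  apply: (@box k.+1 (~~ eps) (1 - p) (1 - (edge_box (@kap_push R) (p, q)).2)); [lra|lra|lra|lra|].
  rewrite !K.
  rewrite iterS bE uE -eE; case: eps {uE} => /=.
    by rewrite rot_antipode rE antipodeK.
  by rewrite rE edge_antipode// kap_push0.
pose u := v; have uE : iter 0 (@bowen R) v = u by [].
have all_cases (eps : bool) X Y : 0 <= X -> hexagon (X, Y) -> (X, Y) != 0 ->
    iter 0 (@bowen R) v = (if eps then antipode (X, Y) else (X, Y)) -> False.
  move=> X0 VXY XY0 E.
  have [Y0|Y0] := ltrP 0 Y.
    have [X1 Y1] : X < 1 /\ Y < 1 by apply/hexagon_box => //; exact: ltW.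
    by apply: (@box 0%N eps (1 - X) (1 - Y)); [lra|lra|lra|lra|rewrite !K].
  have [X1|X1] := ltrP 0 X; first exact: entry E.
  have hX : X = 0 by lra.
  have Y1 : Y < 0.
    by rewrite lt_neqAle Y0 andbT; apply: contra_neq XY0 => ->; rewrite hX.
  have Y2 : - Y < 1 by move: VXY; rewrite hX => /(hexagon_side (lexx 0) Y0); lra.
  apply: (@box 0%N (~~ eps) 1 (1 - - Y)); [lra|lra|lra|lra|].
  rewrite K subrr.
  rewrite E hX; case: eps {E} => /=; rewrite /antipode /= ?opprK ?oppr0//.
have [h|/ltW h] := lerP 0 v.1.
  by apply: (@all_cases false v.1 v.2) => //; rewrite -surjective_pairing.
apply: (@all_cases true (- v.1) (- v.2)).
- by rewrite oppr_ge0.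
- by apply/hexagon_antipode.
- apply: contra_neq v0 => -[a b]; case: v {Vv const step side side' exit box entry all_cases u uE h} a b => a b /= /eqP + /eqP.
  by rewrite !oppr_eq0 => /eqP -> /eqP ->.
- by rewrite /= /antipode /= !opprK -surjective_pairing.
Qed.

End Lyapunov.

(** * Limits of the height along forward and backward orbits *)

Section Attraction.
Variable R : realType.
Local Notation plane := (R * R)%type.
Implicit Types v : plane.

Lemma cluster_value (T : topologicalType) (u : nat -> T) (p : T) (phi : T -> R) (l : R) :
  cluster (u n @[n --> \oo]) p -> {for p, continuous phi} ->
  phi (u n) @[n --> \oo] --> l -> phi p = l.
Proof.
move=> up cphi cul; apply/eqP; rewrite -subr_eq0 -normr_eq0; apply/negPn/negP => h0.
pose e := `|phi p - l| / 2; have e0 : 0 < e by rewrite divr_gt0// lt_neqAle eq_sym h0 normr_ge0.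
have A1 : nbhs p [set q | `|phi p - phi q| < e].
  by move/cvgrPdist_lt : cphi => /(_ e e0).
have A2 : nbhs (u n @[n --> \oo]) [set q | `|l - phi q| < e].
  by move/cvgrPdist_lt : cul => /(_ e e0).
have [q [/= q2 q1]] := up _ _ A2 A1.
have := ler_normD (phi p - phi q) (phi q - l); rewrite addrA subrK.
rewrite (distrC (phi q)); have : `|phi p - l| = 2 * e by rewrite /e mulrC divfK.
lra.
Qed.

Lemma compact_hexagon : compact [set v : plane | hex_norm v <= 1].
Proof.
apply: (@subclosed_compact _ _ (`[-1, 1] `*` `[-1, 1] : set plane)).
- apply: (@closed_comp _ _ (@hex_norm R) [set a | a <= 1]); last exact: closed_le.
  by move=> v _; exact: continuous_hex_norm.
- by apply: compact_setX; exact: segment_compact.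
- move=> v /=; rewrite /hex_norm !ge_max !ler_norml => /andP[/andP[h1 h2] _].
  by split; rewrite /= in_itv.
Qed.

Lemma continuous_iter (T : topologicalType) (f : T -> T) n : continuous f -> continuous (iter n f).
Proof.
move=> cf; elim: n => [|n IH] v; first exact: cvg_id.
by apply: (@continuous_comp _ _ _ (iter n f) f); [exact: IH|exact: cf].
Qed.

Lemma orbit_cluster (u : nat -> plane) : (forall n, hexagon (u n)) ->
  exists2 p, hex_norm p <= 1 & cluster (u n @[n --> \oo]) p.
Proof.
move=> Vu; have [|p [hp cp]] := @compact_hexagon (u n @[n --> \oo]) _; last by exists p.
by exists 0%N => // n _; apply: ltW; exact: Vu.
Qed.

(** LaSalle's argument: a cluster point of [u] lies in the hexagon, differs from the source and
    keeps the height [l] along its whole orbit, against [height_increases]. Taking a forward or a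
    backward orbit for [u] settles both limits. *)
Lemma no_intermediate_height (u : nat -> plane) (l : R) : (forall n, hexagon (u n)) ->
  (forall k, height (iter k (@bowen R) (u n)) @[n --> \oo] --> l) -> 0 < l -> l < 1 -> False.
Proof.
move=> Vu cu l0 l1; have [p hp cp] := orbit_cluster Vu.
have hk k : height (iter k (@bowen R) p) = l.
  apply: (cluster_value (phi := fun q => height (iter k (@bowen R) q)) cp _ (cu k)).
  apply: (@continuous_comp _ _ _ (iter k (@bowen R)) (@height R)); last exact: continuous_height.
  exact: continuous_iter (@continuous_bowen R) p.
have h0 : height p = l by exact: (hk 0%N).
have Vp : hexagon p by apply: hexagon_of_height => //; rewrite h0.
have p0 : p != 0 by apply/eqP => p0; move: h0; rewrite p0 height0; lra.
by have [k] := height_increases Vp p0; rewrite hk h0 ltxx.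
Qed.

Lemma height_iter_nondecreasing v : hexagon v ->
  {homo (fun n => height (iter n (@bowen R) v)) : m n / (m <= n)%N >-> m <= n}.
Proof.
move=> Vv; apply: homo_leq => // [x y z|n]; first exact: le_trans.
by have [] := bowen_hexagon (iter_bowen_hexagon n Vv).
Qed.

Lemma iter_bowen_inv_hexagon n v : hexagon v -> hexagon (iter n (@bowen_inv R) v).
Proof. by move=> Vv; elim: n => //= n; exact: bowen_inv_hexagon. Qed.

Lemma height_cvg1 v : hexagon v -> v != 0 ->
  height (iter n (@bowen R) v) @[n --> \oo] --> (1 : R).
Proof.
move=> Vv v0; set h := fun n => height (iter n (@bowen R) v).
have nd := height_iter_nondecreasing Vv.
have h1 n : h n < 1 by apply: height_lt1; exact: iter_bowen_hexagon.
have ub : has_ubound (range h) by exists 1 => _ [n _ <-]; exact: ltW.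
have ch := nondecreasing_cvgn nd ub; rewrite -/h in ch.
have h0 : 0 < h 0%N by exact: height_gt0.
have hl : h 0%N <= sup (range h) by apply: ub_le_sup => //; exists 0%N.
have l1 : sup (range h) <= 1.
  by apply: ge_sup; [exists (h 0%N), 0%N|move=> _ [n _ <-]; exact: ltW].
suff <- : sup (range h) = 1 by exact: ch.
apply/eqP; rewrite eq_le l1 leNgt; apply/negP => llt.
apply: (@no_intermediate_height (fun n => iter n (@bowen R) v) (sup (range h))) => //.
- by move=> n; exact: iter_bowen_hexagon.
- move=> k; have := ch; rewrite -(cvg_shiftn k h).
  have -> // : [sequence h (n + k)%N]_n = (fun n => height (iter k (@bowen R) (iter n (@bowen R) v))).
  by apply/funext => n; rewrite /h /mk_sequence addnC iterD.
- exact: lt_le_trans hl.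
Qed.

Lemma iter_bowen_inv_cvg0 v : hexagon v ->
  iter n (@bowen_inv R) v @[n --> \oo] --> (0 : plane).
Proof.
move=> Vv; set h := fun n => height (iter n (@bowen_inv R) v).
have Vn n := iter_bowen_inv_hexagon n Vv.
have nd : {homo h : m n / (m <= n)%N >-> n <= m}.
  apply: (@homo_leq _ _ (fun a b => b <= a)) => [x|x y z xy yz|n]; [exact: lexx|exact: le_trans xy|].
  by have [_] := bowen_hexagon (Vn n.+1); rewrite /= bowen_invK.
have h0 n : 0 <= h n by apply: le_trans (height_ge_norm (Vn n)).
have lb : has_lbound (range h) by exists 0 => _ [n _ <-].
have ch := nonincreasing_cvgn nd lb.
have hl : inf (range h) <= h 0%N by apply: ge_inf => //; exists 0%N.
have l0 : 0 <= inf (range h).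
  by apply: lb_le_inf; [exists (h 0%N), 0%N|move=> _ [n _ <-]].
have l_eq0 : inf (range h) = 0.
  apply/eqP; rewrite eq_le l0 andbT leNgt; apply/negP => lgt.
  apply: (@no_intermediate_height (fun n => iter n (@bowen_inv R) v) (inf (range h))) => //.
  - move=> k; rewrite -(cvg_shiftn k).
    have -> // : [sequence height (iter k (@bowen R) (iter (n + k) (@bowen_inv R) v))]_n = h.
    by apply/funext => n; rewrite /mk_sequence addnC iterD iter_bowen_invK.
  - by apply: le_lt_trans hl _; exact: height_lt1.
rewrite l_eq0 in ch; apply/cvgr0Pnorm_lt => e e0.
near=> n; apply: le_lt_trans (height_ge_norm (Vn n)) _.
rewrite -[ltLHS]ger0_norm ?h0// -[height _]subr0 distrC; near: n.
by move/cvgrPdist_lt : ch; exact.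
Unshelve. all: by end_near. Qed.

End Attraction.

(** * Sojourns near the saddles *)

Section Passes.
Variable R : realType.
Local Notation plane := (R * R)%type.
Implicit Types (v : plane) (t w x y : R).

(* The point with parameter t on the segment of the fourth quadrant where
   [height] is 1 - w. *)
Definition crossing t w : plane := ((1 - w) * (1 - t), - ((1 - w) * t)).

Definition saddle1 : plane := (1, 1).
Definition saddle2 : plane := (- 1, - 1).

Definition side v := 0 <= v.1 + v.2.
Definition side_dist v : R := `|v - (if side v then saddle1 else saddle2)|.

Lemma bowen_box_local x y : 0 <= x -> x <= 1 -> 0 <= y -> y <= 2^-1 -> x * y <= 4^-1 ->
  bowen (1 - x, 1 - y) = (1 - x / 2, 1 - 2 * y).
Proof.
move=> x0 x1 y0 y1 xy.
have C : 5 / 4 <= (1 - x) / 2 + 2 * (1 - y).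
  have [h|h] := lerP y 4^-1; first by lra.
  (* With [x <= 1 / (4 * y)], the bound [x / 2 + 2 * y <= 5 / 4] follows from
     [16 * y ^ 2 - 10 * y + 1 <= 0], which is this product. *)
  have : (8 * y - 1) * (2 * y - 1) <= 0 by nra.
  by nra.
by rewrite (bowen_box _ _ C); [congr pair; field|lra|lra].
Qed.

Lemma iter_bowen_box x y j : 0 <= x -> x <= 1 -> 0 <= y -> x * y <= 4^-1 ->
  2 ^+ j * y <= 1 ->
  iter j (@bowen R) (1 - x, 1 - y) = (1 - x / 2 ^+ j, 1 - 2 ^+ j * y).
Proof.
move=> x0 x1 y0 xy; elim: j => [|j IH]; first by rewrite expr0 divr1 mul1r.
rewrite exprS -mulrA => yj.
have p0 : 0 < 2 ^+ j :> R by rewrite exprn_gt0.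
have yj0 : 0 <= 2 ^+ j * y by rewrite mulr_ge0// ltW.
rewrite iterS IH; last by lra.
have xj0 : 0 <= x / 2 ^+ j by rewrite divr_ge0// ltW.
have xj1 : x / 2 ^+ j <= 1.
  by rewrite ler_pdivrMr// mul1r; apply: le_trans x1 _; rewrite exprn_ege1// ler1n.
have xyj : x / 2 ^+ j * (2 ^+ j * y) = x * y by rewrite mulrA divfK// gt_eqF.
rewrite bowen_box_local// ?xyj//; last by lra.
by congr pair; field; rewrite gt_eqF.
Qed.

(** The rotation keeps [x * y]; the push then acts at the crossing with phase [t = 2 * y - 1], where
    its exponent is [1 + t]. The next step, in [bowen_entry], has exponent [2 - t], and afterwards
    the orbit is out of reach of the push until the next crossing. *)
Lemma bowen_exit x y : 0 < x -> 2^-1 <= y -> y < 1 -> x * y <= 4^-1 ->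
  bowen (1 - x, 1 - y) = crossing (2 * y - 1) (flatten (2 * y) (x * y)).
Proof.
move=> x0 y2 y1 xy; have x2 : x <= 2^-1 by nra.
have w0 : 0 < x * y by rewrite mulr_gt0//; lra.
rewrite /bowen rot_exit; [|lra|lra|lra].
rewrite level_out; [|lra|lra|by left; lra].
have -> : 1 - x + (1 - y) - (1 - x) * (1 - y) = 1 - x * y by ring.
set w := x * y in w0 xy *.
have -> : speed (1 - w) = 2 * (1 - w) by rewrite /speed max_r//; lra.
have -> : 2 * (1 - w) * (1 - y) - (1 - w) = - ((1 - w) * (2 * y - 1)) by ring.
have X0 : 0 <= 2 * (1 - w) * (1 - y) by rewrite mulr_ge0 ?mulr_ge0//; lra.
have Y0 : - ((1 - w) * (2 * y - 1)) <= 0 by rewrite oppr_le0 mulr_ge0//; lra.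
have s : 2 * (1 - w) * (1 - y) - - ((1 - w) * (2 * y - 1)) = 1 - w by ring.
rewrite radial_push_far; last first.
  rewrite /norm1 /= (ger0_norm X0) (ler0_norm Y0).
  have -> : 2 * (1 - w) * (1 - y) - - ((1 - w) * (2 * y - 1)) = 1 - w by ring.
  lra.
rewrite edge4 ?kap_push0// edge_side_far ?s//; last by lra.
have s0 : 1 - w != 0 by rewrite gt_eqF//; lra.
have -> : - - ((1 - w) * (2 * y - 1)) / (1 - w) = 2 * y - 1 by rewrite opprK mulrAC divff// mul1r.
have -> : kap_push (2 * y - 1) = 2 * y by rewrite /kap_push; ring.
have -> : 1 - (1 - w) = w by ring.
by rewrite /scale /crossing /=; congr pair; field.
Qed.

Lemma bowen_entry t w : 0 <= t -> t <= 1 -> 0 < w -> w <= 4^-1 ->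
  bowen (crossing t w) =
    antipode (1 - (1 - t / 2), 1 - flatten (2 - t) w / (1 - t / 2)).
Proof.
move=> t0 t1 w0 w1; rewrite /bowen /crossing rot_entry; first last.
- by rewrite oppr_le0 mulr_ge0//; lra.
- by rewrite mulr_ge0//; lra.
have -> : (1 - w) * (1 - t) - - ((1 - w) * t) = 1 - w by ring.
have -> : speed (1 - w) = 2 * (1 - w) by rewrite /speed max_r//; lra.
have s0 : 1 - w != 0 by rewrite gt_eqF//; lra.
have E1 : - - ((1 - w) * t) / (2 * (1 - w)) = t / 2 by field.
have E2 : - ((1 - w) * t) / (2 * (1 - w)) = - (t / 2) by field.
rewrite E1 E2.
have h1 : 0 <= t / 2 by lra.
have h2 : t / 2 <= 2^-1 by lra.
have h3 : t / 2 <= 1 - w by lra.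
have x0 : 0 < 1 - t / 2 by lra.
have iE : ilevel (t / 2) (1 - w) = 1 - w / (1 - t / 2).
  case: (ilevelP h1 h2 h3) => [|_ h5|_]; first by lra.
    have -> : t = 1 by lra.
    by have -> : w = 4^-1 by [lra]; field.
  by congr (1 - _ / _); ring.
have yb : w / (1 - t / 2) <= 2^-1 by rewrite ler_pdivrMr//; lra.
have yb0 : 0 < w / (1 - t / 2) by rewrite divr_gt0.
rewrite iE -[(- (t / 2), - _)]/(antipode (t / 2, 1 - w / (1 - t / 2))).
rewrite radial_push_antipode radial_push_far; last first.
  rewrite norm1_quadrant//; last by lra.
  have : (1 - t / 2) * (w / (1 - t / 2)) = w by rewrite mulrC divfK// gt_eqF.
  set y := w / (1 - t / 2) in yb yb0 *; nra.
rewrite edge_antipode ?kap_push0//.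
rewrite [edge _ _]edge1 /=; [|by []|by lra].
rewrite edge_box_near//; congr antipode; congr pair; first by ring.
have -> : (1 - t / 2) * (1 - (1 - w / (1 - t / 2))) = w.
  by field; rewrite gt_eqF//; lra.
have -> : kap_push (1 - 2 * (t / 2)) = 2 - t by rewrite /kap_push; lra.
by [].
Qed.

(** Equal to [1 - ln (2 * w')], where [w' = flatten (2 - t) w] is the value of [x * y] kept during
    the passage; up to a bounded error, the number of steps times [ln 2]. *)
Definition pass_size t w := expR ((2 - t) * depth w).

Lemma depth_flatten_ln c w : 0 < c -> 0 < w -> w < 2^-1 ->
  expR (c * depth w) = 1 - ln (2 * flatten c w).
Proof.
move=> c0 w0 w1; rewrite -(flatten_depth _ w0 w1).
have f1 := flatten_lt c0 w1; have f0 := flatten_gt0 c w0.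
by have := ln2w f0 f1 => l; rewrite /depth lnK// posrE; lra.
Qed.

Lemma ln2_bounds : 2^-1 <= ln (2 : R) /\ ln (2 : R) <= 1.
Proof.
split.
  have : ln (1 + - 2^-1 : R) <= - 2^-1 by apply: le_ln1Dx; lra.
  have -> : 1 + - 2^-1 = 2^-1 :> R by lra.
  by rewrite lnV ?posrE//; lra.
have : ln (1 + 1 : R) <= 1 by apply: le_ln1Dx; lra.
by [].
Qed.

Definition state := (R * R)%type.
Definition good_state (s : state) := [/\ 0 <= s.1, s.1 < 1, 0 < s.2 & s.2 <= 4^-1].

(* A passage near a saddle takes the orbit from a crossing to the opposite one in
   k + 2 steps. By the last two clauses k grows quadratically from one passage to
   the next, so that each sojourn outweighs all the previous ones. *)
Definition pass (s : state) (k : nat) (s' : state) := [/\ good_state s',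
  iter k.+2 (@bowen R) (crossing s.1 s.2) = antipode (crossing s'.1 s'.2),
  (forall j, (j <= k)%N -> exists2 xy : R * R,
     iter j.+1 (@bowen R) (crossing s.1 s.2) = antipode (1 - xy.1, 1 - xy.2) &
     [/\ 0 < xy.1, xy.1 <= 2 ^- j, 0 < xy.2, xy.2 < 2 ^- (k - j) & xy.2 < 1]),
  pass_size s.1 s.2 - 2 <= k%:R * ln 2 <= pass_size s.1 s.2 &
  pass_size s.1 s.2 ^+ 2 <= pass_size s'.1 s'.2].

Lemma exit_time y : 0 < y -> y < 2^-1 ->
  exists k, 2^-1 <= 2 ^+ k * y /\ 2 ^+ k * y < 1.
Proof.
move=> y0 y1.
have exj : exists j, 2^-1 <= 2 ^+ j * y.
  have y0' : 0 < 2 * y by lra.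
  have [n _ /(_ n (leqnn n)) h] := near_infty_natSinv_expn_lt (PosNum y0').
  by exists n; move: h; rewrite /= ltr_pdivrMr ?exprn_gt0//; lra.
case: (ex_minnP exj) => -[|j] yj jmin; first by move: yj; rewrite expr0; lra.
exists j.+1; split => //; rewrite exprS -mulrA.
suff : 2 ^+ j * y < 2^-1 by lra.
by rewrite ltNge; apply/negP => /jmin; rewrite ltnn.
Qed.

Lemma exists_pass (s : state) : good_state s -> exists ks : nat * state, pass s ks.1 ks.2.
Proof.
case: s => t w [/= t0 t1 w0 w1].
(* Up to the antipode, the entry point is [(1 - x, 1 - y)], and [x * y = w'] is preserved until the
   exit. *)
set x := 1 - t / 2; set w' := flatten (2 - t) w; set y := w' / x.
have x0 : 0 < x by rewrite /x; lra.
have x1 : x <= 1 by rewrite /x; lra.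
have w'0 : 0 < w' by exact: flatten_gt0.
have w'w : w' <= w by apply: flatten_le; lra.
have y0 : 0 < y by rewrite divr_gt0.
have xy : x * y = w' by rewrite mulrC divfK// gt_eqF.
have y1 : y < 2^-1.
  by rewrite ltr_pdivrMr// /x; lra.
have w2 : w < 2^-1 by lra.
have xy4 : x * y <= 4^-1 by lra.
have [k [k1 k2]] := exit_time y0 y1.
have p0 j : 0 < 2 ^+ j :> R by rewrite exprn_gt0.
have it j : (j <= k)%N -> iter j.+1 (@bowen R) (crossing t w) =
    antipode (1 - x / 2 ^+ j, 1 - 2 ^+ j * y).
  move=> jk; rewrite iterSr bowen_entry ?(ltW t1)// -/x -/w' -/y.
  have -> n v : iter n (@bowen R) (antipode v) = antipode (iter n (@bowen R) v).
    by elim: n => //= n ->; rewrite bowen_antipode.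
  rewrite iter_bowen_box ?(ltW x0) ?(ltW y0)//.
  apply: le_trans (_ : 2 ^+ k * y <= _); last exact: ltW.
  by rewrite ler_pM2r// ler_weXn2l// ler1n.
pose t' := 2 * (2 ^+ k * y) - 1; pose w'' := flatten (2 * (2 ^+ k * y)) w'.
have t'0 : 0 <= t' by rewrite /t'; lra.
have t'1 : t' < 1 by rewrite /t'; lra.
have w''0 : 0 < w'' by exact: flatten_gt0.
have w''1 : w'' <= w' by apply: flatten_le; lra.
exists (k, (t', w'')); split => /=.
- by split => //=; lra.
- have := it k (leqnn k); rewrite /= => ->; rewrite bowen_antipode.
  have E : x / 2 ^+ k * (2 ^+ k * y) = w' by rewrite mulrA divfK ?xy// gt_eqF.
  by rewrite bowen_exit ?E ?divr_gt0//; lra.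
- move=> j jk; exists (x / 2 ^+ j, 2 ^+ j * y); first exact: it.
  have yk : 2 ^+ j * y < 2 ^- (k - j).
    by rewrite -[ltRHS]mulr1 ltr_pdivlMl// mulrA -exprD subnK.
  split => //=; [by rewrite divr_gt0| |by rewrite mulr_gt0|].
    by rewrite ler_pdivrMr// mulVf// gt_eqF.
  apply: lt_le_trans yk _; rewrite invf_le1//.
  by rewrite exprn_ege1// ler1n.
- have [l1 l2] := ln2_bounds.
  have c0 : 0 < 2 - t by lra.
  (* As [x] lies between 1/2 and 1, [y] lies between [w'] and [2 * w']; with [1/2 <= 2 ^+ k * y < 1]
     this places [2 ^+ k * w'] between 1/4 and 1. *)
  rewrite /pass_size depth_flatten_ln// -/w' lnM ?posrE//.
  have kE : k%:R * ln 2 = ln (2 ^+ k : R) by rewrite lnXn// mulr_natl.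
  rewrite kE; apply/andP; split.
    have : ln (4 * w') + ln (2 ^+ k) >= 0.
      rewrite -lnM ?posrE ?mulr_gt0// ln_ge0//.
      have : y <= 2 * w' by rewrite ler_pdivrMr// /x; nra.
      have := p0 k; nra.
    rewrite lnM ?posrE//; have -> : ln (4 : R) = ln 2 + ln 2 by rewrite -lnM ?posrE//; congr ln; ring.
    lra.
  have : ln w' + ln (2 ^+ k) <= 0.
    rewrite -lnM ?posrE//; apply: ln_le0.
    have : w' <= y by rewrite ler_pdivlMr// ler_piMr// ltW.
    have := p0 k; nra.
  lra.
(* From one [pass_size] to the next, the exponents of the exit and of the following entry multiply:
   [(1 + t') * (2 - t') >= 2]. *)
- have w'2 : w' < 2^-1 by lra.
  rewrite /pass_size /w'' flatten_depth// /w' flatten_depth// -expRM_natl ler_expR.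
  have -> : 2 * (2 ^+ k * y) = 1 + t' by rewrite /t'; ring.
  rewrite !mulrA; apply: ler_wpM2r; first by rewrite ltW// depth_gt0.
  apply: ler_wpM2r; first by lra.
  nra.
Qed.

End Passes.

(** * Time averages along sojourns of growing length *)

Section Counting.
Variables (R : realType) (T k : nat -> nat) (sd : nat -> bool) (d : nat -> R) (b0 : bool).
Hypothesis T_step : forall i, T i.+1 = (T i + k i).+2.
Hypothesis sd_pass : forall i j, (j <= k i)%N -> sd (T i + j.+1)%N = b0 (+) odd i.
Hypothesis d_pass : forall i j, (j <= k i)%N -> d (T i + j.+1)%N <= 2 ^- j + 2 ^- (k i - j).
Hypothesis d_bound : forall n, 0 <= d n <= 2.
Hypothesis k_large : forall i, (16 <= k i)%N.
Hypothesis k_growth : forall i, (k i)%:R ^+ 2 / 4 - 2 <= (k i.+1)%:R :> R.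

Let S n : R := \sum_(j < n) d j.

Let k_double i : (2 * k i <= k i.+1)%N.
Proof.
rewrite -(ler_nat R); apply: le_trans (k_growth i); rewrite natrM.
have : 16 <= (k i)%:R :> R by rewrite ler_nat.
by nra.
Qed.

Let k_lower i : (16 + 2 * i <= k i)%N.
Proof. by elim: i => [|i IH]; [exact: k_large|have := k_double i; lia]. Qed.

(** Linear growth of the sojourns makes their starting times quadratic: about [sqrt n] passages at
    most begin before time [n]. *)
Let T_lower i : (i ^ 2 <= T i)%N.
Proof.
elim: i => // i IH; rewrite T_step; have := k_lower i; rewrite expnS expn1 in IH *; lia.
Qed.

Let sum_half n : \sum_(j < n) (2 ^- j : R) <= 2.
Proof.
suff -> : \sum_(j < n) (2 ^- j : R) = 2 - 2 * 2 ^- n.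
  by rewrite gerBl// mulr_ge0// invr_ge0 exprn_ge0.
elim: n => [|n IH]; first by rewrite big_ord0 expr0 invr1 mulr1 subrr.
rewrite big_ord_recr /= IH exprS invfM.
by set z := 2 ^- n; field.
Qed.

Let S_mono m n : (m <= n)%N -> S m <= S n.
Proof.
move=> /subnK <-; elim: (n - m)%N => // p IH; rewrite addSn /S big_ord_recr /=.
by apply: le_trans IH _; rewrite lerDl; case/andP: (d_bound (p + m)).
Qed.

(** The crossing itself is far from both saddles and costs at most 2; the geometric sums counted
    from the two ends of the passage cost at most 2 each. *)
Let S_pass i : S (T i.+1) <= S (T i) + 6.
Proof.
have E n m : S (n + m) = S n + \sum_(j < m) d (n + j)%N by rewrite /S big_split_ord.
have -> : T i.+1 = (T i + (k i).+2)%N by rewrite T_step; lia.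
rewrite E lerD2l big_ord_recl addn0.
apply: (@le_trans _ _ (2 + \sum_(j < (k i).+1) (2 ^- j + 2 ^- (k i - j)))).
  apply: lerD; first by case/andP: (d_bound (T i)).
  by apply: ler_sum => j _; rewrite lift0; apply: d_pass; rewrite -ltnS.
rewrite big_split /= [X in _ + (_ + X)](reindex_inj rev_ord_inj) /=.
have -> : \sum_(j < (k i).+1) (2 ^- (k i - ((k i).+1 - j.+1)) : R) =
    \sum_(j < (k i).+1) 2 ^- j.
  by apply: eq_bigr => j _; congr (_ ^- _); have := ltn_ord j; lia.
by have := sum_half (k i).+1; lra.
Qed.

Let S_T i : S (T i) <= S (T 0%N) + 6 * i%:R.
Proof.
elim: i => [|i IH]; first by rewrite mulr0 addr0.
by apply: le_trans (S_pass i) _; rewrite -natr1; lra.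
Qed.

Let S_index n : exists i, (i ^ 2 <= n)%N /\ S n.+1 <= S (T 0%N) + 6 * i.+1%:R.
Proof.
have exm : exists m, (n < T m)%N.
  exists n.+1; apply: leq_trans (T_lower n.+1); rewrite expnS expn1; lia.
case: (ex_minnP exm) => -[|m] nT mmin.
  exists 0%N; split => //; apply: le_trans (S_mono nT) _; lra.
exists m; split; last by apply: le_trans (S_mono nT) (S_T _).
apply: leq_trans (T_lower m) _.
by rewrite leqNgt; apply/negP => /mmin; rewrite ltnn.
Qed.

(** Each passage adds at most 6 to the sum of the distances, and there are only about [sqrt n] of
    them before time [n]. *)
Lemma cesaro_pass : (n.+1%:R^-1 * \sum_(j < n.+1) d j) @[n --> \oo] --> (0 : R).
Proof.
apply/cvgr0Pnorm_le => e e0.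
pose C := S (T 0%N) + 6 + 18 / e.
near=> n.
have n0 : 0 < n.+1%:R :> R by rewrite ltr0n.
rewrite ger0_norm; last first.
  by rewrite mulr_ge0 ?invr_ge0 ?ler0n// sumr_ge0// => j _; case/andP: (d_bound j).
rewrite mulrC ler_pdivrMr//.
have [i [i2 Si]] := S_index n; apply: le_trans Si _.
have i2' : i%:R ^+ 2 <= n%:R :> R by rewrite -natrX ler_nat.
(* The arithmetic-geometric inequality trades the term linear in [i] for a small multiple of
   [i ^ 2], itself at most [n]. *)
have hi : i%:R <= e / 12 * i%:R ^+ 2 + 3 / e.
  rewrite -subr_ge0.
  have -> : e / 12 * i%:R ^+ 2 + 3 / e - i%:R = (e * i%:R - 6) ^+ 2 / (12 * e).
    by field; rewrite gt_eqF.
  by rewrite divr_ge0 ?sqr_ge0// mulr_ge0// ltW.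
have hn : C <= e / 2 * n.+1%:R.
  have : 2 * C / e <= n.+1%:R.
    near: n; exists (Num.truncn (2 * C / e)) => // n /= hn.
    by apply: ltW; apply: lt_le_trans (truncnS_gt _) _; rewrite ler_nat ltnS.
  by rewrite ler_pdivrMr//; lra.
have hni : 6 * (e / 12 * i%:R ^+ 2) <= e / 2 * n%:R by nra.
have hn1 : n.+1%:R = n%:R + 1 :> R by rewrite natr1.
have hi1 : i.+1%:R = i%:R + 1 :> R by rewrite natr1.
move: hn; rewrite /C hn1 hi1 => hn.
have : 6 * (3 / e) = 18 / e by field; rewrite gt_eqF.
lra.
Unshelve. all: by end_near. Qed.

Let T_upper i : (T i.+1 <= T 0%N + 2 * k i)%N.
Proof.
elim: i => [|i IH]; first by rewrite T_step; have := k_large 0; lia.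
rewrite T_step; have := k_double i; have := k_large i.
have : (2 * k i + 2 <= k i.+1)%N.
  rewrite -(ler_nat R); apply: le_trans (k_growth i); rewrite natrD natrM.
  have : 16 <= (k i)%:R :> R by rewrite ler_nat.
  by nra.
by lia.
Qed.

(** Stop at the end of a late passage near the required saddle: its length is quadratic in the
    previous length [k i.-1], whereas all the time before it is linear in [k i.-1]. *)
Lemma frequent_side (b : bool) (e : R) (N : nat) : 0 < e ->
  exists2 n, (N <= n)%N & (1 - e) * n.+1%:R <= \sum_(j < n.+1) (sd j == b)%:R.
Proof.
move=> e0; pose C : R := (T 0%N)%:R + 3.
pose K := maxn N (Num.truncn (8 * C / e)).+1.
(* Sides alternate, so one of two consecutive passages is on side [b]. *)
pose i := if b0 (+) odd K.+1 == b then K.+1 else K.+2.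
have iK : (K < i)%N by rewrite /i; case: ifP.
have ib : b0 (+) odd i = b.
  by rewrite /i; case: eqP => // /=; case: b0; case: (b); case: (odd K).
have i1 : i = i.-1.+1 by rewrite prednK//; exact: leq_trans iK.
have Ki : (K <= i.-1)%N by rewrite i1 in iK.
exists (T i + k i).+1.
  apply: leq_trans (leq_trans (leq_maxl N _) (ltnW iK)) _.
  by have := k_lower i; rewrite -/K; lia.
have large : (1 - e) * (T i + k i).+2%:R <= (k i).+1%:R :> R.
  have Tu := T_upper i.-1; rewrite -i1 in Tu.
  have Tu' : (T i)%:R <= (T 0%N)%:R + 2 * (k i.-1)%:R :> R by rewrite -natrM -natrD ler_nat.
  have kg := k_growth i.-1; rewrite -i1 in kg.
  have kK : 8 * C / e <= (k i.-1)%:R.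
    apply: ltW; apply: lt_le_trans (truncnS_gt _) _; rewrite ler_nat.
    apply: leq_trans (leq_maxr N _) _; rewrite -/K.
    by apply: leq_trans Ki _; have := k_lower i.-1; lia.
  have k16 : 16 <= (k i.-1)%:R :> R by rewrite ler_nat.
  move: kK; rewrite ler_pdivrMr// => kK.
  have T0 : 0 <= (T 0%N)%:R :> R by rewrite ler0n.
  have -> : (T i + k i).+2%:R = (T i)%:R + (k i)%:R + 2 :> R by rewrite -addn2 !natrD.
  have -> : (k i).+1%:R = (k i)%:R + 1 :> R by rewrite -addn1 natrD.
  set q := (k i.-1)%:R in Tu' kg kK k16 *; set p := (k i)%:R in kg *.
  have h1 : e * p >= q * C.
    apply: (@le_trans _ _ (e * (q ^+ 2 / 8))); last first.
      by apply: ler_wpM2l; [exact: ltW|nra].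
    have -> : e * (q ^+ 2 / 8) = q * (q * e / 8) by field.
    by apply: ler_wpM2l; lra.
  have h2 : (T i)%:R + 1 <= q * C by rewrite /C; nra.
  have Ti0 : 0 <= (T i)%:R :> R by rewrite ler0n.
  nra.
apply: le_trans large _.
have E n m : \sum_(j < n + m) ((sd j == b)%:R : R) =
    \sum_(j < n) (sd j == b)%:R + \sum_(j < m) (sd (n + j)%N == b)%:R by rewrite big_split_ord.
have -> : (T i + k i).+2 = (T i + (k i).+2)%N by lia.
rewrite E big_ord_recl addn0.
apply: (@le_trans _ _ (\sum_(j < (k i).+1) (sd (T i + lift ord0 j)%N == b)%:R)).
  rewrite (eq_bigr (fun=> 1)) ?sumr_const ?card_ord// => j _.
  by rewrite lift0 sd_pass ?ib ?eqxx// -ltnS.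
rewrite addrA lerDr addr_ge0 ?ler0n// sumr_ge0// => j _; exact: ler0n.
Qed.

End Counting.

(** * Decomposition of an orbit into passages *)

Section Itinerary.
Variable R : realType.
Local Notation plane := (R * R)%type.
Local Notation bowen := (@bowen R).
Implicit Types (v : plane) (b : bool).

Definition flip b v := if b then antipode v else v.

Lemma flipK b : involutive (flip b).
Proof. by case: b => v //=; rewrite antipodeK. Qed.

Lemma flip_flip a b v : flip a (flip b v) = flip (a (+) b) v.
Proof. by case: a; case: b => //=; rewrite antipodeK. Qed.

Lemma iter_bowen_flip n b v : iter n bowen (flip b v) = flip b (iter n bowen v).
Proof. by case: b => //=; elim: n => //= n ->; rewrite bowen_antipode. Qed.

Lemma hexagon_flip b v : hexagon (flip b v) <-> hexagon v.
Proof. by case: b => //; exact: hexagon_antipode. Qed.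

Lemma height_flip b v : height (flip b v) = height v.
Proof. by case: b => //; exact: height_antipode. Qed.

Lemma crossing_of_box x y : 0 < x -> x <= 1 -> 0 < y -> y < 1 -> x * y <= 4^-1 ->
  exists m t w, [/\ iter m bowen (1 - x, 1 - y) = crossing t w, 0 <= t < 1 & 0 < w <= x * y].
Proof.
move=> x0 x1 y0 y1 xy.
have [k [k1 k2]] : exists k, 2^-1 <= 2 ^+ k * y /\ 2 ^+ k * y < 1.
  have [y2|y2] := ltrP y 2^-1; first exact: exit_time.
  by exists 0%N; rewrite expr0 mul1r.
have p0 : 0 < 2 ^+ k :> R by rewrite exprn_gt0.
have E : x / 2 ^+ k * (2 ^+ k * y) = x * y by rewrite mulrA divfK// gt_eqF.
exists k.+1, (2 * (2 ^+ k * y) - 1), (flatten (2 * (2 ^+ k * y)) (x * y)); split.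
- by rewrite iterS iter_bowen_box ?bowen_exit ?E ?divr_gt0// ?(ltW x0) ?(ltW y0)// ltW.
- by apply/andP; split; lra.
- rewrite flatten_gt0 ?mulr_gt0//=; apply: flatten_le; lra.
Qed.

Lemma half_plane_cases v : v != 0 -> exists b X Y, v = flip b (X, Y) /\
  ((0 < X /\ Y <= 0) \/ (0 <= X /\ 0 < Y)).
Proof.
case: v => X Y v0; have [X0|X0|X0] := ltgtP X 0.
- exists true, (- X), (- Y); split; first by rewrite /flip /antipode /= !opprK.
  have [Y0|Y0] := ltrP Y 0; [right|left]; lra.
- exists false, X, Y; split => //.
  have [Y0|Y0] := ltrP 0 Y; [right|left]; lra.
- have [Y0|Y0|Y0] := ltgtP Y 0.
  + exists true, (- X), (- Y); split; first by rewrite /flip /antipode /= !opprK.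
    right; lra.
  + by exists false, X, Y; split => //; right; lra.
  + by move: v0; rewrite X0 Y0 eqxx.
Qed.

(** The height tends to 1. Once it exceeds [1 - del], a point of a side region is itself a crossing,
    and a point of a box has [x * y < del] and reaches a crossing by [crossing_of_box]. *)
Lemma reaches_crossing v (del : R) : hexagon v -> v != 0 -> 0 < del -> del <= 4^-1 ->
  exists n b t w, [/\ iter n bowen v = flip b (crossing t w), 0 <= t < 1 & 0 < w < del].
Proof.
move=> Vv v0 d0 d4.
have /cvgrPdist_lt /(_ del d0) [n _ /(_ n (leqnn n)) /= hn] := height_cvg1 Vv v0.
set u := iter n bowen v in hn.
have Vu : hexagon u := iter_bowen_hexagon n Vv.
have h1 := height_lt1 Vu.
have {}hn : 1 - height u < del by apply: le_lt_trans hn; exact: ler_norm.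
have u0 : u != 0 by apply/eqP => u0; move: hn; rewrite u0 height0; lra.
have [b [X [Y [uE]]]] := half_plane_cases u0.
move: Vu h1 hn; rewrite uE hexagon_flip height_flip => VXY h1 hn [[X0 Y0]|[X0 Y0]].
- rewrite (height_side (ltW X0) Y0) in h1 hn.
  have s0 : X - Y != 0 by rewrite gt_eqF//; lra.
  exists n, b, (- Y / (X - Y)), (1 - (X - Y)); split; last by lra.
    rewrite -/u uE /crossing; congr flip; congr pair; by field.
  rewrite divr_ge0/=; [|lra|lra].
  by rewrite ltr_pdivrMr; lra.
- have [X1 Y1] : X < 1 /\ Y < 1 by apply/(hexagon_box X0 (ltW Y0)).
  rewrite (height_box X0 (ltW Y0)) in h1 hn.
  have xy : (1 - X) * (1 - Y) < del.
    by move: hn; case: (levelP X0 (ltW Y0)) => *; nra.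
  have [m [t [w [E t01 w01]]]] : exists m t w, [/\ iter m bowen (1 - (1 - X), 1 - (1 - Y)) = crossing t w,
      0 <= t < 1 & 0 < w <= (1 - X) * (1 - Y)] by apply: crossing_of_box; lra.
  exists (m + n)%N, b, t, w; split => //; last by lra.
  rewrite iterD -/u uE iter_bowen_flip; congr flip; rewrite -E.
  by congr (iter _ _ (_, _)); ring.
Qed.

Lemma side_dist_bound v : hexagon v -> 0 <= side_dist v <= 2.
Proof.
move=> Vv; rewrite /side_dist normr_ge0 /=.
have v1 : `|v| <= 1 by apply: le_trans (height_ge_norm Vv) (ltW (height_lt1 Vv)).
apply: le_trans (ler_normB _ _) _.
suff : `|if side v then saddle1 R else saddle2 R| <= 1 by lra.
by case: ifP => _; rewrite plane_norm /= ?normrN normr1 maxxx.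
Qed.

Lemma side_box b (x y : R) : 0 < x -> x <= 1 -> 0 < y -> y < 1 ->
  side (flip b (1 - x, 1 - y)) = ~~ b /\
  side_dist (flip b (1 - x, 1 - y)) <= x + y.
Proof.
move=> x0 x1 y0 y1.
have s : side (flip b (1 - x, 1 - y)) = ~~ b.
  by rewrite /side; case: b => /=; [apply/negbTE; rewrite -ltNge|]; lra.
split => //; rewrite /side_dist s.
have -> : flip b (1 - x, 1 - y) - (if ~~ b then saddle1 R else saddle2 R) = flip b (- x, - y).
  by case: b {s} => /=; congr pair => /=; ring.
have -> : `|flip b (- x, - y)| = Num.max x y.
  by case: b {s}; rewrite plane_norm /= !normrN !gtr0_norm.
by rewrite ge_max; apply/andP; split; lra.
Qed.

Lemma itinerary v : hexagon v -> v != 0 -> exists (T k : nat -> nat) (b0 : bool),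
  [/\ forall i, T i.+1 = (T i + k i).+2,
      forall i j, (j <= k i)%N -> side (iter (T i + j.+1) bowen v) = b0 (+) odd i /\
        side_dist (iter (T i + j.+1) bowen v) <= 2 ^- j + 2 ^- (k i - j),
      forall i, (16 <= k i)%N &
      forall i, (k i)%:R ^+ 2 / 4 - 2 <= (k i.+1)%:R :> R].
Proof.
(* A depth above 20 makes the first [pass_size] at least 18, hence the first sojourn at least 16
   steps long; 1/4 is the bound in [good_state]. *)
move=> Vv v0; pose del : R := Num.min 4^-1 (of_depth 20).
have d0 : 0 < del by rewrite lt_min invr_gt0 ltr0n of_depth_gt0.
have d4 : del <= 4^-1 by rewrite ge_min lexx.
have [n0 [b0 [t0 [w0 [E0 /andP[t00 t01] /andP[w00 w01]]]]]] := reaches_crossing Vv v0 d0 d4.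
have g0 : good_state (t0, w0) by split => //=; lra.
have size0 : 18 <= pass_size t0 w0.
  have dp : 20 < depth w0.
    rewrite -of_depth_lt_mono depthK//; last by lra.
    by apply: lt_le_trans w01 _; rewrite ge_min lexx orbT.
  rewrite /pass_size; apply: le_trans (expR_ge1Dx _); nra.
have /choice[nxt Hnxt] : forall s, exists ks : nat * state R, good_state s -> pass s ks.1 ks.2.
  move=> s; have [/exists_pass[ks ?]|ng] := pselect (good_state s); first by exists ks.
  by exists (0%N, s).
pose st i := iter i (fun s => (nxt s).2) (t0, w0).
have gst i : good_state (st i).
  by elim: i => //= i IH; have [] := Hnxt _ IH.
have Hst i : pass (st i) (nxt (st i)).1 (st i.+1) by exact: Hnxt.
pose k i := (nxt (st i)).1.
pose T i := iteri i (fun j t => (t + k j).+2) n0.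
have TS i : T i.+1 = (T i + k i).+2 by [].
have TE i : iter (T i) bowen v = flip (b0 (+) odd i) (crossing (st i).1 (st i).2).
  elim: i => [|i IH]; first by rewrite addbF.
  have [_ E _ _ _] := Hst i.
  have -> : T i.+1 = ((k i).+2 + T i)%N by rewrite TS; lia.
  rewrite [odd _]/= iterD IH iter_bowen_flip E -/(flip true _) flip_flip.
  by congr flip; case: b0 {E0 IH}; case: (odd i).
have [l1 l2] := ln2_bounds R.
have sz i : pass_size (st i).1 (st i).2 - 2 <= (k i)%:R * ln 2 <= pass_size (st i).1 (st i).2.
  by have [] := Hst i.
have grow i : (k i)%:R ^+ 2 / 4 - 2 <= (k i.+1)%:R :> R.
  have [_ _ _ _ g2] := Hst i.
  have /andP[_ s1] := sz i; have /andP[s2 _] := sz i.+1.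
  have k0 : 0 <= (k i)%:R :> R by [].
  have k1 : 0 <= (k i.+1)%:R :> R by [].
  set a := (k i)%:R in s1 k0 *; set c := (k i.+1)%:R in s2 k1 *.
  (* Sizes are converted into lengths by [1/2 <= ln 2 <= 1], which accounts for the factor 1/4 in
     the growth. *)
  have h1 : c * ln 2 <= c by rewrite ler_piMr.
  have h2 : a / 2 <= a * ln 2 by rewrite ler_wpM2l.
  have h3 : (a / 2) ^+ 2 <= pass_size (st i).1 (st i).2 ^+ 2.
    by rewrite lerXn2r ?nnegrE ?divr_ge0 ?expR_ge0//; lra.
  have -> : a ^+ 2 / 4 = (a / 2) ^+ 2 by field.
  lra.
have large i : (16 <= k i)%N.
  elim: i => [|i IH].
    have /andP[s _] := sz 0%N; rewrite -(ler_nat R).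
    have h1 : (k 0%N)%:R * ln 2 <= (k 0%N)%:R :> R by rewrite ler_piMr.
    by move: s; rewrite /=; lra.
  rewrite -(ler_nat R); apply: le_trans (grow i).
  have : 16 <= (k i)%:R :> R by rewrite ler_nat.
  nra.
exists T, k, b0; split => // i j jk.
have [_ _ /(_ j jk)[[x y] /= E [x0 x1 y0 y1 y2]] _ _] := Hst i.
rewrite addnC iterD TE iter_bowen_flip [iter j.+1 _ _]E -/(flip true _) flip_flip.
have x1' : x <= 1.
  by apply: le_trans x1 _; rewrite invf_le1 ?exprn_gt0// exprn_ege1// ler1n.
(* The passage after a crossing flipped by [b] takes place in the box flipped by the negation of
   [b], whose side is [b]. *)
have [-> dxy] := @side_box (b0 (+) odd i (+) true) x y x0 x1' y0 y2.
split; first by rewrite addbT negbK.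
by apply: le_trans dxy _; apply: lerD => //; exact: ltW.
Qed.

Lemma orbit_cesaro v : hexagon v -> v != 0 ->
  n.+1%:R^-1 * (\sum_(j < n.+1) side_dist (iter j bowen v)) @[n --> \oo] --> (0 : R).
Proof.
move=> Vv v0; have [T [k [b0 [h1 h2 h3 h4]]]] := itinerary Vv v0.
apply: (cesaro_pass (d := fun n => side_dist (iter n bowen v)) h1 _ _ h3 h4).
- by move=> i j jk; have [] := h2 i j jk.
- by move=> n; apply: side_dist_bound; exact: iter_bowen_hexagon.
Qed.

Lemma orbit_frequent_side v b (e : R) N : hexagon v -> v != 0 -> 0 < e ->
  exists2 n, (N <= n)%N &
    (1 - e) * n.+1%:R <= \sum_(j < n.+1) (side (iter j bowen v) == b)%:R.
Proof.
move=> Vv v0 e0; have [T [k [b0 [h1 h2 h3 h4]]]] := itinerary Vv v0.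
apply: (frequent_side (b0 := b0) (sd := fun n => side (iter n bowen v)) h1 _ h3 h4) => //.
by move=> i j jk; have [] := h2 i j jk.
Qed.

End Itinerary.

(** * The plane as a Riemannian surface *)

Section AffineCalculus.
Variable R : realType.
Local Notation plane := (R * R)%type.

(** Wherever a derivative is taken, the map in question is affine nearby, so calculus is only
    developed for these functions. *)
Definition affine (a b c : R) (v : plane) : R := a * v.1 + b * v.2 + c.

Lemma derive_affine a b c (y e : plane) :
  derivable (affine a b c) y e /\ 'D_e (affine a b c) y = a * e.1 + b * e.2.
Proof.
have E (h : R) : h != 0 ->
    h^-1 *: (affine a b c (h *: e + y) - affine a b c y) = a * e.1 + b * e.2.
  move=> h0; rewrite /affine /=.
  have -> : a * (h *: e.1 + y.1) + b * (h *: e.2 + y.2) + c - (a * y.1 + b * y.2 + c) =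
    h * (a * e.1 + b * e.2) by rewrite /GRing.scale /=; ring.
  by rewrite /GRing.scale /= mulKf.
have C : h^-1 *: (affine a b c (h *: e + y) - affine a b c y) @[h --> 0^'] -->
    a * e.1 + b * e.2.
  apply/cvgrPdist_lt => eps eps0; near=> h.
  rewrite E ?subrr ?normr0//; near: h; exact: nbhs_dnbhs_neq.
split; first by apply/cvg_ex; exists (a * e.1 + b * e.2).
exact: cvg_lim C.
Unshelve. all: by end_near. Qed.

Lemma Ck_affine k U a b c : Ck k U (affine a b c).
Proof.
elim: k a b c => [|k IH] a b c /=.
  by move=> y _; apply: lip_continuous; rewrite /affine; lip.
move=> i; split; first by move=> y _; have [] := derive_affine a b c y (basis_vector R i).
set e := basis_vector R i.
have -> : (fun y => 'D_e (affine a b c) y) = affine 0 0 (a * e.1 + b * e.2).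
  apply/funext => y; have [_ ->] := derive_affine a b c y e.
  by rewrite /affine !mul0r !add0r.
exact: IH.
Qed.

Lemma coord0E : coord ord0 = affine 1 0 0 :> (plane -> R).
Proof. by apply/funext => v; rewrite /coord /affine eqxx mul1r mul0r !addr0. Qed.

Lemma coord1E : coord (lift ord0 ord0) = affine 0 1 0 :> (plane -> R).
Proof. by apply/funext => v; rewrite /coord /affine /= mul1r mul0r add0r addr0. Qed.

Lemma ord2P (P : 'I_2 -> Prop) : P ord0 -> P (lift ord0 ord0) -> forall a, P a.
Proof.
by move=> P0 P1 a; case: (unliftP ord0 a) => [j|] ->//; rewrite (ord1 j).
Qed.

Lemma Ck_map_id k U : Ck_map k U (id : plane -> plane).
Proof.
by apply: ord2P; rewrite [_ \o _]/= ?coord0E ?coord1E; exact: Ck_affine.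
Qed.

Lemma jacobian_id (y : plane) : jacobian_mx id y = 1%:M.
Proof.
apply/matrixP => a b; rewrite !mxE.
move: a; apply: ord2P; rewrite [_ \o _]/= ?coord0E ?coord1E;
  rewrite (derive_affine _ _ _ y _).2; move: b; apply: ord2P => /=;
  by rewrite ?mulr1 ?mulr0 ?mul0r ?addr0 ?add0r.
Qed.

Lemma posdef1 : posdef (1%:M : 'M[R]_2).
Proof.
split=> [|v v0]; first exact: trmx1.
rewrite mulmx1 !mxE big_ord_recl big_ord1 !mxE -!expr2.
rewrite lt_neqAle addr_ge0 ?sqr_ge0// andbT eq_sym paddr_eq0 ?sqr_ge0// !sqrf_eq0.
apply: contra v0 => /andP[/eqP v0 /eqP v1]; apply/eqP/matrixP => i j.
rewrite (ord1 j) mxE; move: i; apply: ord2P => //.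
Qed.

End AffineCalculus.

Section PlaneSurface.
Variable R : realType.
Local Notation plane := (R * R)%type.

Let dom (_ : unit) : set plane := setT.
Let chart (_ : unit) (v : plane) : R * R := v.
Let metric (_ : unit) (_ : R * R) : 'M[R]_2 := 1%:M.

Let chart_image i : chart i @` dom i = setT.
Proof. exact: image_id. Qed.

Let plane_dom_open i : open (dom i).
Proof. exact: openT. Qed.

Let plane_dom_cover (p : plane) : exists i, dom i p.
Proof. by exists tt. Qed.

Let plane_chart_open i : open (chart i @` dom i).
Proof. by rewrite chart_image; exact: openT. Qed.

Let plane_chart_homeo i : homeo_between (chart i) (chart i) (dom i) (chart i @` dom i).
Proof.
have cid : {within setT, continuous (id : plane -> plane)}.
  by apply: continuous_subspaceT => v; exact: cvg_id.
by rewrite chart_image; split=> //; exact: image_id.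
Qed.

Let plane_transition i j k :
  Ck_map k (chart i @` (dom i `&` dom j)) (chart j \o chart i).
Proof. exact: Ck_map_id. Qed.

Let plane_metric_posdef i y : (chart i @` dom i) y -> posdef (metric i y).
Proof. by move=> _; exact: posdef1. Qed.

Let plane_metric_smooth i k (a b : 'I_2) : Ck k (chart i @` dom i) (fun y => metric i y a b).
Proof.
have -> : (fun y => metric i y a b) = affine 0 0 (metric i 0 a b).
  by apply/funext => y; rewrite /affine /metric !mul0r !add0r.
exact: Ck_affine.
Qed.

Let plane_metric_compat i j (p : plane) : dom i p -> dom j p ->
  let J := jacobian_mx (chart j \o chart i) (chart i p) in
  metric i (chart i p) = J^T *m metric j (chart j p) *m J.
Proof.
move=> _ _ /=; have -> : chart j \o chart i = id by [].
by rewrite jacobian_id /metric trmx1 !mulmx1.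
Qed.

Let plane_volE i (A : set (borel plane)) : measurable A -> A `<=` dom i ->
  vol_plane A = (\int[@plane_lebesgue R]_(y in chart i @` A)
              (Num.sqrt (\det (metric i y)))%:E)%E.
Proof.
move=> mA _; rewrite /metric det1 sqrtr1.
have -> : chart i @` A = A by exact: image_id.
rewrite (@integral_cst _ _ _ (lebesgue_measure \x lebesgue_measure)%E) ?mul1e//.
exact: borel_measurable_plane.
Qed.

Definition plane_surface : riemannian_surface R :=
  @RiemannianSurface R plane (@plane_hausdorff R) (@plane_second_countable R) unit
    dom chart chart metric (@vol_plane R) plane_dom_open plane_dom_cover
    plane_chart_open plane_chart_homeo plane_transition plane_metric_posdef
    plane_metric_smooth plane_metric_compat plane_volE.

End PlaneSurface.

(** * Stable and unstable manifolds *)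

Section Separatrices.
Variable R : realType.
Local Notation plane := (R * R)%type.
Implicit Types (v : plane) (r : R) (b : bool).

(* The stable curve of saddle1; its half [0, +oo[ runs along the boundary of
   the hexagon to saddle2, which it does not reach. *)
Definition arc r : plane :=
  (Num.max (1 - r) (- 1), 2 / Num.max r 2 - 1 + Num.min 1 (2 - Num.min r 2)).

(** Left inverse of [arc] on [0, +oo[: on the first two pieces the quotient is 2 and leaves [1 - X];
    on the last one [X = -1] and the quotient is the parameter. *)
Definition arc_param v : R := - 1 - v.1 + 2 / (1 + Num.min v.2 0).

Lemma arc1 r : r <= 1 -> arc r = (1 - r, 1).
Proof.
move=> h; rewrite /arc max_l; last by lra.
rewrite (@max_r _ _ r); last by lra.
rewrite (@min_l _ _ r); last by lra.
by rewrite min_l; [congr pair; field|lra].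
Qed.

Lemma arc2 r : 1 <= r -> r <= 2 -> arc r = (1 - r, 2 - r).
Proof.
move=> h h'; rewrite /arc max_l; last by lra.
rewrite (@max_r _ _ r)// (@min_l _ _ r)// min_r; last by lra.
by congr pair; field.
Qed.

Lemma arc3 r : 2 <= r -> arc r = (- 1, 2 / r - 1).
Proof.
move=> h; rewrite /arc max_r; last by lra.
rewrite (@max_l _ _ r)// (@min_r _ _ r)// min_r; last by lra.
by rewrite subrr addr0.
Qed.

Variant arc_spec r : plane -> Prop :=
| Arc1 of r <= 1 : arc_spec r (1 - r, 1)
| Arc2 of 1 <= r & r <= 2 : arc_spec r (1 - r, 2 - r)
| Arc3 of 2 <= r : arc_spec r (- 1, 2 / r - 1).

Lemma arcP r : arc_spec r (arc r).
Proof.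
have [h|/ltW h] := lerP r 1; first by rewrite arc1//; apply: Arc1.
have [h'|/ltW h'] := lerP r 2; first by rewrite arc2//; apply: Arc2.
by rewrite arc3//; apply: Arc3.
Qed.

Lemma arc0 : arc 0 = saddle1 R.
Proof. by rewrite arc1// subr0. Qed.

Lemma continuous_arc : continuous arc.
Proof.
move=> r; apply: lip_continuous; rewrite /arc.
have l (V : normedModType R) : lipschitz_at (fun z : R => z) r by exact: lip_id.
by lip; rewrite ?gt_eqF ?lt_max ?ltr0n ?orbT//; exact: lip_id.
Qed.

Lemma arc_paramK r : 0 <= r -> arc_param (arc r) = r.
Proof.
move=> r0; rewrite /arc_param; case: arcP => [h|h h'|h] /=.
- by rewrite min_r; [rewrite addr0 divr1; lra|lra].
- by rewrite min_r; [rewrite addr0 divr1; lra|lra].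
- have r1 : 0 < r by lra.
  have d : 2 / r <= 1 by rewrite ler_pdivrMr//; lra.
  rewrite min_l; last by lra.
  have -> : 1 + (2 / r - 1) = 2 / r by ring.
  by field; rewrite gt_eqF.
Qed.

Lemma arc_inj : injective arc.
Proof.
have E r : r <= 1 -> arc r = (1 - r, 1) by exact: arc1.
have neg r s : r < 0 -> arc r = arc s -> r = s.
  move=> r0; rewrite E; last by lra.
  by case: (arcP s) => [h [hs]|h h' [hs _]|h [hs _]]; lra.
move=> r s; have [r0|r0] := ltrP r 0; first exact: neg.
have [s0|s0] := ltrP s 0; first by move=> /esym /neg ->.
by move=> rs; rewrite -[r]arc_paramK// rs arc_paramK.
Qed.

(** The action of [bowen] on the parameter of [arc], a contraction towards 0. In the middle case a
    point of the last piece of the arc is sent to the slanted one. *)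
Definition arc_step r := if r <= 2 then r / 2 else if r <= 4 then 3 - 4 / r else r / 2.
Definition arc_back r := if r <= 1 then 2 * r else if r <= 2 then 4 / (3 - r) else 2 * r.

Lemma arc_step_back r : arc_step (arc_back r) = r.
Proof.
rewrite /arc_back /arc_step; have [h|h] := lerP r 1.
  by rewrite ifT; [field|lra].
have [h'|h'] := lerP r 2; last first.
  by rewrite ifF ?ifF; [field|apply/negbTE; rewrite -ltNge; lra..].
have d0 : 0 < 3 - r by lra.
rewrite ifF; last by apply/negbTE; rewrite -ltNge ltr_pdivlMr//; lra.
rewrite ifT; last by rewrite ler_pdivrMr//; lra.
by field; rewrite gt_eqF.
Qed.

Lemma arc_step_norm r : `|arc_step r| <= 3 / 4 * `|r|.
Proof.
have half z : `|z / 2| <= 3 / 4 * `|z : R|.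
  by rewrite normrM (@ger0_norm _ 2^-1)//; have := normr_ge0 z; lra.
rewrite /arc_step; have [//|h] := lerP r 2; have [h'|//] := lerP r 4.
have r0 : 0 < r by lra.
have d1 : 4 / r <= 2 by rewrite ler_pdivrMr//; lra.
rewrite (gtr0_norm r0) ger0_norm; last by lra.
rewrite lerBlDr -lerBlDl ler_pdivlMr//.
have : 0 <= (3 * r - 6) ^+ 2 by exact: sqr_ge0.
by nra.
Qed.

Lemma iter_arc_step_cvg0 r : iter n arc_step r @[n --> \oo] --> (0 : R).
Proof.
have b n : `|iter n arc_step r| <= `|r| * (3 / 4) ^+ n.
  elim: n => [|n IH]; first by rewrite expr0 mulr1.
  rewrite iterS exprS mulrCA; apply: le_trans (arc_step_norm _) _.
  by rewrite ler_pM2l//; lra.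
apply: norm_cvg0.
apply: (@squeeze_cvgr _ _ _ _ (fun=> 0) (fun n => `|r| * (3 / 4) ^+ n)).
- by near=> n; rewrite normr_ge0 b.
- exact: cvg_cst.
- by apply: cvg_geometric; rewrite ger0_norm; lra.
Unshelve. all: by end_near. Qed.

Lemma rot_arc r : rot (arc r) = arc (arc_step r).
Proof.
rewrite /arc_step; case: (arcP r) => [h|h h'|h].
- rewrite ifT; last by lra.
  by rewrite rot_box; [rewrite arc1; [congr pair; field|lra]|lra|lra].
- rewrite h'.
  have -> : (1 - r, 2 - r) = antipode (r - 1, r - 2) by rewrite /antipode /=; congr pair; ring.
  rewrite rot_antipode rot_entry; [|lra|lra].
  have -> : r - 1 - (r - 2) = 1 by ring.
  have -> : speed (1 : R) = 2 by rewrite /speed max_r//; lra.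
  have h1 : 0 <= - (r - 2) / 2 by lra.
  have h2 : - (r - 2) / 2 <= 2^-1 by lra.
  have h3 : - (r - 2) / 2 <= 1 by lra.
  have -> : ilevel (- (r - 2) / 2) 1 = 1.
    by case: (ilevelP h1 h2 h3) => [|*|_]; [lra|lra|rewrite subrr mul0r subr0].
  by rewrite arc1; [rewrite /antipode /=; congr pair; field|lra].
- have r0 : 0 < r by lra.
  have d0 : 0 < 2 / r by rewrite divr_gt0.
  have d1 : 2 / r <= 1 by rewrite ler_pdivrMr//; lra.
  have -> : (- 1, 2 / r - 1) = antipode (1, 1 - 2 / r) by rewrite /antipode /=; congr pair; ring.
  rewrite rot_antipode.
  have [h4|h4] := lerP 4 r.
    have d2 : 2 / r <= 2^-1 by rewrite ler_pdivrMr//; lra.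
    rewrite rot_box; [|lra|lra].
    have -> : (if r <= 2 then r / 2 else if r <= 4 then 3 - 4 / r else r / 2) = r / 2.
      case: ifPn => // _; case: ifPn => // h5; have -> : r = 4 by lra.
      by field.
    rewrite arc3; last by lra.
    by rewrite /antipode /=; congr pair; field; rewrite ?gt_eqF.
  have d2 : 2^-1 <= 2 / r by rewrite ler_pdivlMr//; lra.
  rewrite rot_exit; [|lra|lra|lra].
  rewrite level_out; [|lra|lra|by left; lra].
  have -> : 1 + (1 - 2 / r) - 1 * (1 - 2 / r) = 1 by ring.
  have -> : speed (1 : R) = 2 by rewrite /speed max_r//; lra.
  have -> : (if r <= 2 then r / 2 else if r <= 4 then 3 - 4 / r else r / 2) = 3 - 4 / r.
    case: ifPn => [h5|_]; last by rewrite ifT//; exact: ltW.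
    by have -> : r = 2 by [lra]; field.
  have e : 4 / r = 2 * (2 / r) by field; rewrite gt_eqF.
  rewrite arc2; [|lra|lra].
  by rewrite /antipode /=; congr pair; lra.
Qed.

Lemma arc_line r : boundary_line (arc r) \/ boundary_line (antipode (arc r)).
Proof.
case: arcP => [h|h h'|h]; first by left; constructor 2.
- by right; constructor 3 => /=; ring.
- by right; constructor 1 => /=; rewrite opprK.
Qed.

Lemma arc_norm1 r : 3 / 4 <= norm1 (arc r).
Proof.
have A (x : R) : x <= `|x| by exact: ler_norm.
have B (x : R) : - x <= `|x| by rewrite -normrN; exact: ler_norm.
rewrite /norm1; case: arcP => [h|h h'|h] /=.
- by have := A 1; have := normr_ge0 (1 - r); lra.
- by have := B (1 - r); have := A (2 - r); lra.
- by have := B (-1); have := normr_ge0 (2 / r - 1); lra.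
Qed.

Lemma bowen_arc r : bowen (arc r) = arc (arc_step r).
Proof.
rewrite /bowen rot_arc radial_push_far ?arc_norm1//.
by rewrite edge_fix_lines ?kap_push0//; exact: arc_line.
Qed.

Lemma radial_pull_far v : 3 / 4 <= norm1 v -> radial_pull v = v.
Proof. by move=> h; rewrite /radial_pull pull_factor_far// scale1. Qed.

Lemma bowen_inv_swap_arc r : bowen_inv (swap (arc r)) = swap (arc (arc_step r)).
Proof.
have L : boundary_line (swap (arc r)) \/ boundary_line (antipode (swap (arc r))).
  have [[h|h|h]|[h|h|h]] := arc_line r.
  - by left; constructor 2.
  - by left; constructor 1.
  - by right; constructor 3; move: h => /=; lra.
  - by right; constructor 2; move: h => /=; lra.
  - by right; constructor 1; move: h => /=; lra.
  - by left; constructor 3; move: h => /=; lra.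
rewrite /bowen_inv edge_fix_lines ?kap_pull0// radial_pull_far.
  by rewrite /irot swapK rot_arc.
by rewrite /norm1 /= addrC; exact: arc_norm1.
Qed.

End Separatrices.

Section StableManifolds.
Variable R : realType.
Local Notation plane := (R * R)%type.
Local Notation M := (plane_surface R).
Implicit Types (v : plane) (r : R) (b sw : bool).

(** Reduction to a local statement: a convergent orbit eventually stays in [U], so some iterate lies
    on the curve, and the inverse map, which preserves the curve, leads back to the starting
    point. *)
Lemma stable_set_range (T : topologicalType) (h hinv : T -> T) (c : R -> T) (U : set T) :
  cancel h hinv -> (forall r, h (c r) = c (arc_step r)) -> continuous c ->
  nbhs (c 0) U -> (forall z, (forall n, U (iter n h z)) -> range c z) ->
  [set y | iter n h y @[n --> \oo] --> c 0] = range c.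
Proof.
move=> hK hc cc U0 locU; rewrite eqEsubset; split => [y yc|_ [r _ <-]] /=.
  have [N _ HN] := yc _ U0.
  have /locU[r _ rE] : forall n, U (iter n h (iter N h y)).
    by move=> n; rewrite -iterD; apply: HN => /=; exact: leq_addl.
  have hic s : hinv (c s) = c (arc_back s) by rewrite -{1}(arc_step_back s) -hc hK.
  have it m s : iter m hinv (c s) = c (iter m (@arc_back R) s).
    by elim: m => //= m ->; rewrite hic.
  have hKn m z : iter m hinv (iter m h z) = z.
    by elim: m z => // m IH z; rewrite iterSr [X in hinv X]iterS hK.
  by exists (iter N (@arc_back R) r) => //; rewrite -it rE hKn.
have it n : iter n h (c r) = c (iter n (@arc_step R) r).
  by elim: n => //= n ->; rewrite hc.
under eq_fun do rewrite it.
by apply: continuous_cvg; [exact: cc|exact: iter_arc_step_cvg0].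
Qed.

(** [b] selects the saddle. [sw] turns stable curves into unstable ones: reflection in the diagonal
    reverses [rot], and both pushes are trivial on the boundary lines that carry the curves. *)
Definition place b sw v : plane := flip b (if sw then swap v else v).

Lemma placeK b sw : involutive (place b sw).
Proof. by case: b; case: sw => -[x y]; rewrite /place /flip /swap /antipode /= ?opprK. Qed.

Lemma continuous_place b sw : continuous (place b sw).
Proof.
move=> v; apply: lip_continuous; case: b; case: sw; rewrite /place /flip.
- by apply: lip_comp; [exact: lip_antipode|exact: lip_swap].
- exact: lip_antipode.
- exact: lip_swap.
- exact: lip_id.
Qed.

Definition separatrix b sw r : plane := place b sw (arc r).

Lemma continuous_separatrix b sw : continuous (separatrix b sw).
Proof.
move=> r; apply: (@continuous_comp _ _ _ (@arc R) (place b sw)).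
  exact: continuous_arc.
exact: continuous_place.
Qed.

Lemma separatrix_inj b sw : injective (separatrix b sw).
Proof. by move=> r s /(can_inj (placeK b sw)) /arc_inj. Qed.

Lemma bowen_separatrix b r : bowen (separatrix b false r) = separatrix b false (arc_step r).
Proof. by case: b; rewrite /separatrix /place /= ?bowen_antipode bowen_arc. Qed.

Lemma bowen_inv_separatrix b r :
  bowen_inv (separatrix b true r) = separatrix b true (arc_step r).
Proof. by case: b; rewrite /separatrix /place /= ?bowen_inv_antipode bowen_inv_swap_arc. Qed.

Lemma doubling_bounded (x : R) (C : R) : (forall n, `|2 ^+ n * x| < C) -> x = 0.
Proof.
move=> xC; apply/eqP; rewrite -normr_eq0; apply/negPn/negP => x0.
have x1 : 0 < `|x| by rewrite lt_neqAle eq_sym x0 normr_ge0.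
have C0 : 0 < C by apply: le_lt_trans (xC 0%N).
have e0 : 0 < `|x| / C by rewrite divr_gt0.
have [n _ /(_ n (leqnn n)) /= h] := near_infty_natSinv_expn_lt (PosNum e0).
have := xC n; rewrite normrM ger0_norm ?exprn_ge0//.
move: h; rewrite ltr_pdivrMr ?exprn_gt0// mulrAC ltr_pdivlMr// mul1r (mulrC `|x|).
lra.
Qed.

Let near_saddle b : set plane := flip b @^-1` ball (saddle1 R) (4^-1 : R).

Let nbhs_near_saddle b sw : nbhs (separatrix b sw 0) (near_saddle b).
Proof.
have s : flip b (separatrix b sw 0) = saddle1 R.
  by rewrite /separatrix arc0 /place flipK; case: sw.
have E : flip b = place b false by [].
rewrite /near_saddle E; apply: continuous_place; rewrite -E s.
exact: nbhsx_ballx.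
Qed.

Let near_saddle_bounds v : ball (saddle1 R) (4^-1 : R) v ->
  [/\ `|1 - v.1| < 4^-1, `|1 - v.2| < 4^-1, 3 / 4 < v.1 < 5 / 4 & 3 / 4 < v.2 < 5 / 4].
Proof.
rewrite plane_ballE => -[]; rewrite -!ball_normE /= => h1 h2; split => //.
- by move: h1; rewrite ltr_norml => /andP[? ?]; apply/andP; split; lra.
- by move: h2; rewrite ltr_norml => /andP[? ?]; apply/andP; split; lra.
Qed.

Lemma stable_set_bowen b : [set y | iter n (@bowen R) y @[n --> \oo] -->
  separatrix b false 0] = range (separatrix b false).
Proof.
apply: (@stable_set_range _ (@bowen R) (@bowen_inv R) (separatrix b false)
  (near_saddle b) (@bowenK R) (bowen_separatrix b) (@continuous_separatrix b false)
  (@nbhs_near_saddle b false)) => v vU.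
have {vU} wU n : ball (saddle1 R) (4^-1 : R) (iter n (@bowen R) (flip b v)).
  by rewrite iter_bowen_flip; exact: vU.
set w := flip b v in wU.
(* Near the saddle [1 - Y] doubles at every step, so an orbit that never leaves has [Y = 1]. *)
have it n : 1 - (iter n (@bowen R) w).2 = 2 ^+ n * (1 - w.2).
  elim: n => [|n IH]; first by rewrite mul1r.
  rewrite exprS -mulrA -IH iterS; have [_ _ b1 b2] := near_saddle_bounds (wU n).
  case: (iter n _ _) b1 b2 => X Y /= b1 b2; rewrite bowen_box/=; lra.
have w2 : 1 - w.2 = 0.
  apply: (@doubling_bounded _ 4^-1) => n; rewrite -it.
  by have [_ + _ _] := near_saddle_bounds (wU n).
have [_ _ b1 _] := near_saddle_bounds (wU 0%N).
exists (1 - w.1) => //; rewrite /separatrix /place -[RHS](flipK b) -/w; congr flip.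
move: b1 w2; case: (w) => X Y /= b1 b2; rewrite arc1; last by lra.
by congr pair; lra.
Qed.

Lemma stable_set_bowen_inv b : [set y | iter n (@bowen_inv R) y @[n --> \oo] -->
  separatrix b true 0] = range (separatrix b true).
Proof.
apply: (@stable_set_range _ (@bowen_inv R) (@bowen R) (separatrix b true)
  (near_saddle b) (@bowen_invK R) (bowen_inv_separatrix b) (@continuous_separatrix b true)
  (@nbhs_near_saddle b true)) => v vU.
have itf n : iter n (@bowen_inv R) (flip b v) = flip b (iter n (@bowen_inv R) v).
  by case: (b) => //=; elim: n => //= n ->; rewrite bowen_inv_antipode.
have {vU} wU n : ball (saddle1 R) (4^-1 : R) (iter n (@bowen_inv R) (flip b v)).
  by rewrite itf; exact: vU.
set w := flip b v in wU.
have it n : 1 - (iter n (@bowen_inv R) w).1 = 2 ^+ n * (1 - w.1).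
  elim: n => [|n IH]; first by rewrite mul1r.
  rewrite exprS -mulrA -IH iterS; have [_ _ b1 b2] := near_saddle_bounds (wU n).
  case: (iter n _ _) b1 b2 => X Y b1 b2.
  rewrite /= in b1 b2; rewrite bowen_inv_box; rewrite /=; lra.
have w2 : 1 - w.1 = 0.
  apply: (@doubling_bounded _ 4^-1) => n; rewrite -it.
  by have [+ _ _ _] := near_saddle_bounds (wU n).
have [_ _ _ b1] := near_saddle_bounds (wU 0%N).
exists (1 - w.2) => //; rewrite /separatrix /place -[RHS](flipK b) -/w; congr flip.
move: b1 w2; case: (w) => X Y /= b1 b2; rewrite arc1; last by lra.
by rewrite /swap /=; congr pair; lra.
Qed.

Lemma derive1_near_affine (u : R -> R) (t al be : R) :
  (\forall z \near t, u z = al + be * z) -> derivable u t 1 /\ derive1 u t = be.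
Proof.
move=> uE; have ut := nbhs_singleton uE.
have C : h^-1 *: (u (h *: 1 + t) - u t) @[h --> 0^'] --> be.
  apply/cvgrPdist_lt => eps eps0; near=> h.
  have h0 : h != 0 by near: h; exact: nbhs_dnbhs_neq.
  have -> : u (h *: 1 + t) = al + be * (h *: 1 + t).
    near: h; apply: nbhs_dnbhs.
    have c : (fun h : R => h *: 1 + t) @ (0 : R) --> t.
      have -> : (fun h : R => h *: 1 + t) = (fun h : R => h + t).
        by apply/funext => z; rewrite /GRing.scale /= mulr1.
      rewrite -[X in _ --> X]add0r.
      exact: (lip_continuous (lipD (@lip_id R R 0) (@lip_cst R R R t 0))).
    exact: (c _ uE).
  rewrite ut; have -> : al + be * (h *: 1 + t) - (al + be * t) = h * be.
    by rewrite /GRing.scale /=; ring.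
  by rewrite /GRing.scale /= mulKf// subrr normr0.
split; first by apply/cvg_ex; exists be.
by rewrite derive1E; exact: cvg_lim C.
Unshelve. all: by end_near. Qed.

Lemma separatrix_half_branch b sw : half_branch (M := M)
  (range (separatrix b sw)) (separatrix b sw 0) (separatrix b sw @` `[0, +oo[).
Proof.
exists (separatrix b sw); split; [split => //|split].
- exact: continuous_separatrix.
- exact: separatrix_inj.
- exists (fun v => arc_param (place b sw v)).
  have K r : `[0, +oo[%classic r -> arc_param (place b sw (separatrix b sw r)) = r.
    by rewrite /= in_itv /= andbT => r0; rewrite /separatrix placeK arc_paramK.
  split => //.
  + by apply: continuous_subspaceT; exact: continuous_separatrix.
  + apply: continuous_in_subspaceT => v; rewrite inE => -[r].
    rewrite /= in_itv /= andbT => r0 <-.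
    apply: (@continuous_comp _ _ _ (place b sw) (@arc_param R)); first exact: continuous_place.
    rewrite /separatrix placeK; apply: lip_continuous; rewrite /arc_param; lip.
    rewrite gt_eqF//; case: arcP => [h|h h'|h] /=.
    * by rewrite min_r//; lra.
    * by rewrite min_r//; lra.
    * have d0 : 0 < 2 / r by rewrite divr_gt0//; lra.
      by rewrite -ltrBlDl sub0r lt_min; apply/andP; split; lra.
  + rewrite eqEsubset; split=> [_ [_ [r r0 <-] <-]|r r0]; first by rewrite K.
    by exists (separatrix b sw r); [exists r|exact: K].
(* The curve is affine for parameters below 1, hence the radius 1. *)
- exists 1 => // t; rewrite /= in_itv /= => /andP[_ t1] _ _.
  pose al (a : 'I_2) : R := if b then -1 else 1.
  pose be (a : 'I_2) : R := if (a == ord0) (+) sw then (if b then 1 else -1) else 0.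
  have uE a z : z < 1 -> (coord a \o (fun v : plane => v) \o separatrix b sw) z =
      al a + be a * z.
    move=> z1; rewrite /comp /separatrix arc1; last exact: ltW.
    rewrite /al /be /coord /place; move: a; apply: ord2P => /=; case: (b); case: (sw) => /=; lra.
  have near_lt (z : R) : z < 1 -> \forall y \near z, y < 1.
    by move=> z1; apply: (@open_nbhs_nbhs _ z [set y | y < 1]); split => //; exact: open_lt.
  have D a z : z < 1 -> derivable (coord a \o (fun v : plane => v) \o separatrix b sw) z 1 /\
      derive1 (coord a \o (fun v : plane => v) \o separatrix b sw) z = be a.
    move=> z1; apply: (@derive1_near_affine _ _ (al a)).
    by near=> y; apply: uE; near: y; exact: near_lt.
  split=> [a|].
    split; first by have [] := D a t t1.
    have [_ Dt] := D a t t1.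
    apply/cvgrPdist_lt => eps eps0; near=> y.
    have [|_ Dy] := D a y; first by near: y; exact: near_lt.
    by rewrite Dt Dy subrr normr0.
  have h a : derive1 (coord a \o (fun v : plane => v) \o separatrix b sw) t = be a.
    by have [] := D a t t1.
  exists (if sw then lift ord0 ord0 else ord0); rewrite [derive1 _ _]h /be.
  by case: (sw); case: (b); rewrite /= ?oppr_eq0 oner_eq0.
Unshelve. all: by end_near. Qed.

End StableManifolds.

(** * Weak* limits of the empirical measures *)

Section WeakStarLimits.
Variables (R : realType) (M : ptopologicalType).
Implicit Types (mu nu : probability (borel M) R) (phi : bounded_continuous R M).

Lemma continuous_integrate phi : continuous (fun nu : weakstar R M => integrate nu phi : R).
Proof.
move=> mu; apply: (@continuous_comp _ _ _ (@integrate R M : weakstar R M -> _)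
  (@proj _ (fun=> R : topologicalType) phi)).
  exact: initial_continuous.
exact: proj_continuous.
Qed.

Lemma weakstar_cvgP (F : set_system (probability (borel M) R)) mu : Filter F ->
  (F --> (mu : weakstar R M)) <->
  forall phi, (integrate nu phi : R) @[nu --> F] --> (integrate mu phi : R).
Proof.
move=> FF; split=> [Fmu phi|Fphi].
  exact: cvg_trans (cvg_app _ Fmu) (@continuous_integrate phi mu).
have H : (@integrate R M) @ F --> integrate mu.
  apply/cvg_sup => phi A /= [_ [[B Bop <-] Bmu] sBA].
  apply: filterS sBA _; apply: (Fphi phi); exact: open_nbhs_nbhs.
move=> A /= [_ [[B Bop <-] Bmu] sBA].
apply: filterS sBA _; apply: H; exact: open_nbhs_nbhs.
Qed.

Lemma weakstar_seqP (u : nat -> probability (borel M) R) mu :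
  (u j : weakstar R M) @[j --> \oo] --> (mu : weakstar R M) <->
  forall phi, (integrate (u j) phi : R) @[j --> \oo] --> (integrate mu phi : R).
Proof.
have FF : Filter (u @ \oo) by exact: fmap_filter.
have P := @weakstar_cvgP (u @ \oo) mu FF.
split=> [h phi|h]; first by have := P.1 h phi.
by apply/P => phi; exact: (h phi).
Qed.

(** Covers both the empirical measures and the points of the segment. *)
Lemma integrate_dirac_sum mu (m : nat) (c : nat -> {nonneg R}) (y : nat -> M) phi :
  (forall A : set (borel M), measurable A ->
    mu A = (\sum_(i < m) (c i)%:num%:E * \d_(y i : borel M) A)%E) ->
  integrate mu phi = \sum_(i < m) (c i)%:num * sval phi (y i).
Proof.
move=> muE; case: phi => phi [cphi bphi] /=.
have mphi : measurable_fun setT (phi : borel M -> R) by exact: continuous_borel_measurable.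
have mE : measurable_fun setT (EFin \o (phi : borel M -> R)) by exact/measurable_EFinP.
rewrite /integrate /Rintegral /=.
have pos (f : borel M -> \bar R) : measurable_fun setT f -> (forall x, (0 <= f x)%E) ->
    (\int[mu]_x f x = \sum_(i < m) (c i)%:num%:E * f (y i))%E.
  move=> mf f0.
  rewrite (@eq_measure_integral _ _ _ _
    (msum (fun i => mscale (c i) (dirac (y i : borel M))) m)); last first.
    by move=> A mA _; apply: etrans (muE A mA) _.
  rewrite ge0_integral_measure_sum//; apply: eq_bigr => i _.
  by rewrite ge0_integral_mscale// integral_dirac// diracT mul1e.
rewrite integralE !pos; [|exact: measurable_funeneg|by move=>?; exact: funeneg_ge0
  |exact: measurable_funepos|by move=>?; exact: funepos_ge0].
rewrite (eq_bigr (fun i : 'I_m => ((c i)%:num * Num.max (phi (y i)) 0)%:E)); last first.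
  by move=> i _; rewrite EFinM EFin_max funeposE.
rewrite [X in (_ - X)%E](eq_bigr (fun i : 'I_m => ((c i)%:num * Num.max (- phi (y i)) 0)%:E)); last first.
  by move=> i _; rewrite EFinM EFin_max funenegE.
rewrite !sumEFin -EFinB /= -sumrB; apply: eq_bigr => i _.
rewrite -mulrBr; congr (_ * _).
by case: (lerP 0 (phi (y i))) => h; case: (lerP 0 (- phi (y i))) => h'; lra.
Qed.

Lemma integrate_empirical (f : M -> M) x n phi :
  integrate (empirical R f x n) phi =
  n.+1%:R^-1 * \sum_(j < n.+1) sval phi (iter j f x).
Proof.
rewrite (@integrate_dirac_sum _ n.+1 (fun=> (n.+1%:R^-1)%:nng) (fun j => iter j f x)).
  by rewrite mulr_sumr.
move=> A mA; exact: (@ge0_sume_distrr _ _ _ _ _ (fun j : 'I_n.+1 => \d_(iter j f x : borel M) A)%E).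
Qed.

Lemma integrate_dirac_segment mu (x1 x2 : M) (t : R) phi : 0 <= t <= 1 ->
  (forall A : set (borel M), measurable A ->
     mu A = (t%:E * \d_(x1 : borel M) A + (1 - t)%:E * \d_(x2 : borel M) A)%E) ->
  integrate mu phi = t * sval phi x1 + (1 - t) * sval phi x2.
Proof.
move=> /andP[t0 t1] muE.
have t1' : 0 <= 1 - t by lra.
rewrite (@integrate_dirac_sum _ 2 (fun i => if i == 0%N then NngNum t0 else NngNum t1')
  (fun i => if i == 0%N then x1 else x2)).
  by rewrite big_ord_recl big_ord1.
by move=> A mA; rewrite big_ord_recl big_ord1 muE.
Qed.

End WeakStarLimits.

Lemma plane_ballP (R : realType) (v w : R * R) (e : R) : ball v e w <-> `|v - w| < e.
Proof.
rewrite plane_ballE plane_norm gt_max /=; split=> [[h1 h2]|/andP[h1 h2]].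
  by apply/andP; split.
by split.
Qed.

(** * Limit points of slowly varying sequences *)

Section SlowlyVarying.
Variable R : realType.
Implicit Types (r : nat -> R) (t e : R).

(** Discrete intermediate values: start at a late time below [t + e / 2], when increments are
    already below [e]; the first time from there on with a value above [t - e] cannot overshoot. *)
Lemma slowly_varying_hits r t : r n.+1 - r n @[n --> \oo] --> 0 ->
  (forall e N, 0 < e -> exists2 n, (N <= n)%N & r n <= t + e) ->
  (forall e N, 0 < e -> exists2 n, (N <= n)%N & t - e <= r n) ->
  forall e N, 0 < e -> exists2 n, (N <= n)%N & `|t - r n| < e.
Proof.
move=> rd lo hi e N e0.
have /cvgrPdist_lt/(_ e e0)[N1 _ small] := rd.
have [n0 Nn0 rn0] := lo (e / 2) (maxn N N1) ltac:(lra).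
move: Nn0; rewrite geq_max => /andP[Nn0 N1n0].
have ex : exists n, (n0 <= n)%N && (t - e < r n).
  by have [n n0n rn] := hi (e / 2) n0 ltac:(lra); exists n; rewrite n0n; lra.
case: (ex_minnP ex) => n /andP[n0n rn] nmin; exists n; first exact: leq_trans n0n.
suff : r n < t + e by move=> ?; rewrite ltr_norml; lra.
move: n0n; rewrite leq_eqVlt => /predU1P[<-|]; first lra.
case: n rn nmin => // n rn nmin n0n.
have := small n; rewrite /= sub0r normrN => /(_ (leq_trans N1n0 n0n)).
rewrite ltr_norml => /andP[_ d].
suff : r n <= t - e by lra.
rewrite leNgt; apply/negP => h; move: (nmin n); rewrite h andbT -ltnS n0n => /(_ isT).
by rewrite ltnn.
Qed.

Lemma subsequence_to r t :
  (forall e N, 0 < e -> exists2 n, (N <= n)%N & `|t - r n| < e) ->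
  exists2 k : nat -> nat, {homo k : a b / (a < b)%N} & r (k j) @[j --> \oo] --> t.
Proof.
move=> hits.
have /choice[F FP] : forall p : nat * nat, exists n,
    (p.2 <= n)%N /\ `|t - r n| < p.1.+1%:R^-1.
  by move=> [m N]; have [|n Nn d] := hits m.+1%:R^-1 N; [rewrite invr_gt0|exists n].
pose k := fix k j := if j is j'.+1 then F (j, (k j').+1) else F (0%N, 0%N).
exists k.
  by apply: homo_ltn => [|j]; [exact: ltn_trans|have [] := FP (j.+1, (k j).+1)].
apply/cvgrPdist_lt => e e0; near=> j.
have H : `|t - r (k j)| < j.+1%:R^-1.
  by case: (j) => [|j']; [have [] := FP (0%N, 0%N)|have [] := FP (j'.+1, (k j').+1)].
by apply: lt_trans H _; near: j; exact: near_infty_natSinv_lt (PosNum e0).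
Unshelve. all: by end_near. Qed.

End SlowlyVarying.

(** * Time averages of continuous functions *)

Section OrbitAverages.
Variable R : realType.
Local Notation plane := (R * R)%type.
Implicit Types (v : plane) (phi : bounded_continuous R plane).
Local Notation s1 := (@saddle1 R).
Local Notation s2 := (@saddle2 R).
Local Notation f := (@bowen R).

Definition side_fraction v n : R :=
  n.+1%:R^-1 * \sum_(j < n.+1) (side (iter j f v))%:R.

Lemma side_fraction_ge0 v n : 0 <= side_fraction v n.
Proof. by rewrite mulr_ge0 ?invr_ge0// sumr_ge0. Qed.

Lemma side_fraction_le1 v n : side_fraction v n <= 1.
Proof.
rewrite /side_fraction mulrC ler_pdivrMr// mul1r.
apply: le_trans (_ : \sum_(j < n.+1) 1 <= _); last by rewrite sumr_const card_ord.
by apply: ler_sum => j _; case: side.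
Qed.

Lemma side_fraction_slow v :
  side_fraction v n.+1 - side_fraction v n @[n --> \oo] --> 0.
Proof.
apply/cvgrPdist_lt => e e0; near=> n.
rewrite sub0r normrN.
have -> : side_fraction v n.+1 - side_fraction v n =
    n.+2%:R^-1 * ((side (iter n.+1 f v))%:R - side_fraction v n).
  rewrite /side_fraction big_ord_recr /= -(natr1 n.+1).
  by field; apply/andP; split; apply: lt0r_neq0; have := ler0n R n; lra.
rewrite normrM ger0_norm ?invr_ge0//.
apply: le_lt_trans (_ : n.+2%:R^-1 * 1 < _).
  rewrite ler_wpM2l ?invr_ge0//; have := side_fraction_ge0 v n.
  by have := side_fraction_le1 v n; case: side => /=; rewrite ler_norml; lra.
rewrite mulr1; apply: le_lt_trans (_ : n.+1%:R^-1 < _).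
  by rewrite lef_pV2 ?posrE// ler_nat.
near: n; exact: near_infty_natSinv_lt (PosNum e0).
Unshelve. all: by end_near. Qed.

Lemma side_fraction_subsequence v (t : R) : hexagon v -> v != 0 -> 0 <= t <= 1 ->
  exists2 k : nat -> nat, {homo k : a b / (a < b)%N} &
    side_fraction v (k j) @[j --> \oo] --> t.
Proof.
move=> hv v0 /andP[t0 t1]; apply: subsequence_to.
apply: slowly_varying_hits; first exact: side_fraction_slow.
- move=> e N e0; have [n Nn h] := orbit_frequent_side false N hv v0 e0.
  exists n => //; apply: le_trans (_ : e <= _); last by rewrite lerDr.
  rewrite /side_fraction mulrC ler_pdivrMr//.
  have -> : \sum_(j < n.+1) (side (iter j f v))%:R =
      n.+1%:R - \sum_(j < n.+1) (side (iter j f v) == false)%:R :> R.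
    have -> : n.+1%:R = \sum_(j < n.+1) 1 :> R by rewrite sumr_const card_ord.
    by rewrite -sumrB; apply: eq_bigr => j _; case: side => /=; lra.
  by move: h; rewrite mulrBl mul1r; lra.
- move=> e N e0; have [n Nn h] := orbit_frequent_side true N hv v0 e0.
  exists n => //; apply: le_trans (_ : 1 - e <= _); first by rewrite lerB.
  rewrite /side_fraction mulrC ler_pdivlMr//; apply: le_trans h _.
  by apply: ler_sum => j _; case: side.
Qed.

Lemma orbit_average v phi : hexagon v -> v != 0 ->
  n.+1%:R^-1 * (\sum_(j < n.+1) sval phi (iter j f v)) -
  (side_fraction v n * sval phi s1 + (1 - side_fraction v n) * sval phi s2)
    @[n --> \oo] --> (0 : R).
Proof.
case: phi => phi [cphi [c bphi]] /= hv v0.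
apply/cvgrPdist_lt => e e0.
have near_saddle s : exists2 d, 0 < d & forall w : plane, `|w - s| < d ->
    `|phi w - phi s| < e / 2.
  have /cvgrPdist_lt/(_ (e / 2) ltac:(lra)) := cphi s.
  rewrite near_simpl => /nbhs_ballP[d /= d0 H]; exists d => // w ws.
  by rewrite distrC; apply: H; apply/plane_ballP; rewrite distrC.
have [d1 d10 H1] := near_saddle s1; have [d2 d20 H2] := near_saddle s2.
set d := Num.min d1 d2.
have d0 : 0 < d by rewrite lt_min d10.
have c0 : 0 <= c by exact: le_trans (bphi 0).
(* Within [d] of the saddle [phi] varies by less than [e / 2]; beyond, the oscillation [2 * c] is at
   most [K] times the distance. So the error averages out with [side_dist]. *)
set K := 2 * c / d.
have K0 : 0 <= K by rewrite divr_ge0 ?(ltW d0)// mulr_ge0.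
have term w : `|phi w - ((side w)%:R * phi s1 + (1 - (side w)%:R) * phi s2)| <=
    e / 2 + K * side_dist w.
  have -> : (side w)%:R * phi s1 + (1 - (side w)%:R) * phi s2 =
      phi (if side w then s1 else s2) by case: side => /=; ring.
  have far s : d <= `|w - s| -> `|phi w - phi s| <= e / 2 + K * `|w - s|.
    move=> dw; apply: le_trans (_ : c + c <= _).
      by rewrite (le_trans (ler_normB _ _))// lerD.
    have : K * d <= K * `|w - s| by rewrite ler_wpM2l.
    by rewrite divfK ?gt_eqF//; lra.
  have close s : `|phi w - phi s| < e / 2 ->`|phi w - phi s| <= e / 2 + K * `|w - s|.
    move=> h; have := mulr_ge0 K0 (normr_ge0 (w - s)); lra.
  rewrite /side_dist; case: side.
  - have [|h] := leP d `|w - s1|; first exact: far.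
    by apply/close/H1; move: h; rewrite lt_min => /andP[].
  - have [|h] := leP d `|w - s2|; first exact: far.
    by apply/close/H2; move: h; rewrite lt_min => /andP[].
have e' : 0 < e / 2 / (K + 1) by rewrite divr_gt0//; lra.
have /cvgrPdist_lt/(_ _ e') C := orbit_cesaro hv v0.
near=> n; rewrite sub0r normrN.
have Cn : n.+1%:R^-1 * (\sum_(j < n.+1) side_dist (iter j f v)) < e / 2 / (K + 1).
  have : `|0 - n.+1%:R^-1 * (\sum_(j < n.+1) side_dist (iter j f v))| < e / 2 / (K + 1).
    by near: n.
  by rewrite sub0r normrN; apply: le_lt_trans; exact: ler_norm.
have -> : n.+1%:R^-1 * (\sum_(j < n.+1) phi (iter j f v)) -
  (side_fraction v n * phi s1 + (1 - side_fraction v n) * phi s2) =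
  n.+1%:R^-1 * \sum_(j < n.+1) (phi (iter j f v) -
     ((side (iter j f v))%:R * phi s1 + (1 - (side (iter j f v))%:R) * phi s2)).
  rewrite sumrB big_split /= -!mulr_suml sumrB sumr_const card_ord /side_fraction.
  by field; apply: lt0r_neq0; have := ler0n R n; lra.
rewrite normrM ger0_norm ?invr_ge0//.
apply: le_lt_trans (_ : n.+1%:R^-1 *
    \sum_(j < n.+1) (e / 2 + K * side_dist (iter j f v)) < _).
  rewrite ler_wpM2l ?invr_ge0// (le_trans (ler_norm_sum _ _ _))//.
  by apply: ler_sum => j _; exact: term.
rewrite big_split /= sumr_const card_ord -mulr_sumr mulrDr -[(e / 2) *+ _]mulr_natl mulKf//.
rewrite mulrCA.
have S0 : 0 <= n.+1%:R^-1 * (\sum_(j < n.+1) side_dist (iter j f v)).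
  by rewrite mulr_ge0 ?invr_ge0// sumr_ge0// => j _; exact: normr_ge0.
move: Cn S0; rewrite ltr_pdivlMr; last lra.
have fin (S : R) : S * (K + 1) < e / 2 -> 0 <= S -> e / 2 + K * S < e.
  by move=> h1 h2; rewrite mulrDr mulr1 (mulrC S) in h1; lra.
exact: fin.
Unshelve. all: by end_near. Qed.

End OrbitAverages.

Lemma cvg_infty_increasing (k : nat -> nat) : {homo k : a b / (a < b)%N} ->
  k j @[j --> \oo] --> \oo.
Proof.
move=> hk; apply/cvgnyPge => A; near=> j.
have kj i : (i <= k i)%N.
  by elim: i => // i IH; apply: leq_ltn_trans IH _; exact: hk.
apply: leq_trans (kj j); near: j; exact: nbhs_infty_ge.
Unshelve. all: by end_near. Qed.

Lemma cvg_of_sub0 (R : realType) (u w : nat -> R) (l : R) :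
  u j - w j @[j --> \oo] --> 0 -> w j @[j --> \oo] --> l -> u j @[j --> \oo] --> l.
Proof.
move=> uw wl; have -> : u = (fun j => (u j - w j) + w j).
  by apply/funext => j; rewrite subrK.
by rewrite -[l]add0r; exact: cvgD.
Qed.

(** * Measures carried by two points *)

Section TwoPointMeasures.
Variable R : realType.
Local Notation plane := (R * R)%type.
Implicit Types (a b v : plane) (mu : probability (borel plane) R).

(** Bounded, continuous and zero exactly at [a] and [b]: its integral detects any mass elsewhere.
    For [a = b] it is a truncated distance, which serves for the omega-limit sets. *)
Definition tent a b v : R := Num.min 1 (Num.min `|v - a| `|v - b|).

Lemma continuous_tent a b : continuous (tent a b).
Proof.
have -> : tent a b = fun v => Num.min 1 (Num.min
    (Num.max `|v.1 - a.1| `|v.2 - a.2|) (Num.max `|v.1 - b.1| `|v.2 - b.2|)).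
  by apply/funext => v; rewrite /tent !plane_norm.
by move=> v; apply: lip_continuous; lip.
Qed.

Lemma tent_ge0 a b v : 0 <= tent a b v.
Proof. by rewrite /tent !le_min ler01 !normr_ge0. Qed.

Lemma tent_le1 a b v : tent a b v <= 1.
Proof. by rewrite /tent ge_min lexx. Qed.

Lemma tent_bounded a b : exists c : R, forall v, `|tent a b v| <= c.
Proof. by exists 1 => v; rewrite ger0_norm ?tent_le1 ?tent_ge0. Qed.

Definition tent_function a b : bounded_continuous R plane :=
  exist _ (tent a b) (conj (@continuous_tent a b) (tent_bounded a b)).

Lemma tent_l a b : tent a b a = 0.
Proof. by rewrite /tent subrr normr0 (min_l (normr_ge0 _)) min_r. Qed.

Lemma tent_r a b : tent a b b = 0.
Proof. by rewrite /tent subrr normr0 (min_r (normr_ge0 _)) min_r. Qed.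

Lemma dirac_segment_of_tent mu a b : a != b ->
  integrate mu (tent_function a b) = 0 -> dirac_segment a b mu.
Proof.
move=> ab I0.
have mtent : measurable_fun setT (EFin \o tent a b : borel plane -> \bar R).
  by apply/measurable_EFinP; apply: continuous_borel_measurable; exact: continuous_tent.
have pos : (0 <= \int[mu]_x (tent a b x)%:E)%E.
  by apply: integral_ge0 => v _; rewrite lee_fin tent_ge0.
have fin : (\int[mu]_x (tent a b x)%:E <= 1)%E.
  rewrite -(probability_setT mu) -[leRHS]mul1e.
  rewrite -(@integral_cst _ _ _ mu setT measurableT 1%E).
  by apply: ge0_le_integral => // v _; rewrite lee_fin ?tent_ge0 ?tent_le1 ?ler01.
have E0 : (\int[mu]_x (tent a b x)%:E = 0)%E.
  move: I0; rewrite /integrate /Rintegral /=.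
  by move: pos fin; case: integral => //= r _ _ ->.
have sa c : measurable ([set c] : set (borel plane)).
  by apply: measurable_closed_borel; apply: accessible_closed_set1;
    apply: hausdorff_accessible; exact: plane_hausdorff.
have offab : mu (~` [set a; b]) = 0%E.
  apply/negligibleP; first by apply: measurableC; apply: measurableU; exact: sa.
  have [+ _] := @ae_eq_integral_abs _ _ _ mu setT measurableT _ mtent.
  have -> : (\int[mu]_x `|(EFin \o tent a b) x| = 0)%E.
    by rewrite -[RHS]E0; apply: eq_integral => v _ /=; rewrite ger0_norm ?tent_ge0.
  move=> /(_ erefl); apply: (@negligibleS _ (borel plane) R mu) => v /= vab.
  move=> /(_ Logic.I)[]; rewrite /tent => h; apply: vab.
  case: (eqVneq v a) => [|va]; first by left.
  case: (eqVneq v b) => [|vb]; first by right.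
  have : 0 < tent a b v by rewrite /tent !lt_min ltr01 !normr_gt0 !subr_eq0 va.
  by rewrite /tent h ltxx.
have split_mu A : measurable (A : set (borel plane)) ->
    mu A = (mu [set a] * \d_a A + mu [set b] * \d_b A)%E.
  move=> mA.
  have part c : mu (A `&` [set c]) = (mu [set c] * \d_(c : borel plane) A)%E.
    rewrite diracE; case: (boolP (c \in A)) => [cA|cA]; rewrite ?mule1 ?mule0.
      by rewrite setIidr// => w ->; rewrite -inE.
    rewrite (_ : A `&` _ = set0) ?measure0//; apply/seteqP; split=> // w [Aw wc].
    by move/negP: cA; apply; rewrite inE -wc.
  have mab : measurable ([set a; b] : set (borel plane)) by apply: measurableU; exact: sa.
  rewrite (measureDI _ mA mab) -!part.
  rewrite [X in (X + _)%E](_ : _ = 0%E); last first.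
    apply: (@subset_measure0 _ (borel plane) R mu _ (~` [set a; b])) => //.
      exact: measurableD.
    exact: measurableC.
  rewrite add0e setIUr measureU//; last first.
  - apply/seteqP; split=> // v [[_ /= ->] [_ /= vb]].
    by move: ab; rewrite vb eqxx.
  - by apply: measurableI => //; exact: sa.
  - by apply: measurableI => //; exact: sa.
have fa c : (mu [set c] \is a fin_num) by exact: fin_num_measure.
have S1 : (mu [set a] + mu [set b] = 1)%E.
  have := split_mu setT measurableT.
  by rewrite probability_setT !diracT !mule1 => <-.
move: S1; rewrite -(fineK (fa a)) -(fineK (fa b)) -EFinD => -[S1].
exists (fine (mu [set a])).
  rewrite fine_ge0//=.
  have : 0 <= fine (mu [set b]) by exact: fine_ge0.
  by lra.
move=> A mA; rewrite (split_mu A mA) -{1}(fineK (fa a)) -{1}(fineK (fa b)).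
by have -> : fine (mu [set b]) = 1 - fine (mu [set a]) by lra.
Qed.

End TwoPointMeasures.

(** * The SRB-like measures *)

Section PhysicalMeasures.
Variable R : realType.
Local Notation plane := (R * R)%type.
Implicit Types (v : plane) (mu nu : probability (borel plane) R).
Local Notation s1 := (@saddle1 R).
Local Notation s2 := (@saddle2 R).
Local Notation f := (@bowen R).
Local Notation null := ((@vol_plane R).-negligible).

Lemma dirac_segment_limit v mu : hexagon v -> v != 0 ->
  dirac_segment s1 s2 mu -> limit_measures f v mu.
Proof.
move=> hv v0 [t t01 muE].
have [k hk kt] := side_fraction_subsequence hv v0 t01.
exists k => //; apply/weakstar_seqP => phi.
rewrite (integrate_dirac_segment phi t01 muE).
have C := cvg_comp _ _ (cvg_infty_increasing hk) (orbit_average phi hv v0).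
have D : side_fraction v (k j) * sval phi s1 + (1 - side_fraction v (k j)) * sval phi s2
    @[j --> \oo] --> t * sval phi s1 + (1 - t) * sval phi s2.
  apply: cvgD; first by apply: cvgM => //; exact: cvg_cst.
  by apply: cvgM; [apply: cvgB => //; exact: cvg_cst|exact: cvg_cst].
have := cvg_of_sub0 C D; apply: cvg_trans; apply: near_eq_cvg.
by near=> j; rewrite /= integrate_empirical.
Unshelve. all: by end_near. Qed.

Lemma limit_measures_tent v mu : hexagon v -> v != 0 ->
  limit_measures f v mu -> integrate mu (tent_function s1 s2) = 0.
Proof.
move=> hv v0 [k hk /weakstar_seqP/(_ (tent_function s1 s2)) C1].
have C := cvg_comp _ _ (cvg_infty_increasing hk) (orbit_average (tent_function s1 s2) hv v0).
apply: (cvg_unique (@Rhausdorff R) C1).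
have D : side_fraction v (k j) * tent s1 s2 s1 + (1 - side_fraction v (k j)) * tent s1 s2 s2
    @[j --> \oo] --> (0 : R).
  by under eq_fun do rewrite tent_l tent_r !mulr0 addr0; exact: cvg_cst.
have := cvg_of_sub0 C D; apply: cvg_trans; apply: near_eq_cvg.
by near=> j; rewrite /= integrate_empirical.
Unshelve. all: by end_near. Qed.

Lemma hex_norm1_boundary v : hex_norm v = 1 -> boundary_line v \/ boundary_line (antipode v).
Proof.
rewrite /hex_norm /boundary_line /= => h.
have hA (x : R) : `|x| = 1 -> x = 1 \/ - x = 1.
  by case: (lerP 0 x) => x0; [rewrite ger0_norm// => ->; left|rewrite ltr0_norm// => ->; right].
move: h; case: (lerP (Num.max `|v.1| `|v.2|) `|v.1 - v.2|) => _.
  by move=> /hA[h|h]; [left|right]; constructor 3; lra.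
case: (lerP `|v.1| `|v.2|) => _ /hA[h|h]; [left|right|left|right];
  by [constructor 2 | constructor 1].
Qed.

Lemma closure_hexagon_sub : closure (@hexagon R) `<=` [set v | hex_norm v <= 1].
Proof.
have cl : closed [set v : plane | hex_norm v <= 1].
  apply: (@closed_comp _ _ (@hex_norm R) [set a | a <= 1]); last exact: closed_le.
  by move=> v _; exact: continuous_hex_norm.
by rewrite ((closure_id _).1 cl); apply: closure_subset => v; exact: ltW.
Qed.

Lemma null_closure_hexagon :
  null (closure (@hexagon R) `\` [set v | hexagon v /\ v != 0]).
Proof.
have := negligibleU (negligibleU (null_boundary_lines R) (null_antipode_lines R))
  (null_vertical_line (0 : R)).
apply: (@negligibleS _ (borel plane) R (@vol_plane R)) => v [].
move=> /closure_hexagon_sub /=; rewrite le_eqVlt => /predU1P[h _|h].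
  by left; exact: hex_norm1_boundary.
move=> nv; right; have [->//|v0] := eqVneq v 0.
by exfalso; apply: nv.
Qed.

Lemma hexagon_not_null : ~ null [set v : plane | hexagon v /\ v != 0].
Proof.
move=> H; pose I := (`]4^-1, 2^-1[%classic : set R).
have mI : measurable (I : set (measurableTypeR R)) by exact: measurable_itv.
have : null (I `*` I).
  apply: (@negligibleS _ (borel plane) R (@vol_plane R) _ _ _ H) => -[x y] [].
  rewrite /I /= !in_itv /= => /andP[x1 x2] /andP[y1 y2]; split.
    by rewrite /hexagon /= hex_norm_box ?gt_max; lra.
  by apply/eqP => -[x0 _]; lra.
move/(measure_negligible (measurable_box_borel mI mI)) => V0.
have : vol_plane (I `*` I) = 0%E by exact: V0.
rewrite vol_plane_box// lebesgue_measure_itv /= lte_fin ifT; last by lra.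
by rewrite -EFinB -EFinM => -[]; lra.
Qed.

Lemma SRB_like_bowen (dist : probability (borel plane) R -> probability (borel plane) R -> R) :
  weakstar_metric dist ->
  SRB_like (@vol_plane R) dist f (closure (@hexagon R)) = dirac_segment s1 s2.
Proof.
move=> [dge0 d0 dsym dtri dnbhs]; apply/seteqP; split=> mu Hmu.
  apply: dirac_segment_of_tent.
    by apply/eqP => -[h _]; lra.
  (* A nonzero integral of the tent persists on a small ball around [mu]. Limit measures of orbits
     in the hexagon minus 0 have integral 0, so only a null set of points comes that close to
     [mu]. *)
  apply/eqP/negPn/negP => I0.
  have /cvgrPdist_lt/(_ `|integrate mu (tent_function s1 s2)|) :=
    @continuous_integrate R plane (tent_function s1 s2) mu.
  rewrite normr_gt0 => /(_ I0).
  move=> N; have [e /= e0 He] : filter_from [set e : R | 0 < e]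
      (fun e => [set nu | dist mu nu < e])
      [set nu | `|integrate mu (tent_function s1 s2) - integrate nu (tent_function s1 s2)| <
        `|integrate mu (tent_function s1 s2)|] by rewrite -dnbhs; exact: N.
  apply: (Hmu e e0); apply: negligibleS null_closure_hexagon => v [cv dv].
  split=> // -[hv v0].
  have [_ [nu Lnu <-]] := ereal_inf_lt dv; rewrite lte_fin => dnu.
  have := He nu; rewrite /= dsym => /(_ dnu).
  by rewrite (limit_measures_tent hv v0 Lnu) subr0 ltxx.
(* Conversely [mu] is itself a limit measure at every point of the hexagon minus 0, so the distance
   there is at most [dist mu mu = 0]. *)
move=> e e0 N; apply: hexagon_not_null.
apply: (@negligibleS _ (borel plane) R (@vol_plane R) _ _ _ N) => v [hv v0].
split; first exact: subset_closure.
apply: (@le_lt_trans _ _ (dist mu mu)%:E); last by rewrite lte_fin (d0 mu mu).2.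
by apply: ereal_inf_lbound; exists mu => //; exact: dirac_segment_limit.
Qed.

End PhysicalMeasures.

(** * The hexagon as a topological disc *)

Section BoundaryOfHexagon.
Variable R : realType.
Local Notation plane := (R * R)%type.
Implicit Types (v : plane) (r : R) (b sw : bool).

Definition branch b sw : set plane := separatrix b sw @` `[0, +oo[.

(** The map [antipode] after [swap] sends the boundary arc between the saddles to itself with
    reversed direction, and acts thus on the parameter. This identifies a punctured stable branch of
    one saddle with an unstable branch of the other. *)
Definition reparam r : R := if (r <= 1) || (2 <= r) then 2 / r else 3 - r.

Lemma reparam_gt0 r : 0 < r -> 0 < reparam r.
Proof.
move=> r0; rewrite /reparam; case: ifPn => [_|]; first by rewrite divr_gt0.
by rewrite negb_or -!ltNge => /andP[]; lra.
Qed.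

Lemma antipode_swap_arc r : 0 < r -> antipode (swap (arc r)) = arc (reparam r).
Proof.
move=> r0; rewrite /reparam; case: ifPn => [/orP[h|h]|].
- have h2 : 2 <= 2 / r by rewrite ler_pdivlMr//; lra.
  rewrite (arc1 h) (arc3 h2) /antipode /swap /=; congr pair; field.
  by rewrite gt_eqF.
- have h2 : 2 / r <= 1 by rewrite ler_pdivrMr//; lra.
  by rewrite (arc3 h) (arc1 h2) /antipode /swap /=; congr pair; ring.
- rewrite negb_or -!ltNge => /andP[/ltW h1 /ltW h2].
  rewrite (arc2 h1 h2) arc2; [|lra|lra].
  by rewrite /antipode /swap /=; congr pair; ring.
Qed.

Lemma separatrix_negb b sw r : 0 < r ->
  separatrix (~~ b) (~~ sw) r = separatrix b sw (reparam r).
Proof.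
move=> r0; rewrite /separatrix -antipode_swap_arc// /place.
by case: b; case: sw => /=; rewrite ?swap_antipode ?antipodeK ?swapK.
Qed.

Lemma branch_punctured b sw :
  branch b sw `\ separatrix b sw 0 = separatrix b sw @` `]0, +oo[.
Proof.
apply/seteqP; split=> v.
  move=> [[r /=]]; rewrite in_itv /= andbT le_eqVlt => /predU1P[<- <-//|r0 <- _].
  by exists r => //=; rewrite in_itv /= r0.
move=> [r /=]; rewrite in_itv /= andbT => r0 <-; split.
  by exists r => //=; rewrite in_itv /= (ltW r0).
by move=> /= /separatrix_inj rE; move: r0; rewrite rE ltxx.
Qed.

Lemma branch_negb b sw :
  branch (~~ b) (~~ sw) `\ separatrix (~~ b) (~~ sw) 0 = branch b sw `\ separatrix b sw 0.
Proof.
have sub b' sw' : separatrix (~~ b') (~~ sw') @` (`]0, +oo[ : set R) `<=`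
      separatrix b' sw' @` (`]0, +oo[ : set R).
  move=> v [r /=]; rewrite in_itv /= andbT => r0 <-; exists (reparam r).
    by rewrite /= in_itv /= reparam_gt0.
  by rewrite separatrix_negb.
rewrite !branch_punctured; apply/seteqP; split; first exact: sub.
by have := sub (~~ b) (~~ sw); rewrite !negbK.
Qed.

Lemma hex_norm_arc r : 0 <= r -> hex_norm (arc r) = 1.
Proof.
move=> r0; case: arcP => [h|h h'|h].
- by rewrite hex_norm_box ?max_r; lra.
- by rewrite -hex_norm_antipode hex_norm_side /=; lra.
- have h2 : 2 / r <= 1 by rewrite ler_pdivrMr; lra.
  have h0 : 0 <= 2 / r by rewrite divr_ge0.
  rewrite -hex_norm_antipode /antipode /=; move: (2 / r) h2 h0 => z h2 h0.
  by rewrite hex_norm_box ?max_l; lra.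
Qed.

Lemma arc_onto v : hex_norm v = 1 -> v.1 <= v.2 -> v != saddle2 R ->
  exists2 r, 0 <= r & arc r = v.
Proof.
case: v => x y /= h xy ns.
have [hx hy hd] : [/\ -1 <= x <= 1, -1 <= y <= 1 & -1 <= x - y <= 1].
  rewrite -!ler_norml -h /hex_norm /=.
  by split; rewrite !le_max lexx ?orbT.
have upper : y = 1 -> exists2 r, 0 <= r & arc r = (x, y).
  by move=> y1; exists (1 - x); [lra|rewrite arc1; [congr pair|]; lra].
have [[/=h'|/=h'|/=h']|[/=h'|/=h'|/=h']] := hex_norm1_boundary h.
- by apply: upper; lra.
- exact: upper.
- by exfalso; lra.
- have y1 : 0 < 1 + y.
    rewrite lt_neqAle; apply/andP; split; last by lra.
    apply/eqP => y1; move/eqP: ns; apply.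
    by rewrite /saddle2; congr pair; lra.
  exists (2 / (1 + y)); first by rewrite divr_ge0// ltW.
  rewrite arc3; last by rewrite ler_pdivlMr//; lra.
  by congr pair; [lra|field; rewrite gt_eqF].
- by exfalso; move/eqP: ns; apply; rewrite /saddle2; congr pair; lra.
- by exists (1 - x); [lra|rewrite arc2; [congr pair| |]; lra].
Qed.

Lemma branch_union :
  branch false false `|` branch true false = [set v | hex_norm v = 1].
Proof.
have onto b r : 0 <= r -> branch b false (separatrix b false r).
  by move=> r0; exists r => //=; rewrite in_itv /= r0.
apply/seteqP; split=> v.
  case=> -[r /=]; rewrite in_itv /= andbT => r0 <-.
    exact: hex_norm_arc.
  by rewrite [LHS](hex_norm_antipode (arc r)) hex_norm_arc.
move=> /= h; have [-> |n2] := eqVneq v (saddle2 R).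
  right; have -> : saddle2 R = separatrix true false 0 by rewrite /separatrix arc0.
  exact: (onto true).
have [-> |n1] := eqVneq v (saddle1 R).
  left; have -> : saddle1 R = separatrix false false 0 by rewrite /separatrix arc0.
  exact: (onto false).
have [xy|/ltW xy] := lerP v.1 v.2.
  by left; have [r r0 <-] := arc_onto h xy n2; exact: (onto false).
right; have [||| r r0 E] := @arc_onto (antipode v).
- by rewrite hex_norm_antipode.
- by rewrite /= lerN2.
- apply: contra n1 => /eqP n1; rewrite -(antipodeK v) n1 /saddle2 /antipode /=.
  by rewrite opprK.
- by rewrite -(antipodeK v) -E; exact: (onto true).
Qed.

End BoundaryOfHexagon.

(** * Radial homeomorphisms between level sets *)

Section Gauges.
Variable R : realType.
Local Notation plane := (R * R)%type.
Implicit Types (v : plane) (N : plane -> R).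

(** The comparison with the sup norm bounds the factor of [radial] and gives its continuity at 0.
    Since [radial N N'] carries each level set of [N] to that of [N'], the pair [hex_norm], [euclid]
    yields both the open disc and the closed curve. *)
Definition gauge N : Prop := [/\ continuous N, forall v, `|v| <= N v <= 2 * `|v| &
  forall k v, 0 <= k -> N (scale k v) = k * N v].

Definition radial N N' v : plane := scale (N v / N' v) v.

Lemma gauge_gt0 N v : gauge N -> v != 0 -> 0 < N v.
Proof.
by move=> [_ /(_ v)/andP[h _] _] v0; apply: lt_le_trans h; rewrite normr_gt0.
Qed.

Lemma gauge_ge0 N v : gauge N -> 0 <= N v.
Proof. by move=> [_ /(_ v)/andP[h _] _]; exact: le_trans h. Qed.

Lemma gauge0 N : gauge N -> N 0 = 0.
Proof.
move=> [_ /(_ 0)]; rewrite normr0 mulr0 => h _.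
by apply/eqP; rewrite eq_le andbC.
Qed.

Lemma gauge_radial N N' v : gauge N -> gauge N' -> N' (radial N N' v) = N v.
Proof.
move=> gN gN'; have [-> |v0] := eqVneq v 0.
  by rewrite /radial /scale /= !mulr0 !gauge0.
have [_ _ ->] := gN'; last by rewrite divr_ge0// gauge_ge0.
by rewrite divfK// gt_eqF// gauge_gt0.
Qed.

Lemma radialK N N' : gauge N -> gauge N' -> cancel (radial N N') (radial N' N).
Proof.
move=> gN gN' v; have [-> |v0] := eqVneq v 0.
  by rewrite /radial /scale /= !mulr0.
rewrite {1}/radial gauge_radial//.
have n0 := gauge_gt0 gN v0; have n0' := gauge_gt0 gN' v0.
have E : N (radial N N' v) = N v / N' v * N v.
  by case: gN => _ _ ->//; rewrite divr_ge0// ltW.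
rewrite E /radial /scale; case: v v0 n0 n0' {E} => x y /= _ n0 n0'.
by congr pair; field; rewrite !gt_eqF.
Qed.

Lemma continuous_radial N N' : gauge N -> gauge N' -> continuous (radial N N').
Proof.
move=> gN gN' v; have [-> |v0] := eqVneq v 0; last first.
  have c : {for v, continuous (fun w => N w / N' w)}.
    apply: continuousM; first by case: gN => c _ _; exact: c.
    by apply: continuousV; [rewrite gt_eqF// gauge_gt0|case: gN' => c _ _; exact: c].
  have c1 : {for v, continuous (fun w => N w / N' w * w.1)}.
    by apply: continuousM; [exact: c|apply: lip_continuous; lip].
  have c2 : {for v, continuous (fun w => N w / N' w * w.2)}.
    by apply: continuousM; [exact: c|apply: lip_continuous; lip].
  exact: cvg_pair c1 c2.
apply/cvgrPdist_lt => e e0.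
have r0 : radial N N' 0 = 0 by rewrite /radial /scale /= !mulr0.
have small : \forall w \near (0 : plane), `|0 - w| < e / 2.
  apply/nbhs_ballP; exists (e / 2); first by rewrite /= divr_gt0.
  by move=> w /plane_ballP.
near=> w; rewrite r0 sub0r normrN.
have [-> |w0] := eqVneq w 0; first by rewrite r0 normr0.
have n0 := gauge_gt0 gN w0; have n0' := gauge_gt0 gN' w0.
have q0 : 0 <= N w / N' w by rewrite divr_ge0// ltW.
have q2 : N w / N' w <= 2.
  rewrite ler_pdivrMr//; case: gN => _ /(_ w)/andP[_ h] _; apply: le_trans h _.
  by case: gN' => _ /(_ w)/andP[h _] _; lra.
apply: le_lt_trans (_ : 2 * `|w| < _).
  rewrite [`|w|]plane_norm [leLHS]plane_norm /radial /scale /= !(normrM (N w / N' w)) (ger0_norm q0) -maxr_pMr//.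
  by rewrite ler_wpM2r// le_max normr_ge0.
rewrite mulrC -ltr_pdivlMr//.
have -> : `|w| = `|0 - w| by rewrite sub0r normrN.
by near: w.
Unshelve. all: by end_near. Qed.

Lemma homeo_radial N N' (I : set R) : gauge N -> gauge N' ->
  homeo_between (radial N N') (radial N' N) (N @^-1` I) (N' @^-1` I).
Proof.
move=> gN gN'; have sub M M' : gauge M -> gauge M' ->
    radial M M' @` (M @^-1` I) `<=` M' @^-1` I.
  by move=> gM gM' _ [v /= Iv <-]; rewrite /preimage /= gauge_radial.
split.
- by apply: continuous_subspaceT; exact: continuous_radial.
- by apply: continuous_subspaceT; exact: continuous_radial.
- apply/seteqP; split; first exact: sub.
  move=> v /= Iv; exists (radial N' N v); last by rewrite radialK.
  by rewrite /preimage /= gauge_radial.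
- apply/seteqP; split; first exact: sub.
  move=> v /= Iv; exists (radial N N' v); last by rewrite radialK.
  by rewrite /preimage /= gauge_radial.
- by move=> v _; rewrite radialK.
Qed.

Lemma gauge_hex_norm : gauge (@hex_norm R).
Proof.
split=> [|[x y]|]; [exact: continuous_hex_norm| |by move=> k v k0; exact: hex_norm_scale].
rewrite plane_norm /hex_norm /= le_max lexx /= !ge_max.
have X : `|x| <= Num.max `|x| `|y| by rewrite le_max lexx.
have Y : `|y| <= Num.max `|x| `|y| by rewrite le_max lexx orbT.
have D := ler_normB x y.
by move: (normr_ge0 x) X Y D; set m := Num.max _ _ => h0 h1 h2 h3; apply/andP; split; lra.
Qed.

Definition euclid v : R := Num.sqrt (v.1 ^+ 2 + v.2 ^+ 2).

Lemma gauge_euclid : gauge euclid.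
Proof.
have sq (z : R) : `|z| ^+ 2 = z ^+ 2 by rewrite real_normK// num_real.
split=> [v|[x y]|k [x y] k0].
- apply: (@continuous_comp _ _ _ (fun v : plane => v.1 ^+ 2 + v.2 ^+ 2) Num.sqrt).
    by apply: lip_continuous; rewrite /GRing.exp /=; lip.
  exact: sqrt_continuous.
- rewrite plane_norm /euclid /=; apply/andP; split.
    rewrite ge_max; apply/andP; split; rewrite -sqrtr_sqr ler_wsqrtr//.
      by rewrite lerDl sqr_ge0.
    by rewrite lerDr sqr_ge0.
  have X : `|x| <= Num.max `|x| `|y| by rewrite le_max lexx.
  have Y : `|y| <= Num.max `|x| `|y| by rewrite le_max lexx orbT.
  move: (normr_ge0 x) (normr_ge0 y) X Y; set m := Num.max _ _ => x0 y0 X Y.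
  rewrite -[leRHS]ger0_norm ?mulr_ge0// ?(le_trans x0)// -sqrtr_sqr ler_wsqrtr//.
  by rewrite -(sq x) -(sq y); nra.
- rewrite /euclid /= !exprMn -mulrDr sqrtrM ?sqr_ge0// sqrtr_sqr ger0_norm//.
Qed.

Lemma unit_circle_euclid : @unit_circle R = euclid @^-1` [set 1].
Proof.
apply/seteqP; split=> v; rewrite /unit_circle /preimage /euclid /=.
  by move=> ->; rewrite sqrtr1.
have s0 : 0 <= v.1 ^+ 2 + v.2 ^+ 2 by rewrite addr_ge0// sqr_ge0.
by move=> h; rewrite -(sqr_sqrtr s0) h expr1n.
Qed.

Lemma open_disc_euclid : @open_disc R = euclid @^-1` [set a | a < 1].
Proof.
apply/seteqP; split=> v; rewrite /open_disc /preimage /euclid /=.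
  by move=> h; rewrite -sqrtr1 ltr_sqrt.
by rewrite -{1}sqrtr1 ltr_sqrt.
Qed.

Lemma closure_hexagon : closure (@hexagon R) = [set v | hex_norm v <= 1].
Proof.
apply/seteqP; split; first exact: closure_hexagon_sub.
move=> v /= h; have v0 := gauge_ge0 v gauge_hex_norm.
apply: (@closed_cvg _ _ \oo _ (fun n => scale (1 - n.+1%:R^-1) v)); last first.
- have s1 : (1 - n.+1%:R^-1 : R) @[n --> \oo] --> (1 : R).
    rewrite -[X in _ --> X]subr0; apply: cvgB; first exact: cvg_cst.
    exact: cvg_harmonic.
  have sc (z : R) : (1 - n.+1%:R^-1) * z @[n --> \oo] --> 1 * z.
    by apply: cvgM => //; exact: cvg_cst.
  have C : scale (1 - n.+1%:R^-1) v @[n --> \oo] --> ((1 * v.1, 1 * v.2) : plane).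
    exact: cvg_pair (sc v.1) (sc v.2).
  by move: C; rewrite !mul1r; case: (v).
- near=> n; apply: subset_closure; rewrite /hexagon /= hex_norm_scale.
    apply: le_lt_trans (_ : (1 - n.+1%:R^-1) * 1 < 1).
      by rewrite ler_wpM2l// subr_ge0 invf_le1// ler1n.
    by rewrite mulr1 ltrBlDr ltrDl invr_gt0.
  by rewrite subr_ge0 invf_le1// ler1n.
- exact: closed_closure.
Unshelve. all: by end_near. Qed.

Lemma closure_diff_hexagon : closure (@hexagon R) `\` (@hexagon R)^° =
  @branch R false false `|` @branch R true false.
Proof.
rewrite branch_union closure_hexagon (interior_id _).1; last exact: hexagon_open.
apply/seteqP; split=> v; rewrite /hexagon /=.
  by move=> [h /negP]; rewrite -leNgt => h'; apply/eqP; rewrite eq_le h.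
by move=> h; rewrite h ltxx lexx.
Qed.

End Gauges.

(** * Hyperbolicity of the fixed points *)

Section PlaneMatrices.
Variable F : fieldType.
Implicit Types (a b c d z : F).

Definition mat2 a b c d : 'M[F]_2 := \matrix_(i, j)
  if i == ord0 then (if j == ord0 then a else b) else if j == ord0 then c else d.

Lemma mul_mat2 (v : 'rV[F]_2) a b c d :
  v *m mat2 a b c d = \row_j (if j == ord0 then v ord0 ord0 * a + v ord0 (lift ord0 ord0) * c
    else v ord0 ord0 * b + v ord0 (lift ord0 ord0) * d).
Proof.
by apply/rowP => j; rewrite !mxE big_ord_recl big_ord1 !mxE /=; case: ifP.
Qed.

Lemma eigenvalue_mat2 a b c d z : eigenvalue (mat2 a b c d) z -> (a - z) * (d - z) = b * c.
Proof.
move/eigenvalueP => [v]; rewrite mul_mat2 => /rowP E v0.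
have E0 := E ord0; have E1 := E (lift ord0 ord0); rewrite !mxE /= in E0 E1.
move: E0 E1; set x := v ord0 ord0; set y := v ord0 (lift ord0 ord0) => E0 E1.
apply/eqP; rewrite -subr_eq0; apply/negPn/negP => D.
have [x0 y0] : x = 0 /\ y = 0.
  split; apply: (mulfI D); rewrite mulr0.
    have : (x * a + y * c - z * x) * (d - z) - (x * b + y * d - z * y) * c = 0.
      by rewrite E0 E1 !subrr !mul0r subrr.
    by move=> <-; ring.
  have : (x * b + y * d - z * y) * (a - z) - (x * a + y * c - z * x) * b = 0.
    by rewrite E0 E1 !subrr !mul0r subrr.
  by move=> <-; ring.
move/eqP: v0; apply; apply/rowP; apply: ord2P; rewrite mxE //.
Qed.

Lemma eigenvalue_diag1 a d : eigenvalue (mat2 a 0 0 d) a.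
Proof.
apply/eigenvalueP; exists (\row_j (j == ord0)%:R).
  by rewrite mul_mat2; apply/rowP; apply: ord2P; rewrite !mxE /=; ring.
by apply/eqP => /rowP /(_ ord0); rewrite !mxE /= => /eqP; rewrite oner_eq0.
Qed.

Lemma eigenvalue_diag2 a d : eigenvalue (mat2 a 0 0 d) d.
Proof.
apply/eigenvalueP; exists (\row_j (j != ord0)%:R).
  by rewrite mul_mat2; apply/rowP; apply: ord2P; rewrite !mxE /=; ring.
by apply/eqP => /rowP /(_ (lift ord0 ord0)); rewrite !mxE /= => /eqP; rewrite oner_eq0.
Qed.

End PlaneMatrices.

Lemma map_mat2 (F K : fieldType) (f : F -> K) a b c d :
  map_mx f (mat2 a b c d) = mat2 (f a) (f b) (f c) (f d).
Proof. by apply/matrixP => i j; rewrite !mxE; do ! case: ifP. Qed.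

Section Hyperbolicity.
Variable R : realType.
Local Notation plane := (R * R)%type.
Local Notation C := R[i].

Lemma saddle_mx_diag : saddle_mx (mat2 2^-1 0 0 2 : 'M[R]_2).
Proof.
have E : map_mx (real_complex R) (mat2 2^-1 0 0 2) = mat2 2^-1 0 0 2.
  by rewrite map_mat2 rmorph0; congr mat2; [rewrite fmorphV; congr GRing.inv|]; exact: (rmorph_nat (real_complex R) 2).
have n2 : `|2 : C| = 2 by rewrite normr_nat.
have nh : `|2^-1 : C| = 2^-1 by rewrite normfV n2.
have h1 : (2^-1 : C) < 1 by rewrite invf_lt1// ltr1n.
have h2 : (1 : C) < 2 by rewrite ltr1n.
rewrite /saddle_mx /spectrum /= E; split=> [z /eigenvalue_mat2|  |].
- rewrite mulr0 => /eqP; rewrite mulf_eq0 !subr_eq0 => /orP[|] /eqP <-.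
    by rewrite nh lt_eqF.
  by rewrite n2 gt_eqF.
- by exists 2^-1; [exact: eigenvalue_diag1|rewrite nh].
- by exists 2; [exact: eigenvalue_diag2|rewrite n2].
Qed.

Lemma source_mx_rotation : source_mx (mat2 0 2 (- 2) 0 : 'M[R]_2).
Proof.
move=> z; rewrite /spectrum /=.
have -> : map_mx (real_complex R) (mat2 0 2 (- 2) 0) = mat2 0 2 (- 2) 0.
  rewrite map_mat2 rmorph0; congr mat2; last (rewrite rmorphN; congr GRing.opp);
    exact: (rmorph_nat (real_complex R) 2).
move/eigenvalue_mat2 => E.
have zz : z ^+ 2 = - 4 by move: E; rewrite !sub0r mulrNN expr2 => ->; ring.
have : `|z| ^+ 2 = 2 ^+ 2 by rewrite -normrX zz normrN normr_nat -natrX.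
move/eqP; rewrite eqrXn2// => /eqP ->; by rewrite ltr1n.
Qed.

Definition affine_map (a b c a' b' c' : R) (v : plane) : plane :=
  (affine a b c v, affine a' b' c' v).

Lemma coord_affine_map a b c a' b' c' :
  (coord ord0 \o affine_map a b c a' b' c' = affine a b c) /\
  (coord (lift ord0 ord0) \o affine_map a b c a' b' c' = affine a' b' c').
Proof. by []. Qed.

Lemma continuous_affine_map a b c a' b' c' : continuous (affine_map a b c a' b' c').
Proof. by move=> v; apply: lip_continuous; rewrite /affine_map /affine; lip. Qed.

Lemma jacobian_near_affine (G : plane -> plane) (p : plane) a b c a' b' c' :
  (\forall v \near p, G v = affine_map a b c a' b' c' v) ->
  jacobian_mx G p = mat2 a b a' b'.
Proof.
move=> GE; apply/matrixP => i j; rewrite !mxE.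
have -> : 'D_(basis_vector R j) (coord i \o G) p =
    'D_(basis_vector R j) (coord i \o affine_map a b c a' b' c') p.
  by apply: near_eq_derive; near=> v; rewrite /=; congr coord; near: v.
move: i; apply: ord2P; rewrite ?(coord_affine_map _ _ _ _ _ _).1
  ?(coord_affine_map _ _ _ _ _ _).2 (derive_affine _ _ _ p _).2;
  move: j; apply: ord2P => /=; ring.
Unshelve. all: by end_near. Qed.

Lemma C1_affine_map (O : set plane) a b c a' b' c' :
  C1_map (M := plane_surface R) O (affine_map a b c a' b' c').
Proof.
move=> p _; split; first exact: continuous_affine_map.
move=> [] [] _ _; exists setT; split; [exact: openT|by []|].
have -> : local_map (M := plane_surface R) tt tt (affine_map a b c a' b' c') =
  affine_map a b c a' b' c' by [].
apply: ord2P; rewrite ?(coord_affine_map _ _ _ _ _ _).1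
  ?(coord_affine_map _ _ _ _ _ _).2; exact: Ck_affine.
Qed.

Definition locally_affine_at (G : plane -> plane) (p : plane) : Prop :=
  exists O a b c a' b' c', [/\ open O, O p &
    forall v, O v -> affine_map a b c a' b' c' v = G v].

Lemma C1_on_locally_affine (K : set plane) G :
  (forall p, K p -> locally_affine_at G p) -> C1_on (M := plane_surface R) K G.
Proof.
move=> KG p /KG [] O [a [b [c [a' [b' [c' [oO Op OG]]]]]]].
exists O, (affine_map a b c a' b' c'); split => //; first exact: C1_affine_map.
by move=> q [Oq _]; exact: OG.
Qed.

End Hyperbolicity.

(** * Limit sets of orbits *)

Section OmegaLimits.
Variable R : realType.
Local Notation plane := (R * R)%type.
Implicit Types (v s : plane).

Lemma sum_eventually_ge (d : nat -> R) (m : R) N n : 0 <= m -> (forall j, 0 <= d j) ->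
  (forall j, (N <= j)%N -> m <= d j) -> m * (n%:R - N%:R) <= \sum_(j < n) d j.
Proof.
move=> m0 d0 dm; elim: n => [|n IH].
  by rewrite big_ord0 sub0r mulrN oppr_le0 mulr_ge0.
rewrite big_ord_recr /= -natr1; have [Nn|nN] := leqP N n.
  have := dm _ Nn; move: IH; move: (\sum_(j < n) d j) => S; lra.
apply: le_trans (_ : 0 <= _); last by rewrite addr_ge0// sumr_ge0.
by rewrite mulr_ge0_le0// natr1 subr_le0 ler_nat.
Qed.

(** Otherwise the truncated distance to [s] is at least [m] from some time [N] on, and averages over
    more than [2 * N] terms are at least [m / 2]. *)
Lemma cluster_of_average (u : nat -> plane) (k : nat -> nat) s :
  {homo k : a b / (a < b)%N} ->
  (k j).+1%:R^-1 * (\sum_(i < (k j).+1) tent s s (u i)) @[j --> \oo] --> (0 : R) ->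
  cluster (u n @[n --> \oo]) s.
Proof.
move=> hk avg A B [N _ AN] /nbhs_ballP[e /= e0 eB].
pose m := Num.min 1 e.
have m0 : 0 < m by rewrite lt_min ltr01.
apply: contrapT => /forallNP AB.
have far j : (N <= j)%N -> m <= tent s s (u j).
  move=> Nj; rewrite /tent minxx /m le_min !ge_min lexx /=; apply/orP; right; rewrite leNgt.
  apply/negP => h; apply: (AB (u j)); split; first exact: (AN j Nj).
  by apply: eB; apply/plane_ballP; rewrite distrC.
have /cvgrPdist_lt/(_ (m / 2)) := avg; rewrite divr_gt0// => /(_ isT) small.
have large := cvg_infty_increasing hk; move/cvgnyPge: large => /(_ (2 * N)%N) large.
have [j [h1 h2]] : exists j, `|0 - (k j).+1%:R^-1 * (\sum_(i < (k j).+1) tent s s (u i))| < m / 2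
    /\ (2 * N <= k j)%N.
  exact: filter_ex (filterI small large).
move: h1; rewrite sub0r normrN => /(le_lt_trans (ler_norm _)).
rewrite mulrC ltr_pdivrMr// => h1.
have := @sum_eventually_ge (fun i => tent s s (u i)) m N (k j).+1 (ltW m0)
  (fun i => tent_ge0 _ _ _) far.
have h3 : 2 * N%:R <= (k j)%:R :> R by rewrite -natrM ler_nat.
have : m * (2 * N%:R) <= m * (k j)%:R by rewrite ler_pM2l.
move: h1; rewrite -(natr1 (k j)); move: (\sum_(_ < _) _) => S; lra.
Qed.

(** Along a subsequence whose [side_fraction] tends to 1 or to 0, the average truncated distance to
    the corresponding saddle tends to 0. *)
Lemma omega_limit_bowen v (b : bool) : hexagon v -> v != 0 ->
  cluster (iter n (@bowen R) v @[n --> \oo]) (if b then saddle1 R else saddle2 R).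
Proof.
move=> hv v0; have t01 : 0 <= (b%:R : R) <= 1 by case: b; rewrite ?lexx ?ler01.
have [k hk kt] := side_fraction_subsequence hv v0 t01.
apply: (cluster_of_average hk); set s := if b then _ else _.
have C := cvg_comp _ _ (cvg_infty_increasing hk) (orbit_average (tent_function s s) hv v0).
apply: (cvg_of_sub0 C) => /=.
have -> : 0 = b%:R * tent s s (saddle1 R) + (1 - b%:R) * tent s s (saddle2 R) :> R.
  by rewrite /s; case: (b); rewrite /= ?tent_l ?subrr ?subr0 ?mul0r ?mulr0 ?addr0.
apply: cvgD; first by apply: cvgM => //; exact: cvg_cst.
by apply: cvgM; [apply: cvgB => //; exact: cvg_cst|exact: cvg_cst].
Qed.

Lemma cluster_cvg (u : nat -> plane) s : u n @[n --> \oo] --> s ->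
  cluster (u n @[n --> \oo]) = [set s].
Proof.
move=> us; apply/seteqP; split=> [w cw|_ ->].
  by rewrite /=; apply/esym; apply: (@plane_hausdorff R); apply: (cvg_cluster us).
move=> A B FA sB; apply: (@filter_ex _ (u n @[n --> \oo])).
exact: filterI FA (us _ sB).
Qed.

End OmegaLimits.

(** * Affine forms near the fixed points *)

Section LocalForms.
Variable R : realType.
Local Notation plane := (R * R)%type.
Implicit Types (v : plane).
Local Notation f := (@bowen R).
Local Notation g := (@bowen_inv R).

Let corner (a b : R) : set plane := [set v | a < v.1] `&` [set v | b < v.2].

Let open_corner a b : open (corner a b).
Proof.
apply: openI.
  apply: (@open_comp _ _ fst [set x : R | a < x]); last exact: open_gt.
  by move=> v _; apply: lip_continuous; exact: lip_fst.
apply: (@open_comp _ _ snd [set x : R | b < x]); last exact: open_gt.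
by move=> v _; apply: lip_continuous; exact: lip_snd.
Qed.

Let open_antipode (A : set plane) : open A -> open (@antipode R @^-1` A).
Proof.
move=> oA; apply: open_comp => // v _; apply: lip_continuous; exact: lip_antipode.
Qed.

Let open_norm1 (a : R) : open [set v : plane | norm1 v < a].
Proof.
apply: (@open_comp _ _ (@norm1 R) [set x : R | x < a]); last exact: open_lt.
by move=> v _; apply: lip_continuous; rewrite /norm1; lip.
Qed.

(** The bound 5/8 is where [2 * Y] alone reaches the 5/4 of [bowen_box]. *)
Let bowen_corner v : corner 0 (5 / 8) v ->
  affine_map 2^-1 0 2^-1 0 2 (- 1) v = f v.
Proof.
case: v => X Y [/= X0 Y0]; rewrite bowen_box; [|lra|lra|lra].
by rewrite /affine_map /affine /=; congr pair; lra.
Qed.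

Let bowen_corner_antipode v : corner 0 (5 / 8) (antipode v) ->
  affine_map 2^-1 0 (- 2^-1) 0 2 1 v = f v.
Proof.
move/bowen_corner; rewrite bowen_antipode => /(congr1 (@antipode R)); rewrite antipodeK => <-.
by rewrite /affine_map /affine /antipode /=; congr pair; lra.
Qed.

Let bowen_center v : norm1 v < 4^-1 -> affine_map 0 2 0 (- 2) 0 0 v = f v.
Proof.
move/ltW/bowen_source => ->.
by rewrite /affine_map /affine /=; congr pair; lra.
Qed.

Let inv_corner v : corner 2^-1 4^-1 v -> affine_map 2 0 (- 1) 0 2^-1 2^-1 v = g v.
Proof.
case: v => X Y [/= X0 Y0]; rewrite bowen_inv_box; [|lra|lra].
by rewrite /affine_map /affine /=; congr pair; lra.
Qed.

Let inv_corner_antipode v : corner 2^-1 4^-1 (antipode v) ->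
  affine_map 2 0 1 0 2^-1 (- 2^-1) v = g v.
Proof.
move/inv_corner; rewrite bowen_inv_antipode => /(congr1 (@antipode R)); rewrite antipodeK => <-.
by rewrite /affine_map /affine /antipode /=; congr pair; lra.
Qed.

Let inv_center v : norm1 v < 2^-1 -> affine_map 0 (- 2^-1) 0 2^-1 0 0 v = g v.
Proof.
move/ltW/bowen_inv_source => ->.
by rewrite /affine_map /affine /=; congr pair; lra.
Qed.

Lemma hyperbolic_saddle1 : hyperbolic_saddle (M := plane_surface R) f (saddle1 R).
Proof.
move=> i _; rewrite /local_map.
rewrite (_ : jacobian_mx _ _ = mat2 2^-1 0 0 2); first exact: saddle_mx_diag.
apply: (@jacobian_near_affine R _ (saddle1 R) _ _ (2^-1) _ _ (- 1)).
near=> v; rewrite bowen_corner//; near: v.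
by apply: open_nbhs_nbhs; split; [exact: open_corner|split => /=; lra].
Unshelve. all: by end_near. Qed.

Lemma hyperbolic_saddle2 : hyperbolic_saddle (M := plane_surface R) f (saddle2 R).
Proof.
move=> i _; rewrite /local_map.
rewrite (_ : jacobian_mx _ _ = mat2 2^-1 0 0 2); first exact: saddle_mx_diag.
apply: (@jacobian_near_affine R _ (saddle2 R) _ _ (- 2^-1) _ _ 1).
near=> v; rewrite bowen_corner_antipode//; near: v.
apply: open_nbhs_nbhs; split; first by apply: open_antipode; exact: open_corner.
by split => /=; lra.
Unshelve. all: by end_near. Qed.

Lemma hyperbolic_center : hyperbolic_source (M := plane_surface R) f 0.
Proof.
move=> i _; rewrite /local_map.
rewrite (_ : jacobian_mx _ _ = mat2 0 2 (- 2) 0); first exact: source_mx_rotation.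
apply: (@jacobian_near_affine R _ 0 _ _ 0 _ _ 0).
near=> v; rewrite bowen_center//; near: v.
apply: open_nbhs_nbhs; split; first exact: open_norm1.
by rewrite /= /norm1 /= normr0; lra.
Unshelve. all: by end_near. Qed.

Definition square (a b : R) : set plane := `[a, b] `*` `[a, b].

Lemma compact_square a b : compact (square a b).
Proof. by apply: compact_setX; exact: segment_compact. Qed.

Lemma nbhs_square a b (v : plane) : a < v.1 < b -> a < v.2 < b -> nbhs v (square a b).
Proof.
move=> /andP[a1 b1] /andP[a2 b2].
have nb (x : R) : a < x -> x < b -> nbhs x (`[a, b]%classic : set R).
  move=> ax xb; have : nbhs x (`]a, b[%classic : set R).
    by apply: open_nbhs_nbhs; split; [exact: interval_open|rewrite /= in_itv /= ax].
  by apply: filterS => y; rewrite /= !in_itv /= => /andP[/ltW -> /ltW ->].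
by exists ((`[a, b]%classic : set R), (`[a, b]%classic : set R)) => //; split; exact: nb.
Qed.

(** The squares are so small that [bowen] is affine near each of their points and [bowen_inv] near
    each of their images; around the source, [norm1] is at most 1/8 and at most doubles. *)
Lemma diffeo_bowen : diffeo_on (M := plane_surface R)
  (square (3 / 4) (5 / 4) `|` square (- (5 / 4)) (- (3 / 4)) `|`
   square (- 16^-1) 16^-1) f g.
Proof.
have n1 (x y e : R) : - e <= x <= e -> - e <= y <= e -> `|x| + `|y| <= 2 * e.
  by rewrite -!ler_norml; lra.
split; apply: C1_on_locally_affine => p.
  case=> [[]|] [/=]; rewrite !in_itv /= => /andP[x1 x2] /andP[y1 y2].
  - exists (corner 0 (5 / 8)), 2^-1, 0, 2^-1, 0, 2, (- 1); split => //.
    + by split => /=; lra.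
  - exists (@antipode R @^-1` corner 0 (5 / 8)), 2^-1, 0, (- 2^-1), 0, 2, 1; split => //.
    + by apply: open_antipode; exact: open_corner.
    + by split => /=; lra.
  - exists [set v | norm1 v < 4^-1], 0, 2, 0, (- 2), 0, 0; split => //.
    + have := n1 p.1 p.2 16^-1; rewrite x1 x2 y1 y2 => /(_ isT isT).
      by rewrite /= /norm1; lra.
case=> q Kq <-; case: Kq => [[]|] [/=]; rewrite !in_itv /= => /andP[x1 x2] /andP[y1 y2].
- exists (corner 2^-1 4^-1), 2, 0, (- 1), 0, 2^-1, 2^-1; split => //.
  + rewrite -bowen_corner; last by split => /=; lra.
    by rewrite /affine_map /affine; split => /=; lra.
- exists (@antipode R @^-1` corner 2^-1 4^-1), 2, 0, 1, 0, 2^-1, (- 2^-1); split => //.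
  + by apply: open_antipode; exact: open_corner.
  + rewrite -bowen_corner_antipode; last by split => /=; lra.
    by rewrite /affine_map /affine; split => /=; lra.
- have nq := n1 q.1 q.2 16^-1; rewrite x1 x2 y1 y2 in nq; have {nq} := nq isT isT => nq.
  exists [set v | norm1 v < 2^-1], 0, (- 2^-1), 0, 2^-1, 0, 0; split => //.
  + rewrite bowen_source; last by rewrite /norm1; lra.
    rewrite /= /norm1 /= normrN !normrM (ger0_norm (ler0n R 2)); lra.
Qed.

End LocalForms.

(** * The Bowen homeomorphism *)

Section BowenHomeomorphism.
Variable R : realType.
Local Notation plane := (R * R)%type.
Local Notation M := (plane_surface R).
Local Notation f := (@bowen R).
Local Notation g := (@bowen_inv R).
Local Notation s1 := (saddle1 R).
Local Notation s2 := (saddle2 R).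

Lemma saddle1_neq0 : s1 != 0.
Proof. by apply/eqP => -[h _]; lra. Qed.

Lemma saddle2_neq0 : s2 != 0.
Proof. by apply/eqP => -[h _]; lra. Qed.

Lemma saddle1_neq2 : s1 != s2.
Proof. by apply/eqP => -[h _]; lra. Qed.

Lemma antipode_saddle1 : antipode s1 = s2.
Proof. by []. Qed.

Lemma bowen_saddle1 : f s1 = s1.
Proof. by rewrite /saddle1 bowen_box; [congr pair|..]; lra. Qed.

Lemma bowen_saddle2 : f s2 = s2.
Proof. by rewrite -antipode_saddle1 bowen_antipode bowen_saddle1. Qed.

Lemma separatrix_base b sw : separatrix b sw 0 = if b then s2 else s1.
Proof. by rewrite /separatrix arc0; case: b; case: sw. Qed.

Lemma half_branch_stable b :
  half_branch (M := M) (stable_manifold (M := M) f (if b then s2 else s1))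
    (if b then s2 else s1) (branch b false).
Proof.
have := separatrix_half_branch R b false.
by rewrite -stable_set_bowen separatrix_base.
Qed.

Lemma half_branch_unstable b :
  half_branch (M := M) (stable_manifold (M := M) g (if b then s2 else s1))
    (if b then s2 else s1) (branch b true).
Proof.
have := separatrix_half_branch R b true.
by rewrite -stable_set_bowen_inv separatrix_base.
Qed.

Lemma homeo_bowen : homeo_between f g setT setT.
Proof.
split.
- by apply: continuous_subspaceT; exact: continuous_bowen.
- by apply: continuous_subspaceT; exact: continuous_bowen_inv.
- by apply/seteqP; split=> // v _; exists (g v) => //; exact: bowen_invK.
- by apply/seteqP; split=> // v _; exists (f v) => //; exact: bowenK.
- by move=> v _; exact: bowenK.
Qed.

Lemma disjoint_square (a b c d : R) : b < c -> square a b `&` square c d = set0.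
Proof.
move=> bc; apply/seteqP; split=> // -[x y] [[/= + _] [/= + _]].
by rewrite !in_itv /=; lra.
Qed.

Lemma bowen_homeomorphism_bowen : bowen_homeomorphism (M := M) f s1 s2 0 (@hexagon R).
Proof.
exists g; split; first exact: homeo_bowen.
split; first by move=> A mA; exact: bowen_nonsingular.
split; first by split; [exact: bowen_saddle1|exact: bowen_saddle2|exact: bowen0].
split; first by split; apply/eqP;
  [exact: saddle1_neq2|exact: saddle1_neq0|exact: saddle2_neq0].
split.
  exists (square (3 / 4) (5 / 4)), (square (- (5 / 4)) (- (3 / 4))),
    (square (- 16^-1) 16^-1).
  split; first by split; apply: nbhs_square => /=; lra.
  split; first by split; exact: compact_square.
  split; last exact: diffeo_bowen.
  split; [rewrite setIC|rewrite setIC|]; apply: disjoint_square; lra.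
split.
  by split; [exact: hyperbolic_saddle1|exact: hyperbolic_saddle2|exact: hyperbolic_center].
split.
  exists (branch false false), (branch false true), (branch true false), (branch true true).
  split.
    split; [exact: (half_branch_stable false)|exact: (half_branch_unstable false)
      |exact: (half_branch_stable true)|exact: (half_branch_unstable true)].
  have base b sw : separatrix b sw 0 = if b then s2 else s1 by exact: separatrix_base.
  split; first by have := @branch_negb R true true; rewrite !base.
  split; first by have := @branch_negb R true false; rewrite !base.
  split; last exact: closure_diff_hexagon.
  exists (radial (@euclid R) (@hex_norm R)), (radial (@hex_norm R) (@euclid R)).
  rewrite unit_circle_euclid branch_union.
  exact: (@homeo_radial R _ _ [set 1] (@gauge_euclid R) (@gauge_hex_norm R)).
split; first exact: hexagon_open.
split.
  exists (radial (@hex_norm R) (@euclid R)), (radial (@euclid R) (@hex_norm R)).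
  rewrite open_disc_euclid.
  exact: (@homeo_radial R _ _ [set a | a < 1] (@gauge_hex_norm R) (@gauge_euclid R)).
split; first by rewrite /hexagon /= gauge0 ?ltr01//; exact: gauge_hex_norm.
move=> v hv /eqP v0; split.
- exact: (@omega_limit_bowen R v true).
- exact: (@omega_limit_bowen R v false).
- by apply: cluster_cvg; exact: iter_bowen_inv_cvg0.
Qed.

Lemma bowen_closure_hexagon : closure (@hexagon R) `<=` f @^-1` closure (@hexagon R).
Proof.
have cl : closed (f @^-1` closure (@hexagon R)).
  apply: closed_comp; last exact: closed_closure.
  by move=> v _; exact: continuous_bowen.
rewrite [X in _ `<=` X]((closure_id _).1 cl); apply: closure_subset => v hv.
by apply: subset_closure; have [] := bowen_hexagon hv.
Qed.

Lemma closure_hexagon_not_null : ~ (@vol_plane R).-negligible (closure (@hexagon R)).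
Proof.
move=> N; apply: (@hexagon_not_null R).
apply: (@negligibleS _ (borel plane) R (@vol_plane R) _ _ _ N) => v [hv _].
exact: subset_closure.
Qed.

End BowenHomeomorphism.

Theorem mainTheorem7 (R : realType) :
  exists (M : riemannian_surface R) (f : M -> M) (x1 x2 x3 : M) (V : set M),
    bowen_homeomorphism f x1 x2 x3 V /\
    closure V `<=` f @^-1` closure V /\
    ~ (vol M).-negligible (closure V) /\
    forall dist : probability (borel M) R -> probability (borel M) R -> R,
      weakstar_metric dist ->
      SRB_like (vol M) dist f (closure V) = dirac_segment x1 x2.
Proof.
exists (plane_surface R), (@bowen R), (saddle1 R), (saddle2 R), 0, (@hexagon R).
split; first exact: bowen_homeomorphism_bowen.
split; first exact: bowen_closure_hexagon.
split; first exact: closure_hexagon_not_null.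
move=> dist; exact: SRB_like_bowen.
Qed.
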